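(* Let $I=(a,b)$ be a bounded interval of the real axis, let $\beta,\gamma\in[-1/2,1/2]$, $\omega(x)=(x-a)^{\beta}(b-x)^{\gamma}$, $M(\beta,\gamma)<p<m(\beta,\gamma)$, $\alpha\in(0,1)$, and let $\psi\in L_p(I,\omega)$ have Jacobi coefficients $\psi_n$, $n\in\mathbb{N}_0$. Then $I_{a+}^{\alpha}\psi=f$, where $f$ is the function whose Jacobi coefficients are $$f_m=\sum_{n=0}^{\infty}(-1)^n\psi_n A^{\alpha,\beta,\gamma}_{mn},\qquad m\in\mathbb{N}_0$$ (the series being convergent for every $m$). In matrix form, $$\begin{pmatrix}A^{\alpha,\beta,\gamma}_{00}&-A^{\alpha,\beta,\gamma}_{01}&\dots\\ A^{\alpha,\beta,\gamma}_{10}&-A^{\alpha,\beta,\gamma}_{11}&\dots\\ \vdots&\vdots&\end{pmatrix}\begin{pmatrix}\psi_0\\ \psi_1\\ \vdots\end{pmatrix}=\begin{pmatrix}f_0\\ f_1\\ \vdots\end{pmatrix},$$ where the $(m,n)$ entry of the matrix is $(-1)^nA^{\alpha,\beta,\gamma}_{mn}$.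
   Context: $L_{p}(I,\omega)$, $1\le p<\infty$, is the complex weighted Lebesgue space with norm $\left(\int_a^b|f|^p\omega\,dx\right)^{1/p}$. The left-side Riemann-Liouville fractional integral is $(I_{a+}^{\alpha}f)(x)=\frac{1}{\Gamma(\alpha)}\int_a^x f(t)(x-t)^{\alpha-1}\,dt$. Set $$m(\beta,\gamma)=4\min\left\{\frac{\beta+1}{2\beta+1},\frac{\gamma+1}{2\gamma+1}\right\},\qquad M(\beta,\gamma)=4\max\left\{\frac{\beta+1}{2\beta+3},\frac{\gamma+1}{2\gamma+3}\right\},$$ where a fraction with zero denominator is read as $+\infty$. The orthonormal Jacobi polynomials on $I$ with weight $\omega$ are $p_n(x)=p_n^{(\beta,\gamma)}(x)=\delta_n\,y_n(x)$, $n\in\mathbb{N}_0$, where $$y_n(x)=(x-a)^{-\beta}(b-x)^{-\gamma}\frac{d^n}{dx^n}\left[(x-a)^{\beta+n}(b-x)^{\gamma+n}\right],$$ $$\delta_n=(-1)^n\frac{\sqrt{\beta+\gamma+2n+1}}{(b-a)^{n+(\beta+\gamma+1)/2}}\sqrt{\frac{\Gamma(\beta+\gamma+n+1)}{n!\,\Gamma(\beta+n+1)\Gamma(\gamma+n+1)}},$$ with $\delta_0=1/\sqrt{\Gamma(\beta+1)\Gamma(\gamma+1)}$ if $\beta+\gamma+1=0$. The Jacobi coefficients of a function $g$ are $g_n=\int_a^b g(x)p_n(x)\omega(x)\,dx$. Put $\mathfrak{C}_n^{(k)}(\beta,\gamma)=(-1)^{n+k}(b-a)^k\,p_n^{(k)}(a)$,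 where $p_n^{(k)}$ is the $k$-th derivative of $p_n$, and $$\hat\delta_m=(b-a)^{\alpha+(\beta+\gamma+1)/2}\sqrt{\frac{(\beta+\gamma+2m+1)\Gamma(\beta+\gamma+m+1)}{m!\,\Gamma(\beta+m+1)\Gamma(\gamma+m+1)}}$$ (for $m=0$ the product $(\beta+\gamma+1)\Gamma(\beta+\gamma+1)$ is read as $\Gamma(\beta+\gamma+2)$). Then $$A^{\alpha,\beta,\gamma}_{mn}=\hat\delta_m\sum_{k=0}^{n}(-1)^k\frac{\mathfrak{C}_n^{(k)}(\beta,\gamma)\,B(\alpha+\beta+k+1,\gamma+m+1)}{\Gamma(k+\alpha-m+1)},$$ where $B$ is the Euler Beta function. *)

(* Defs.v *)
From HB Require Import structures.
From mathcomp Require Import all_boot all_order all_algebra.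
From mathcomp Require Import complex.
From mathcomp Require Import all_classical all_reals all_analysis.
From mathcomp Require Import ring lra.
Import numFieldNormedType.Exports.
Import Order.TTheory GRing.Theory Num.Theory.

Set Implicit Arguments.
Unset Strict Implicit.
Unset Printing Implicit Defensive.

Local Open Scope classical_set_scope.
Local Open Scope ring_scope.
Local Open Scope complex_scope.

Local Notation leb R := (@lebesgue_measure R).

(* For x <= 0 the Euler integral diverges, and Gamma is continued by
   Gamma(x) = Gamma(x + n) / (x (x + 1) ... (x + n - 1)) with x + n > 0; at the
   poles x = 0, -1, -2, ... the value is the junk value 0. *)
Definition Gamma_integral (R : realType) (x : R) : R :=
  \int[leb R]_(t in `]0, +oo[) (t `^ (x - 1) * expR (- t)).

Definition Gamma (R : realType) (x : R) : R :=
  if 0 < x then Gamma_integral x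
  else let n := (Num.truncn (- x)).+1 in
       Gamma_integral (x + n%:R) / \prod_(i < n) (x + i%:R).

Definition Beta (R : realType) (x y : R) : R :=
  \int[leb R]_(t in `]0, 1[) (t `^ (x - 1) * (1 - t) `^ (y - 1)).

Definition Cintegrable (R : realType) (D : set R) (f : R -> R[i]) : Prop :=
  (leb R).-integrable D (fun x => (complex.Re (f x))%:E) /\
  (leb R).-integrable D (fun x => (complex.Im (f x))%:E).

Definition Cintegral (R : realType) (D : set R) (f : R -> R[i]) : R[i] :=
  (\int[leb R]_(x in D) complex.Re (f x))
  +i* (\int[leb R]_(x in D) complex.Im (f x)).

Definition weight (R : realType) (a b beta gam x : R) : R :=
  (x - a) `^ beta * (b - x) `^ gam.

(* Elements of the Lebesgue spaces are represented by functions on the line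
   whose values outside ]a, b[ are irrelevant. *)
Definition weighted_Lp (R : realType) (p a b beta gam : R) (f : R -> R[i]) :
    Prop :=
  [/\ measurable_fun `]a, b[ (fun x => complex.Re (f x)),
      measurable_fun `]a, b[ (fun x => complex.Im (f x)) &
      (\int[leb R]_(x in `]a, b[)
          (Normc.normc (f x) `^ p * weight a b beta gam x)%:E < +oo)%E].

Definition RL_integrand (R : realType) (alpha : R) (f : R -> R[i]) (x t : R) :
    R[i] :=
  f t * ((x - t) `^ (alpha - 1))%:C.

Definition RL_integral (R : realType) (a alpha : R) (f : R -> R[i]) (x : R) :
    R[i] :=
  ((Gamma alpha)^-1)%:C * Cintegral `]a, x[ (RL_integrand alpha f x).

Definition efrac (R : realType) (x y : R) : \bar R :=
  if y == 0 then +oo%E else (x / y)%:E.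

Definition exponent_m (R : realType) (beta gam : R) : \bar R :=
  (4%:E * Order.min (efrac (beta + 1) (2 * beta + 1))
                    (efrac (gam + 1) (2 * gam + 1)))%E.

Definition exponent_M (R : realType) (beta gam : R) : \bar R :=
  (4%:E * Order.max (efrac (beta + 1) (2 * beta + 3))
                    (efrac (gam + 1) (2 * gam + 3)))%E.

Definition rodrigues (R : realType) (a b beta gam : R) (n : nat) (x : R) : R :=
  (x - a) `^ (- beta) * (b - x) `^ (- gam) *
  derive1n n (fun t : R => (t - a) `^ (beta + n%:R) * (b - t) `^ (gam + n%:R)) x.

Definition jacobi_delta (R : realType) (a b beta gam : R) (n : nat) : R :=
  if (n == 0%N) && (beta + gam + 1 == 0) then
    1 / Num.sqrt (Gamma (beta + 1) * Gamma (gam + 1))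
  else
    (-1) ^+ n *
    (Num.sqrt (beta + gam + 2 * n%:R + 1) /
       (b - a) `^ (n%:R + (beta + gam + 1) / 2)) *
    Num.sqrt (Gamma (beta + gam + n%:R + 1) /
       (n`!%:R * Gamma (beta + n%:R + 1) * Gamma (gam + n%:R + 1))).

(* The Rodrigues expression only makes sense on ]a, b[, while the values of the
   derivatives at the endpoint a are needed; p_n is therefore the polynomial
   that agrees with delta_n y_n on ]a, b[.  Its existence is [jacobi_polyP]
   below; it is unique when a < b. *)
Definition jacobi_poly (R : realType) (a b beta gam : R) (n : nat) : {poly R} :=
  xget 0 [set P : {poly R} | forall x : R, x \in `]a, b[ ->
    P.[x] = jacobi_delta a b beta gam n * rodrigues a b beta gam n x].

Section jacobi_poly_exists.
Variable R : realType.
Implicit Types (a b s t x : R) (n k : nat) (P Q : {poly R}).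

Let is_derive_powRl a s x : a < x ->
  is_derive x (1 : R) (fun y : R => (y - a) `^ s) (s * (x - a) `^ (s - 1)).
Proof.
move=> ax.
have xa : 0 < x - a by rewrite subr_gt0.
have := @is_derive1_comp R (fun u : R => u `^ s) (fun y : R => y - a) x
  (s * (x - a) `^ (s - 1)) 1.
rewrite mulr1; apply; first exact: is_derive1_powR.
by apply: is_derive_eq; rewrite subr0.
Qed.

Let is_derive_powRr b s x : x < b ->
  is_derive x (1 : R) (fun y : R => (b - y) `^ s) (- (s * (b - x) `^ (s - 1))).
Proof.
move=> xb.
have bx : 0 < b - x by rewrite subr_gt0.
have := @is_derive1_comp R (fun u : R => u `^ s) (fun y : R => b - y) x
  (s * (b - x) `^ (s - 1)) (-1).
rewrite mulrN1; apply; first exact: is_derive1_powR.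
by apply: is_derive_eq; rewrite add0r mul1r.
Qed.

Let powRB1 s x : 0 < x -> x `^ s = x `^ (s - 1) * x.
Proof.
move=> x0; rewrite -{3}(powRr1 (ltW x0)) -powRD ?subrK//.
by rewrite (gt_eqF x0) implybT.
Qed.

Let derive1n_weight a b s t k : exists Q, forall x, x \in `]a, b[ ->
  derive1n k (fun y : R => (y - a) `^ s * (b - y) `^ t) x
  = (x - a) `^ (s - k%:R) * (b - x) `^ (t - k%:R) * Q.[x].
Proof.
elim: k => [|k [Q IH]].
  by exists 1 => x _; rewrite derive1n0 !subr0 hornerC mulr1.
exists ((s - k%:R) *: (b%:P - 'X) * Q - (t - k%:R) *: ('X - a%:P) * Q +
  ('X - a%:P) * (b%:P - 'X) * Q^`()) => x xab.
have /andP[ax xb] : a < x < b by move: xab; rewrite in_itv.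
rewrite derive1nS derive1E.
rewrite (@near_eq_derive _ _ _ _ (fun y : R =>
    (y - a) `^ (s - k%:R) * (b - y) `^ (t - k%:R) * Q.[y])); last first.
  by apply: filterS (near_in_itvoo xab) => y /IH.
set u := s - k%:R; set v := t - k%:R.
have D1 := is_derive_powRl u ax.
have D2 := is_derive_powRr v xb.
have D3 := is_derive_poly Q x.
rewrite (@derive_val _ _ _ _ _ _ _ (is_deriveM (is_deriveM D1 D2) D3)).
have eS (w : R) : w - k.+1%:R = w - k%:R - 1 by rewrite -natr1 opprD addrA.
rewrite !eS -/u -/v.
transitivity ((x - a) `^ u * (b - x) `^ v * Q^`().[x] +
  Q.[x] * ((x - a) `^ u * - (v * (b - x) `^ (v - 1)) +
           (b - x) `^ v * (u * (x - a) `^ (u - 1)))); first by [].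
rewrite (powRB1 u) ?subr_gt0// (powRB1 v) ?subr_gt0//.
by rewrite !(hornerD, hornerN, hornerM, hornerZ, hornerX, hornerC); ring.
Qed.

Lemma jacobi_polyP a b (beta gam : R) n x : x \in `]a, b[ ->
  (jacobi_poly a b beta gam n).[x]
  = jacobi_delta a b beta gam n * rodrigues a b beta gam n x.
Proof.
have [Q Qn] := derive1n_weight a b (beta + n%:R) (gam + n%:R) n.
rewrite /jacobi_poly; case: xgetP => [P _|noP]; first exact.
have [] := noP (jacobi_delta a b beta gam n *: Q) => y yab.
have /andP[ay yb] : a < y < b by move: yab; rewrite in_itv.
rewrite /rodrigues Qn// !addrK hornerZ; congr (_ * _).
have powK (w z : R) : 0 < w -> w `^ (- z) * w `^ z = 1.
  by move=> w0; rewrite -powRD ?addNr ?powRr0// (gt_eqF w0) implybT.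
by rewrite mulrA mulrACA !powK ?subr_gt0// !mul1r.
Qed.

End jacobi_poly_exists.

Definition jacobi_integrand (R : realType) (a b beta gam : R) (g : R -> R[i])
    (n : nat) (x : R) : R[i] :=
  g x * ((jacobi_poly a b beta gam n).[x] * weight a b beta gam x)%:C.

Definition jacobi_coef (R : realType) (a b beta gam : R) (g : R -> R[i])
    (n : nat) : R[i] :=
  Cintegral `]a, b[ (jacobi_integrand a b beta gam g n).

Definition has_jacobi_coefs (R : realType) (a b beta gam : R) (g : R -> R[i])
    (c : nat -> R[i]) : Prop :=
  forall n, Cintegrable `]a, b[ (jacobi_integrand a b beta gam g n) /\
            jacobi_coef a b beta gam g n = c n.

Definition frakC (R : realType) (a b beta gam : R) (n k : nat) : R :=
  (-1) ^+ (n + k) * (b - a) ^+ k * ((jacobi_poly a b beta gam n)^`(k)).[a].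

(* For m = 0 the product (beta + gam + 1) Gamma(beta + gam + 1) is written
   Gamma(beta + gam + 2), which also makes sense when beta + gam + 1 = 0. *)
Definition jacobi_hdelta (R : realType) (a b alpha beta gam : R) (m : nat) : R :=
  (b - a) `^ (alpha + (beta + gam + 1) / 2) *
  Num.sqrt
    ((if m == 0%N then Gamma (beta + gam + 2)
      else (beta + gam + 2 * m%:R + 1) * Gamma (beta + gam + m%:R + 1)) /
     (m`!%:R * Gamma (beta + m%:R + 1) * Gamma (gam + m%:R + 1))).

Definition jacobi_A (R : realType) (a b alpha beta gam : R) (m n : nat) : R :=
  jacobi_hdelta a b alpha beta gam m *
  \sum_(0 <= k < n.+1)
    ((-1) ^+ k *
     (frakC a b beta gam n k *
        Beta (alpha + beta + k%:R + 1) (gam + m%:R + 1) /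
      Gamma (k%:R + alpha - m%:R + 1))).

(* [R[i]^o] carries the topology given by the complex modulus. *)
Definition Cseries_cvg (R : realType) (u : nat -> R[i]) (l : R[i]) : Prop :=
  (series u : nat -> R[i]^o) @ \oo --> (l : R[i]^o).

Definition infmx_mul_eq (R : realType) (A : nat -> nat -> R[i])
    (u v : nat -> R[i]) : Prop :=
  forall m, Cseries_cvg (fun n => A m n * u n) (v m).

Definition jacobi_matrix (R : realType) (a b alpha beta gam : R) (m n : nat) :
    R[i] :=
  ((-1) ^+ n * jacobi_A a b alpha beta gam m n)%:C.

(* Main.v *)
Require Import Defs.
From HB Require Import structures.
From mathcomp Require Import all_boot all_order all_algebra.
From mathcomp Require Import complex.
From mathcomp Require Import all_classical all_reals all_analysis.
From mathcomp Require Import measurable_realfun.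
From mathcomp Require Import ring lra zify.
Import numFieldNormedType.Exports.
Import Order.TTheory GRing.Theory Num.Theory.

Local Open Scope classical_set_scope.
Local Open Scope ring_scope.

Set Implicit Arguments.
Unset Strict Implicit.
Unset Printing Implicit Defensive.

(** Write T_m(f) for the m-th Jacobi coefficient of I^alpha f. The value
    T_m(p_n) = (-1)^n A_mn is computed from the Taylor expansion of p_n at a
    and the Rodrigues formula, so the point is that T_m(f_N) tends to 0 for
    the remainders f_N of the expansion of f = psi, although the expansion
    is not shown to converge in L_p.

    The condition M < p gives |psi|^(1 + del) G w integrable for a weight G
    slightly larger than all the p_n, hence a bound N^(1 - del/4) for the
    sum of the first N moduli of coefficients. The primitives of p_n w,
    which vanish at both ends, are of order n^(-1) up to a small power, by a
    Sonin-type energy estimate; so the integrated expansion converges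
    absolutely, with an explicit behaviour at the ends, and its sum is
    identified by testing it against polynomials. Finally T_m(f) is an
    average over 0 < s < 1 of pairings of f w with smooth functions of t
    whose derivatives are bounded, uniformly in s, by a multiple of the
    derivative of an endpoint weight; integration by parts in each pairing
    bounds T_m(f_N) by the tail of the integrated expansion. *)

(** * Integration on the line *)

(** The hypothesis M < p is used by duality: it says that the endpoint weight dominating the p_n,
    raised to the exponent conjugate to p, is still integrable against w. Strictness leaves room for
    two small losses, kap in the weight and del in the exponent.

    The margin of the absolute convergence is narrow. Bounded coefficients against primitives of
    order 1/n would just fail to be summable, so any power gained on the average size of the
    coefficients is enough, provided that the loss in the primitives is smaller; this is the
    condition 16 kap < del.

    The second obstacle is the kernel (x - t)^(alpha - 1): differentiating it in t, as an
    integration by parts requires, destroys its integrability. The substitution x = t + (b - t) s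
    puts the singularity into the fixed integrable factor s^(alpha - 1), and what remains is smooth
    in t for each s. This is where the average over s comes from. *)

Notation intg D f := ((@lebesgue_measure _).-integrable D (EFin \o f)).

Section integration.
Context {R : realType}.
Local Notation mu := (@lebesgue_measure R).
Implicit Types (D E : set (measurableTypeR R)) (f g F G : R -> R) (a b c d x :
  R).

Lemma intg_le D f g : measurable D -> measurable_fun D f ->
  (forall x, D x -> `|f x| <= g x) -> intg D g -> intg D f.
Proof.
move=> mD mf fg ig; apply: le_integrable ig => //; first exact/measurable_EFinP.
move=> x Dx /=; rewrite lee_fin; apply: le_trans (fg _ Dx) _; exact: ler_norm.
Qed.

Lemma intg_measurable D f : intg D f -> measurable_fun D f.
Proof. by move=> /measurable_int /measurable_EFinP. Qed.

Lemma eq_intg D f g : measurable D ->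
  (forall x, D x -> f x = g x) -> intg D f -> intg D g.
Proof.
by move=> mD fg; apply: eq_integrable => // x /set_mem Dx /=; rewrite fg.
Qed.

Lemma eq_int D f g : (forall x, D x -> f x = g x) ->
  \int[mu]_(x in D) f x = \int[mu]_(x in D) g x.
Proof. by move=> fg; apply: eq_Rintegral => x /set_mem; exact: fg. Qed.

Lemma intgD D f g : measurable D -> intg D f -> intg D g ->
  intg D (fun x => f x + g x).
Proof.
move=> mD fi gi; have := integrableD mD fi gi; exact: eq_integrable.
Qed.

Lemma intgB D f g : measurable D -> intg D f -> intg D g ->
  intg D (fun x => f x - g x).
Proof.
move=> mD fi gi; have := integrableB mD fi gi; exact: eq_integrable.
Qed.

Lemma intgZl D k f : measurable D -> intg D f -> intg D (fun x => k * f x).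
Proof.
move=> mD fi; have := integrableZl mD k fi; exact: eq_integrable.
Qed.

Lemma intgN D f : measurable D -> intg D f -> intg D (fun x => - f x).
Proof.
move=> mD fi; have := integrableN fi; exact: eq_integrable.
Qed.

Lemma intg_norm D f : measurable D -> intg D f -> intg D (fun x => `|f x|).
Proof. by move=> mD fi; exact: (integrable_norm fi). Qed.

Lemma intg_sum D I (s : seq I) (P : pred I) (h : I -> R -> R) :
  measurable D -> (forall i, P i -> intg D (h i)) ->
  intg D (fun x => \sum_(i <- s | P i) h i x).
Proof.
move=> mD hi; have := integrable_sum mD s hi.
by apply: eq_integrable => // x _ /=; rewrite sumEFin.
Qed.

Lemma Rintegral_sum D I (s : seq I) (P : pred I) (h : I -> R -> R) :
  measurable D -> (forall i, P i -> intg D (h i)) ->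
  \int[mu]_(x in D) (\sum_(i <- s | P i) h i x)
  = \sum_(i <- s | P i) \int[mu]_(x in D) h i x.
Proof.
move=> mD hi; elim: s => [|i s IH].
  under eq_Rintegral do rewrite big_nil.
  by rewrite big_nil Rintegral_cst// mul0r.
rewrite big_cons; under eq_Rintegral do rewrite big_cons.
case: ifPn => Pi; last exact: IH.
by rewrite RintegralD ?IH//; [exact: hi|exact: intg_sum].
Qed.

Lemma intgS D E f : measurable D -> measurable E -> E `<=` D ->
  intg D f -> intg E f.
Proof. exact: integrableS. Qed.

Lemma norm_Rintegral_le D f g : measurable D -> measurable_fun D f ->
  (forall x, D x -> `|f x| <= g x) -> intg D g ->
  `|\int[mu]_(x in D) f x| <= \int[mu]_(x in D) g x.
Proof.
move=> mD mf fg ig; have fi := intg_le mD mf fg ig.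
apply: le_trans (le_normr_Rintegral mD fi) _.
by apply: le_Rintegral => //; exact: intg_norm.
Qed.

Lemma intg_bounded D f K : measurable D -> (mu D < +oo)%E ->
  measurable_fun D f -> (forall x, D x -> `|f x| <= K) -> intg D f.
Proof.
move=> mD Dfin mf fK; apply: (@intg_le _ _ (cst K)) => //.
by apply: measurable_bounded_integrable => //; apply: bounded_cst.
Qed.

Lemma mitv (i : interval R) :
  measurable ([set` i] : set (measurableTypeR R)).
Proof. exact: measurable_itv. Qed.

Lemma lebesgue_oo a b : a < b ->
  mu (`]a, b[%classic : set (measurableTypeR R)) = (b - a)%:E.
Proof. by move=> ab; rewrite lebesgue_measure_itv/= lte_fin ab EFinB. Qed.

Lemma int_cst_oo a b r : a < b ->
  \int[mu]_(x in `]a, b[) r = r * (b - a).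
Proof.
move=> ab; rewrite Rintegral_cst; last exact: mitv.
rewrite -[b - a]/(fine (b - a)%:E); congr (_ * fine _).
exact: lebesgue_oo.
Qed.

Lemma intZl D k f : measurable D -> intg D f ->
  \int[mu]_(x in D) (k * f x) = k * \int[mu]_(x in D) f x.
Proof. by move=> mD fi; exact: RintegralZl. Qed.

Lemma intD D f g : measurable D -> intg D f -> intg D g ->
  \int[mu]_(x in D) (f x + g x) =
  \int[mu]_(x in D) f x + \int[mu]_(x in D) g x.
Proof. by move=> mD fi gi; exact: RintegralD. Qed.

Lemma intB D f g : measurable D -> intg D f -> intg D g ->
  \int[mu]_(x in D) (f x - g x) =
  \int[mu]_(x in D) f x - \int[mu]_(x in D) g x.
Proof. by move=> mD fi gi; exact: RintegralB. Qed.

Lemma intN D f : measurable D -> intg D f ->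
  \int[mu]_(x in D) (- f x) = - \int[mu]_(x in D) f x.
Proof.
move=> mD fi; rewrite -mulN1r -intZl//.
by apply: eq_int => x _; rewrite mulN1r.
Qed.

Lemma int_le D f g : measurable D -> intg D f -> intg D g ->
  (forall x, D x -> f x <= g x) ->
  \int[mu]_(x in D) f x <= \int[mu]_(x in D) g x.
Proof. by move=> mD fi gi fg; apply: le_Rintegral. Qed.

Lemma intg_patch D f : measurable D -> intg D f -> intg setT (f \_ D).
Proof. by move=> mD fi; rewrite -restrict_EFin;
  apply/(integrable_mkcond _ mD).1. Qed.

Lemma int_subset_le D E f : measurable D -> measurable E -> E `<=` D ->
  intg D f -> (forall x, D x -> 0 <= f x) ->
  \int[mu]_(x in E) f x <= \int[mu]_(x in D) f x.
Proof.
move=> mD mE ED fi f0; have fiE := intgS mD mE ED fi.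
rewrite [leLHS]Rintegral_mkcond [leRHS]Rintegral_mkcond; apply: int_le => //.
- exact: intg_patch.
- exact: intg_patch.
- move=> x _; rewrite !patchE; case: ifPn => [/set_mem/ED/mem_set ->//|_].
  by case: ifPn => // /set_mem; exact: f0.
Qed.

Lemma FTC_cc F f c d : c <= d ->
  (forall x, c <= x <= d -> is_derive x 1 F (f x)) ->
  (forall x, c <= x <= d -> {for x, continuous f}) ->
  intg `[c, d] f /\ \int[mu]_(x in `[c, d]) f x = F d - F c.
Proof.
move=> cd dF cf.
have cf' : {within `[c, d], continuous f}.
  apply: continuous_in_subspaceT => x /set_mem/=; rewrite in_itv/=; exact: cf.
split; first by apply: continuous_compact_integrable => //;
  exact: segment_compact.
move: cd; rewrite le_eqVlt => /predU1P[->|cd].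
  by rewrite set_itv1 Rintegral_set1 subrr.
have Fx x : c <= x <= d -> {for x, continuous F}.
  move=> /dF Dx; apply/differentiable_continuous.
  by rewrite -derivable1_diffP; case: Dx.
rewrite /Rintegral (continuous_FTC2 cd cf' (F := F))//.
- split.
  + move=> x /[!in_itv]/= /andP[cx xd].
    by have [] : is_derive x 1 F (f x) by apply: dF; rewrite !ltW.
  + by apply/cvg_at_right_filter/Fx; rewrite lexx ltW.
  + by apply/cvg_at_left_filter/Fx; rewrite lexx ltW.
- move=> x /[!in_itv]/= /andP[cx xd]; rewrite derive1E.
  by apply: derive_val; apply: dF; rewrite !ltW.
Qed.

End integration.

(** * Fundamental theorem of calculus by exhaustion with segments *)

Section exhaustion.
Context {R : realType}.
Local Notation mu := (@lebesgue_measure R).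
Variables (D : set (measurableTypeR R)) (f F : R -> R) (c d : nat -> R).
Hypothesis mD : measurable D.
Hypothesis cd : forall n, c n <= d n.
Hypothesis cdD : forall n x, c n <= x <= d n -> D x.
Hypothesis cdx : forall x, D x -> \forall n \near \oo, c n <= x <= d n.
Hypothesis dF : forall x, D x -> is_derive x 1 F (f x).
Hypothesis cf : forall x, D x -> {for x, continuous f}.
Hypothesis mf : measurable_fun D f.

Let E n : set (measurableTypeR R) := `[c n, d n].

Let ED n : E n `<=` D.
Proof. by move=> x; rewrite /E /= in_itv; exact: cdD. Qed.

Let FTCn n : intg (E n) f /\ \int[mu]_(x in E n) f x = F (d n) - F (c n).
Proof.
by apply: FTC_cc => // x cxd; [apply: dF|apply: cf]; exact: cdD cxd.
Qed.

Let mfE n : measurable_fun D (f \_ (E n)).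
Proof.
apply/measurable_restrict => //; first exact: measurable_itv.
apply: measurable_funS mf => //; exact: subIsetl.
Qed.

Let fE_cvg x : D x -> ((f \_ (E n)) x)%:E @[n --> \oo] --> (f x)%:E.
Proof.
move=> Dx; apply: cvg_near_cst; apply: filterS (cdx Dx) => n cxd.
by rewrite patchE mem_set// /E/= in_itv.
Qed.

Let int_fE n : (\int[mu]_(x in D) ((f \_ (E n)) x)%:E)%E =
  (F (d n) - F (c n))%:E.
Proof.
have [fi <-] := FTCn n.
transitivity (\int[mu]_(x in E n) (f x)%:E)%E; last first.
  by rewrite /Rintegral fineK//; apply: integrable_fin_num => //;
    exact: measurable_itv.
rewrite -{2}(setIidr (@ED n)) integral_mkcondr; apply: eq_integral => x _.
by rewrite !patchE; case: ifPn.
Qed.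

(** Fatou's lemma for the truncations of [f] to the segments [c n, d n], whose integrals are the
    increments of [F]. Powers singular at an endpoint are later shown integrable in this way. *)
Lemma intg_bounded_primitive M : (forall x, D x -> 0 <= f x) ->
  (forall n, F (d n) - F (c n) <= M) -> intg D f.
Proof.
move=> f0 FM; apply/integrableP; split; first exact/measurable_EFinP.
under eq_integral => x /set_mem Dx do rewrite gee0_abs ?lee_fin ?f0//=.
have fl x : x \in D -> (f x)%:E = limn_einf (fun n => ((f \_ (E n)) x)%:E).
  move=> /set_mem Dx; have H := fE_cvg Dx; rewrite is_cvg_limn_einfE.
    by apply/esym/cvg_lim.
  by apply/cvg_ex; eexists; exact: H.
under eq_integral => x xD do rewrite fl//.
apply: le_lt_trans (fatou _ _ _ _) _ => //.
- by move=> n; exact/measurable_EFinP.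
- by move=> n x Dx; rewrite lee_fin patchE; case: ifPn => // _; exact: f0.
- under eq_fun do rewrite int_fE.
  apply: (@le_lt_trans _ _ M%:E); last exact: ltry.
  rewrite limn_einf_lim; apply: lime_le; first exact: is_cvg_einfs.
  apply: nearW => n; apply: (@le_trans _ _ (F (d n) - F (c n))%:E);
    last by rewrite lee_fin.
  by apply: ereal_inf_lbound; exists n => //=.
Qed.

(** Dominated convergence for the same truncations, with |f| as majorant. Only the limits of [F]
    along the two sequences enter, so [F] and [f] may be singular at the ends of [D]. *)
Lemma FTC_exhaust A B : intg D f -> F (c n) @[n --> \oo] --> A ->
  F (d n) @[n --> \oo] --> B -> \int[mu]_(x in D) f x = B - A.
Proof.
move=> fi FA FB.
have cvgf : {ae mu, forall x, D x ->
    ((f \_ (E n)) x)%:E @[n --> \oo] --> (EFin \o f) x}.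
  by apply: aeW => x Dx; exact: fE_cvg.
have domf : {ae mu, forall x n, D x -> (`|((f \_ (E n)) x)%:E| <= `|f x|%:E)%E}.
  apply: aeW => x n Dx; rewrite lee_fin patchE; case: ifPn => // _.
  by rewrite normr0.
have mfE' n : measurable_fun D (fun x => ((f \_ (E n)) x)%:E).
  exact/measurable_EFinP.
have mf' : measurable_fun D (EFin \o f) by exact/measurable_EFinP.
have [_ _ H] := dominated_convergence mD mfE' mf' cvgf (intg_norm mD fi) domf.
rewrite /Rintegral.
have -> : (\int[mu]_(x in D) (f x)%:E)%E = (B - A)%:E.
  apply/esym/(cvg_unique _ _ H) => //.
  under [X in X @ _]eq_fun do rewrite int_fE.
  by apply: cvg_EFin; [apply: nearW|exact: cvgB].
by [].
Qed.

End exhaustion.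

(** * Affine change of variables *)

Section affine.
Context {R : realType}.
Local Notation mu := (@lebesgue_measure R).
Local Notation RT := (measurableTypeR R).
Variables (k d : R).
Hypothesis k0 : k != 0.
Let h : RT -> RT := fun x => k * x + d.

Let mh : measurable_fun setT h.
Proof.
apply: continuous_measurable_fun => x.
by apply: cvgD; [apply: cvgM; [exact: cvg_cst|exact: cvg_id]|exact: cvg_cst].
Qed.

Let pf : {measure set RT -> \bar R} :=
  measure_function_pushforward__canonical__measure_function_Measure mu mh.

Let absk : {nonneg R} := NngNum (normr_ge0 k).

(** Both sides are measures that agree on half-open intervals, which determine Lebesgue measure. For
    k < 0 the preimage of such an interval is closed on the other side, hence the two cases. *)
Lemma lebesgue_affine (A : set RT) : measurable A ->
  mu A = mscale absk pf A.
Proof.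
move=> mA; apply: lebesgue_measure_unique => // _ [[u v] /=] uv <-.
rewrite /mscale/= /pushforward.
have [kn|kp|/eqP] := ltrgtP k 0; last by rewrite (negbTE k0).
- rewrite (_ : h @^-1` _ = `[(v - d) / k, (u - d) / k[%classic); last first.
    apply/seteqP; split => x /=; rewrite !in_itv/= /h => /andP[H1 H2].
      by rewrite ler_ndivrMr// ltr_ndivlMr// [x * k]mulrC; apply/andP; split;
        lra.
    move: H1 H2; rewrite ler_ndivrMr// ltr_ndivlMr// [x * k]mulrC => H1 H2.
    by apply/andP; split; lra.
  rewrite !lebesgue_measure_itv /= !lte_fin.
  rewrite ltr_ndivrMr// mulrVK ?unitfE// ltrD2r.
  case: ifPn => _; last by rewrite mule0.
  by rewrite -!EFinD -EFinM ltr0_norm//; congr EFin; field.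
- rewrite (_ : h @^-1` _ = `](u - d) / k, (v - d) / k]%classic); last first.
    apply/seteqP; split => x /=; rewrite !in_itv/= /h => /andP[H1 H2].
      by rewrite ltr_pdivrMr// ler_pdivlMr// [x * k]mulrC; apply/andP; split;
        lra.
    move: H1 H2; rewrite ltr_pdivrMr// ler_pdivlMr// [x * k]mulrC => H1 H2.
    by apply/andP; split; lra.
  rewrite !lebesgue_measure_itv /= !lte_fin.
  rewrite ltr_pdivrMr// mulrVK ?unitfE// ltrD2r.
  case: ifPn => _; last by rewrite mule0.
  by rewrite -!EFinD -EFinM gtr0_norm//; congr EFin; field.
Qed.

Lemma ge0_integral_affine (D : set RT) (f : RT -> \bar R) : measurable D ->
  measurable_fun D f -> (forall x, D x -> 0 <= f x)%E ->
  (\int[mu]_(x in D) f x = `|k|%:E * \int[mu]_(x in h @^-1` D) f (h x))%E.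
Proof.
move=> mD mf f0.
rewrite (eq_measure_integral (mscale absk pf)); last first.
  by move=> A mA _; exact: lebesgue_affine.
rewrite ge0_integral_mscale//; congr (_ * _)%E.
by rewrite -(@ge0_integral_pushforward _ _ RT RT _ h mh mu)// => x /set_mem;
  exact: f0.
Qed.

Lemma Rintegral_affine (D : set RT) (f : R -> R) : measurable D ->
  intg D f -> intg (h @^-1` D) (f \o h) /\
  \int[mu]_(x in D) f x = `|k| * \int[mu]_(x in h @^-1` D) f (h x).
Proof.
move=> mD fi.
have mhD : measurable (h @^-1` D) by rewrite -[X in measurable X]setTI;
  exact: mh.
have mf := intg_measurable fi.
have mfh : measurable_fun (h @^-1` D) (f \o h).
  apply: (@measurable_comp _ _ _ RT RT _ D) => //.
    by move=> _ [x Dx <-].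
  exact: measurable_funS mh.
have Ek (g : R -> R) : measurable_fun D g -> (forall x, D x -> 0 <= g x) ->
    (\int[mu]_(x in D) (g x)%:E =
     `|k|%:E * \int[mu]_(x in h @^-1` D) (g (h x))%:E)%E.
  move=> mg g0; apply: ge0_integral_affine => //; exact/measurable_EFinP.
have k0' : 0 < `|k| by rewrite normr_gt0.
have fhi : intg (h @^-1` D) (f \o h).
  apply/integrableP; split; first exact/measurable_EFinP.
  move/integrableP : fi => [_].
  under eq_integral do rewrite abse_EFin.
  rewrite (Ek (fun x => `|f x|))//; last exact: measurableT_comp.
  case: (\int[mu]_(x in _) _)%E => [r _||] //; first by rewrite ltry.
  by rewrite gt0_muley ?lte_fin.
split => //.
have Rk (g : R -> R) : intg D g -> intg (h @^-1` D) (g \o h) ->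
  (forall x, D x -> 0 <= g x) ->
    \int[mu]_(x in D) g x = `|k| * \int[mu]_(x in h @^-1` D) g (h x).
  move=> gi gi' g0; rewrite /Rintegral Ek//; last exact: intg_measurable.
  by rewrite fineM//; apply: integrable_fin_num.
have nfi := intg_norm mD fi.
have nfhi := intg_norm mhD fhi.
(* Both |f| + f and |f| are nonnegative, so the formula for nonnegative functions extends to signed
   ones through this difference. *)
have -> : \int[mu]_(x in D) f x =
    \int[mu]_(x in D) ((`|f x| + f x) - `|f x|).
  by apply: eq_Rintegral => x _; rewrite addrAC subrr add0r.
rewrite RintegralB//; last exact: intgD.
rewrite !Rk//; first last.
- by move=> x _; rewrite -lerBlDr sub0r -normrN ler_norm.
- exact: intgD.
- exact: intgD.
rewrite -mulrBr -RintegralB//; last exact: intgD.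
by congr (_ * _); apply: eq_Rintegral => x _ /=; rewrite addrAC subrr add0r.
Qed.

End affine.

(** * Fubini's theorem under domination of the inner integrals *)

Section fubini.
Context {R : realType}.
Local Notation mu := (@lebesgue_measure R).
Local Notation RT := (measurableTypeR R).

(** An integrable extended-real function is finite almost everywhere, so [fine] changes it only on a
    null set. Iterated integrals first appear in this extended form. *)
Lemma integrable_fine (D : set RT) (G : R -> \bar R) : measurable D ->
  mu.-integrable D G ->
  intg D (fun x => fine (G x)) /\
  (\int[mu]_(x in D) G x = (\int[mu]_(x in D) fine (G x))%R%:E)%E.
Proof.
move=> mD iG; have mG := measurable_int mu iG.
have mf : measurable_fun D (fun x => (fine (G x))%:E).
  by apply/measurable_EFinP; apply: measurableT_comp.
have fi : intg D (fun x => fine (G x)).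
  apply: (le_integrable mD _ _ iG); [exact: mf|move=> x Dx /=].
  by case: (G x) => //= *; rewrite ?normr0 ?leey.
split => //; rewrite /Rintegral fineK; last exact: integrable_fin_num.
apply: ae_eq_integral => //.
apply: filterS (integrable_ae mD iG) => x H Dx /=.
by rewrite fineK// H.
Qed.

(** By Tonelli's theorem, an integrable bound [g] on the inner integrals of |f| is enough for
    integrability on the product, and such a bound is what the later kernels provide. The function
    is extended by 0 to the whole plane. Integrability of the other sections comes out only almost
    everywhere. *)
Lemma Rintegral_Fubini (D1 D2 : set RT) (f : RT * RT -> R) (g : R -> R) :
  measurable D1 -> measurable D2 -> measurable_fun (D1 `*` D2) f ->
  intg D1 g ->
  (forall x, D1 x -> (\int[mu]_(y in D2) `|f (x, y)|%:E <= (g x)%:E)%E) ->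
  [/\ {ae mu, forall y, D2 y -> intg D1 (fun x => f (x, y))},
      intg D2 (fun y => \int[mu]_(x in D1) f (x, y)),
      intg D1 (fun x => \int[mu]_(y in D2) f (x, y)) &
      \int[mu]_(x in D1) (\int[mu]_(y in D2) f (x, y)) =
      \int[mu]_(y in D2) (\int[mu]_(x in D1) f (x, y))].
Proof.
move=> mD1 mD2 mf ig fg.
have mD12 : measurable (D1 `*` D2) by exact: measurableX.
pose F : RT * RT -> \bar R := EFin \o (f \_ (D1 `*` D2)).
have mF : measurable_fun setT F.
  by apply/measurable_EFinP; apply/(measurable_restrictT _ _).1.
have FE x y : F (x, y) = if (x \in D1) && (y \in D2) then (f (x, y))%:E else
  0%E.
  by rewrite /F/= patchE in_setX/=; case: ifPn.
have iF : (mu \x mu)%E.-integrable setT F.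
  apply/integrable12ltyP => //.
  apply: (@le_lt_trans _ _ (\int[mu]_(x in D1) (g x)%:E)%E); last first.
    have /integrableP[_] := ig; apply: le_lt_trans.
    by apply: le_integral => //; [exact: integrable_abse|move=> x _;
      exact: lee_abs].
  rewrite [leRHS]integral_mkcond.
  apply: ge0_le_integral => //.
  - by move=> x _; apply: integral_ge0 => y _; exact: abse_ge0.
  - apply: (measurable_fun_fubini_tonelli_F (abse \o F)) => //=.
    exact: (measurableT_comp (@abse_measurable R setT) mF).
  - by apply/(measurable_restrictT _ _).1 => //; exact: (measurable_int mu ig).
  move=> x _; rewrite patchE; case: ifPn => xD1.
    rewrite (le_trans _ (fg x (set_mem xD1)))// [leRHS]integral_mkcond.
    rewrite le_eqVlt; apply/orP; left; apply/eqP; apply: eq_integral => y _.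
    by rewrite FE xD1/= patchE; case: ifPn => //; rewrite abse0.
  rewrite (eq_integral (cst 0%E)) ?integral0// => y _.
  by rewrite FE (negbTE xD1) abse0.
have F1 x : (\int[mu]_y F (x, y))%E =
    if x \in D1 then (\int[mu]_(y in D2) (f (x, y))%:E)%E else 0%E.
  case: ifPn => xD1.
    rewrite [RHS]integral_mkcond; apply: eq_integral => y _.
    by rewrite FE xD1/= patchE; case: ifPn.
  by rewrite (eq_integral (cst 0%E)) ?integral0// => y _;
    rewrite FE (negbTE xD1).
have F2 y : (\int[mu]_x F (x, y))%E =
    if y \in D2 then (\int[mu]_(x in D1) (f (x, y))%:E)%E else 0%E.
  case: ifPn => yD2.
    rewrite [RHS]integral_mkcond; apply: eq_integral => x _.
    by rewrite FE yD2 andbT patchE; case: ifPn.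
  by rewrite (eq_integral (cst 0%E)) ?integral0// => x _;
    rewrite FE (negbTE yD2) andbF.
have [I1 E1] := integrable_fine measurableT (integrable_fubini_F iF).
have aF : measurable_fun setT (abse \o F).
  exact: (measurableT_comp (@abse_measurable R setT) mF).
have iG : mu.-integrable setT (fubini_G mu F).
  apply/integrableP; split; first exact: (measurable_fubini_G iF).
  have H : (\int[mu]_y \int[mu]_x `|F (x, y)| < +oo)%E
    by exact/(integrable21ltyP mu mu mF).
  apply: (le_lt_trans _ H).
  apply: ge0_le_integral => //.
  - exact: (measurableT_comp (@abse_measurable R setT)
      (measurable_fubini_G iF)).
  - by apply: (measurable_fun_fubini_tonelli_G (abse \o F)) => //=.
  - move=> y _; apply: le_abse_integral => //.
    exact: (measurableT_comp mF (measurable_fun_pair (@measurable_id _ RT setT)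
      (measurable_cst y))).
have [I2 E2] := integrable_fine measurableT iG.
have X1 : (fun x => fine (\int[mu]_y F (x, y))) =
    (fun x => \int[mu]_(y in D2) f (x, y)) \_ D1.
  by apply/funext => x; rewrite F1 patchE; case: ifPn.
have X2 : (fun y => fine (\int[mu]_x F (x, y))) =
    (fun y => \int[mu]_(x in D1) f (x, y)) \_ D2.
  by apply/funext => y; rewrite F2 patchE; case: ifPn.
split.
- have := ae_integrable2 iF; apply: filterS => y H D2y.
  have := integrableS measurableT mD1 (@subsetT _ _) H.
  apply: eq_integrable => // x xD1.
  by rewrite FE xD1 mem_set.
- by apply/integrable_mkcond => //; rewrite restrict_EFin -X2.
- by apply/integrable_mkcond => //; rewrite restrict_EFin -X1.
- rewrite [LHS]Rintegral_mkcond [RHS]Rintegral_mkcond -X1 -X2.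
  apply: EFin_inj; rewrite -E1 -E2; exact: Fubini.
Qed.

End fubini.

Section open_intervals.
Context {R : realType}.
Local Notation mu := (@lebesgue_measure R).
Implicit Types (f F : R -> R) (a b x : R).

Lemma continuous_oo_measurable a b f :
  (forall x, a < x < b -> {for x, continuous f}) ->
  measurable_fun (`]a, b[%classic : set (measurableTypeR R)) f.
Proof.
move=> cf; apply: open_continuous_measurable_fun; first exact: itv_open.
by move=> x /set_mem/=; rewrite in_itv/=; exact: cf.
Qed.

(** With n + 2 in the denominator the offset is at most half the length, so that [cc] stays below
    [dd] already for n = 0. *)
Let cc a b (n : nat) : R := a + (b - a) * n.+2%:R^-1.
Let dd a b (n : nat) : R := b - (b - a) * n.+2%:R^-1.

Let cvg2 : (n.+2%:R^-1 : R) @[n --> \oo] --> (0 : R).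
Proof. by have := @cvg_harmonic R; rewrite -(cvg_shiftn 1)/= ;
  under eq_fun do rewrite addn1. Qed.

Let cvgc a b : cc a b n @[n --> \oo] --> a.
Proof.
rewrite -[X in _ --> X]addr0 -(mulr0 (b - a)).
by apply: cvgD; [exact: cvg_cst|apply: cvgM; [exact: cvg_cst|exact: cvg2]].
Qed.

Let cvgd a b : dd a b n @[n --> \oo] --> b.
Proof.
rewrite -[X in _ --> X]subr0 -(mulr0 (b - a)).
by apply: cvgB; [exact: cvg_cst|apply: cvgM; [exact: cvg_cst|exact: cvg2]].
Qed.

Let pos2 n : 0 < (n.+2%:R^-1 : R) <= 2^-1.
Proof. by rewrite invr_gt0 ltr0n/= lef_pV2 ?posrE ?ltr0n// ler_nat. Qed.

Let ltac a b n : a < b -> a < cc a b n.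
Proof.
by move=> ab; have /andP[H _] := pos2 n; rewrite ltrDl mulr_gt0// subr_gt0.
Qed.

Let ltdb a b n : a < b -> dd a b n < b.
Proof.
by move=> ab; have /andP[H _] := pos2 n;
  rewrite ltrBlDr ltrDl mulr_gt0// subr_gt0.
Qed.

Let lecd a b n : a < b -> cc a b n <= dd a b n.
Proof.
move=> ab; have /andP[_ H] := pos2 n; rewrite /cc /dd.
have : (b - a) * n.+2%:R^-1 <= (b - a) * 2^-1 by rewrite ler_pM2l// subr_gt0.
by move: (_ * _^-1) => k; lra.
Qed.

Let cdD a b n x : a < b -> cc a b n <= x <= dd a b n -> a < x < b.
Proof.
move=> ab /andP[cx xd]; rewrite (lt_le_trans _ cx) ?ltac//=.
exact: le_lt_trans xd (ltdb _ ab).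
Qed.

Let cdx a b x : a < x < b -> \forall n \near \oo, cc a b n <= x <= dd a b n.
Proof.
move=> /andP[ax xb]; near=> n; apply/andP; split.
- by apply/ltW; near: n; apply: (cvgr_lt a) => //; exact: cvgc.
- by apply/ltW; near: n; apply: (cvgr_gt b) => //; exact: cvgd.
Unshelve. all: by end_near. Qed.

Lemma intg_oo_bounded_primitive a b f F M : a < b ->
  (forall x, a < x < b -> is_derive x 1 F (f x)) ->
  (forall x, a < x < b -> {for x, continuous f}) ->
  (forall x, a < x < b -> 0 <= f x) ->
  (forall x, a < x < b -> `|F x| <= M) ->
  intg `]a, b[ f.
Proof.
move=> ab dF cf f0 FM.
apply: (@intg_bounded_primitive _ _ f F (cc a b) (dd a b) _ _ _ _ _ _ _ (M +
  M)).
- exact: measurable_itv.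
- by move=> n; exact: lecd.
- by move=> n x /= /cdD; rewrite in_itv/=; exact.
- by move=> x /=; rewrite in_itv/=; exact: cdx.
- by move=> x /=; rewrite in_itv/=; exact: cf.
- exact: continuous_oo_measurable.
- by move=> x /=; rewrite in_itv/=; exact: f0.
- move=> n; rewrite (le_trans (ler_norm _))// (le_trans (ler_normB _ _))//.
  have ac := ltac n ab; have db := ltdb n ab; have cd := lecd n ab.
  by rewrite lerD// FM// ?ac ?db ?(lt_le_trans ac cd) ?(le_lt_trans cd db).
Qed.

Lemma FTC_oo a b f F A B : a < b ->
  (forall x, a < x < b -> is_derive x 1 F (f x)) ->
  (forall x, a < x < b -> {for x, continuous f}) ->
  intg `]a, b[ f -> F x @[x --> a^'+] --> A -> F x @[x --> b^'-] --> B ->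
  \int[mu]_(x in `]a, b[) f x = B - A.
Proof.
move=> ab dF cf fi FA FB.
apply: (@FTC_exhaust _ _ f F (cc a b) (dd a b)) => //.
- by move=> n; exact: lecd.
- by move=> n x /= /cdD; rewrite in_itv/=; exact.
- by move=> x /=; rewrite in_itv/=; exact: cdx.
- exact: continuous_oo_measurable.
- move/cvg_at_rightP : FA; apply; split; last exact: cvgc.
  by move=> n; exact: ltac.
- move/cvg_at_leftP : FB; apply; split; last exact: cvgd.
  by move=> n; exact: ltdb.
Qed.

Let cvgdy : (n.+1%:R : R) @[n --> \oo] --> +oo.
Proof.
apply/cvgryPge => A; near=> n.
rewrite (@le_trans _ _ n%:R)//; last by rewrite ler_nat.
by near: n; exact: nbhs_infty_ger.
Unshelve. all: by end_near. Qed.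

Let cdxy x : 0 < x -> \forall n \near \oo, (n.+1%:R^-1 : R) <= x <= n.+1%:R.
Proof.
move=> x0; near=> n; apply/andP; split.
- apply/ltW; near: n; apply: (cvgr_lt (0 : R)) => //; exact: cvg_harmonic.
- by near: n; move/cvgryPge : cvgdy; exact.
Unshelve. all: by end_near. Qed.

Let cdDy n x : (n.+1%:R^-1 : R) <= x <= n.+1%:R -> 0 < x.
Proof. by move=> /andP[+ _]; apply: lt_le_trans; rewrite invr_gt0. Qed.

Let lecdy n : n.+1%:R^-1 <= n.+1%:R :> R.
Proof. by rewrite (@le_trans _ _ 1)// ?ler1n// invf_le1 ?ler1n. Qed.

Lemma continuous_0y_measurable f :
  (forall x, 0 < x -> {for x, continuous f}) ->
  measurable_fun (`]0, +oo[%classic : set (measurableTypeR R)) f.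
Proof.
move=> cf; apply: open_continuous_measurable_fun; first exact: interval_open.
by move=> x /set_mem/=; rewrite in_itv/= andbT; exact: cf.
Qed.

Lemma FTC_0y f F A B :
  (forall x, 0 < x -> is_derive x 1 F (f x)) ->
  (forall x, 0 < x -> {for x, continuous f}) ->
  intg `]0, +oo[ f -> F x @[x --> 0^'+] --> A -> F x @[x --> +oo] --> B ->
  \int[mu]_(x in `]0, +oo[) f x = B - A.
Proof.
move=> dF cf fi FA FB.
apply: (@FTC_exhaust _ _ f F (fun n => n.+1%:R^-1) (fun n => n.+1%:R)) => //.
- by move=> n x /= /cdDy; rewrite in_itv/= andbT.
- by move=> x /=; rewrite in_itv/= andbT; exact: cdxy.
- by move=> x /=; rewrite in_itv/= andbT; exact: dF.
- by move=> x /=; rewrite in_itv/= andbT; exact: cf.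
- exact: continuous_0y_measurable.
- move/cvg_at_rightP : FA => /(_ (fun n => n.+1%:R^-1)); apply.
  by split; [move=> n; rewrite invr_gt0|exact: cvg_harmonic].
- by move/cvg_pinftyP : FB; apply; exact: cvgdy.
Qed.

Lemma intg_0y_bounded_primitive f F M :
  (forall x, 0 < x -> is_derive x 1 F (f x)) ->
  (forall x, 0 < x -> {for x, continuous f}) ->
  (forall x, 0 < x -> 0 <= f x) ->
  (forall x, 0 < x -> `|F x| <= M) ->
  intg `]0, +oo[ f.
Proof.
move=> dF cf f0 FM.
apply: (@intg_bounded_primitive _ _ f F (fun n => n.+1%:R^-1)
  (fun n => n.+1%:R) _ _ _ _ _ _ _ (M + M)) => //.
- by move=> n x /= /cdDy; rewrite in_itv/= andbT.
- by move=> x /=; rewrite in_itv/= andbT; exact: cdxy.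
- by move=> x /=; rewrite in_itv/= andbT; exact: dF.
- by move=> x /=; rewrite in_itv/= andbT; exact: cf.
- exact: continuous_0y_measurable.
- by move=> x /=; rewrite in_itv/= andbT; exact: f0.
- move=> n; rewrite (le_trans (ler_norm _))// (le_trans (ler_normB _ _))//.
  by rewrite lerD// FM// invr_gt0.
Qed.

End open_intervals.

(** * Powers, Gamma and Beta *)

Section powers.
Context {R : realType}.
Local Notation mu := (@lebesgue_measure R).
Local Notation RT := (measurableTypeR R).
Implicit Types (a b s t x y : R).

Lemma powR_addl x s t : 0 < x -> x `^ (s + t) = x `^ s * x `^ t.
Proof. by move=> x0; rewrite powRD// (gt_eqF x0) implybT. Qed.

Lemma powR_sub1 x s : 0 < x -> x `^ s = x `^ (s - 1) * x.
Proof. by move=> x0; rewrite -{3}(powRr1 (ltW x0)) -powR_addl// subrK. Qed.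

(** A power is monotone, increasing or decreasing with the sign of the exponent, so one of the two
    endpoint values dominates; their sum spares later case distinctions on that sign. *)
Lemma powR_leD u v x s : 0 < u -> u <= x <= v -> x `^ s <= u `^ s + v `^ s.
Proof.
move=> u0 /andP[ux xv].
have x0 := lt_le_trans u0 ux; have v0 := lt_le_trans x0 xv.
have [s0|s0] := leP 0 s.
  apply: (@le_trans _ _ (v `^ s)); last by rewrite lerDr powR_ge0.
  by rewrite ge0_ler_powR// nnegrE ltW.
have ns : 0 <= - s by lra.
have E z : z `^ s = (z `^ (- s))^-1 by rewrite powRN invrK.
rewrite !E; apply: (@le_trans _ _ (u `^ (- s))^-1); last first.
  by rewrite lerDl invr_ge0 powR_ge0.
by rewrite lef_pV2 ?posrE ?powR_gt0// ge0_ler_powR// nnegrE ltW.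
Qed.

Lemma is_derive_powR_subl a s x : a < x ->
  is_derive x (1 : R) (fun y : R => (y - a) `^ s) (s * (x - a) `^ (s - 1)).
Proof.
move=> ax.
have xa : 0 < x - a by rewrite subr_gt0.
have := @is_derive1_comp R (fun u : R => u `^ s) (fun y : R => y - a) x
  (s * (x - a) `^ (s - 1)) 1.
rewrite mulr1; apply; first exact: is_derive1_powR.
by apply: is_derive_eq; rewrite subr0.
Qed.

Lemma is_derive_powR_subr b s x : x < b ->
  is_derive x (1 : R) (fun y : R => (b - y) `^ s) (- (s * (b - x) `^ (s - 1))).
Proof.
move=> xb.
have bx : 0 < b - x by rewrite subr_gt0.
have := @is_derive1_comp R (fun u : R => u `^ s) (fun y : R => b - y) x
  (s * (b - x) `^ (s - 1)) (-1).
rewrite mulrN1; apply; first exact: is_derive1_powR.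
by apply: is_derive_eq; rewrite add0r mul1r.
Qed.

Lemma is_derive_continuous (f : R -> R) x df :
  is_derive x 1 f df -> {for x, continuous f}.
Proof.
move=> [d _]; apply/differentiable_continuous.
by rewrite -derivable1_diffP.
Qed.

Lemma continuous_powR_subl a s x : a < x ->
  {for x, continuous (fun y : R => (y - a) `^ s)}.
Proof. by move=> /(is_derive_powR_subl s)/is_derive_continuous. Qed.

Lemma continuous_powR_subr b s x : x < b ->
  {for x, continuous (fun y : R => (b - y) `^ s)}.
Proof. by move=> /(is_derive_powR_subr s)/is_derive_continuous. Qed.

Lemma intg_powR_subl a b s : a < b -> -1 < s ->
  intg `]a, b[ (fun x => (x - a) `^ s).
Proof.
move=> ab s1; have s10 : 0 < s + 1 by lra.
apply: (@intg_oo_bounded_primitive _ a b _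
    (fun x => (s + 1)^-1 * (x - a) `^ (s + 1)) ((s + 1)^-1 *
      (b - a) `^ (s + 1)))
  => // x /andP[ax xb].
- have D := is_derive_powR_subl (s + 1) ax.
  apply: is_derive_eq; rewrite addrK /GRing.scale/= mulrA mulVf ?mul1r//.
  by rewrite gt_eqF.
- exact: continuous_powR_subl.
- exact: powR_ge0.
- rewrite ger0_norm ?mulr_ge0 ?powR_ge0 ?invr_ge0 ?(ltW s10)//.
  rewrite ler_pM2l ?invr_gt0// ge0_ler_powR ?(ltW s10)// ?nnegrE; lra.
Qed.

Lemma intg_powR_subr a b s : a < b -> -1 < s ->
  intg `]a, b[ (fun x => (b - x) `^ s).
Proof.
move=> ab s1; have s10 : 0 < s + 1 by lra.
apply: (@intg_oo_bounded_primitive _ a b _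
    (fun x => - (s + 1)^-1 * (b - x) `^ (s + 1)) ((s + 1)^-1 *
      (b - a) `^ (s + 1)))
  => // x /andP[ax xb].
- have D := is_derive_powR_subr (s + 1) xb.
  apply: is_derive_eq; rewrite addrK /GRing.scale/= mulrN mulNr opprK mulrA
    mulVf ?mul1r//.
  by rewrite gt_eqF.
- exact: continuous_powR_subr.
- exact: powR_ge0.
- rewrite mulNr normrN ger0_norm ?mulr_ge0 ?powR_ge0 ?invr_ge0 ?(ltW s10)//.
  rewrite ler_pM2l ?invr_gt0// ge0_ler_powR ?(ltW s10)// ?nnegrE; lra.
Qed.

(** On each half of the interval one of the two factors lies between positive constants, so the
    singularities at the two ends can be separated additively. *)
Lemma powR_mul_le a b s t : a < b -> exists2 K, 0 < K &
  forall x, a < x < b ->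
    (x - a) `^ s * (b - x) `^ t <= K * ((x - a) `^ s + (b - x) `^ t).
Proof.
move=> ab.
pose L := b - a; have L0 : 0 < L by rewrite subr_gt0.
pose h := L / 2; have h0 : 0 < h by rewrite divr_gt0.
exists (h `^ s + L `^ s + (h `^ t + L `^ t)).
  by rewrite !addr_gt0// powR_gt0.
move=> x /andP[ax xb].
have Xs := powR_ge0 (x - a) s; have Yt := powR_ge0 (b - x) t.
have hs := powR_ge0 h s; have ht := powR_ge0 h t.
have Ls := powR_ge0 L s; have Lt := powR_ge0 L t.
have [xh|xh] := leP h (x - a).
  have le1 : (x - a) `^ s <= h `^ s + L `^ s.
    by apply: powR_leD => //; rewrite xh /L; lra.
  rewrite (le_trans (ler_wpM2r Yt le1))//; nra.
have le1 : (b - x) `^ t <= h `^ t + L `^ t.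
  by apply: powR_leD => //; apply/andP; rewrite /L; move: xh; rewrite /h /L;
    lra.
rewrite (le_trans (ler_wpM2l Xs le1))//; nra.
Qed.

Lemma measurable_powR_sub_mul a b s t (D : set RT) : measurable D ->
  measurable_fun D (fun x => (x - a) `^ s * (b - x) `^ t).
Proof.
move=> mD; apply: measurable_funM.
- apply: (measurableT_comp (measurable_powR s)).
  exact: measurable_funB.
- apply: (measurableT_comp (measurable_powR t)).
  exact: measurable_funB.
Qed.

Lemma intg_powR_sub_mul a b s t : a < b -> -1 < s -> -1 < t ->
  intg `]a, b[ (fun x => (x - a) `^ s * (b - x) `^ t).
Proof.
move=> ab s1 t1; have [K K0 HK] := powR_mul_le s t ab.
apply: (@intg_le _ _ _ (fun x => K * ((x - a) `^ s + (b - x) `^ t))).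
- exact: measurable_itv.
- by apply: measurable_powR_sub_mul; exact: measurable_itv.
- move=> x /=; rewrite in_itv/= => /HK.
  by rewrite ger0_norm// mulr_ge0// powR_ge0.
- apply: intgZl; first exact: measurable_itv.
  apply: intgD; first exact: measurable_itv.
    exact: intg_powR_subl.
  exact: intg_powR_subr.
Qed.

Lemma Rintegral_powR_Beta a b s t : a < b -> 0 < s -> 0 < t ->
  \int[mu]_(x in `]a, b[) ((x - a) `^ (s - 1) * (b - x) `^ (t - 1))
  = (b - a) `^ (s + t - 1) * Beta s t.
Proof.
move=> ab s0 t0; have L0 : 0 < b - a by rewrite subr_gt0.
have i1 : intg `]a, b[ (fun x => (x - a) `^ (s - 1) * (b - x) `^ (t - 1)).
  by apply: intg_powR_sub_mul => //; lra.
have [_ ->] := @Rintegral_affine R (b - a) a (lt0r_neq0 L0) _ _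
  (measurable_itv _) i1.
rewrite (gtr0_norm L0).
have -> : (fun x => (b - a) * x + a) @^-1` `]a, b[%classic = `]0, 1[%classic.
  apply/seteqP; split => x /=; rewrite !in_itv/= => /andP[H1 H2]; apply/andP;
    split.
  - by rewrite -(pmulr_rgt0 _ L0); lra.
  - by rewrite -(ltr_pM2l L0); lra.
  - by rewrite ltrDr mulr_gt0.
  - by rewrite -ltrBrDr -[ltRHS]mulr1 ltr_pM2l.
rewrite (@eq_int _ _ _ (fun x => (b - a) `^ (s + t - 2) *
  (x `^ (s - 1) * (1 - x) `^ (t - 1)))); last first.
  move=> x /=; rewrite in_itv/= => /andP[x0 x1].
  rewrite addrK.
  have -> : b - ((b - a) * x + a) = (b - a) * (1 - x) by ring.
  rewrite !powRM ?subr_ge0 ?(ltW x1) ?(ltW ab) ?(ltW x0)//.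
  have -> : s + t - 2 = (s - 1) + (t - 1) by ring.
  by rewrite (powR_addl (s - 1) (t - 1) L0); ring.
have i01 : intg (`]0, 1[%classic : set RT) (fun x => x `^ (s - 1) *
  (1 - x) `^ (t - 1)).
  have := @intg_powR_sub_mul 0 1 (s - 1) (t - 1) ltr01.
  under [fun x => (x - 0) `^ _ * _]eq_fun do rewrite subr0.
  by apply; lra.
rewrite (intZl _ (mitv _) i01).
rewrite mulrA; congr (_ * _).
have -> : s + t - 2 = (s + t - 1) - 1 by ring.
by rewrite [RHS]powR_sub1// mulrC.
Qed.

End powers.

(** * The Gamma function *)

Section gamma.
Context {R : realType}.
Local Notation mu := (@lebesgue_measure R).
Local Notation RT := (measurableTypeR R).
Implicit Types (a b s t x y : R).

Lemma exp_powR_bound y : 0 < y -> exists2 K, 0 < K & forall t, 0 <= t ->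
  (t + 1) `^ y * expR (- t) <= K.
Proof.
(* The constant comes from ln z <= z - 1 at z = (t + 1) / y, multiplied by y. *)
move=> y0; exists (expR (1 + y * ln y)); first exact: expR_gt0.
move=> t t0; have t1 : 0 < t + 1 by lra.
rewrite /powR (gt_eqF t1) -expRD ler_expR.
have := @le_ln1Dx R ((t + 1) / y - 1).
have -> : 1 + ((t + 1) / y - 1) = (t + 1) / y by ring.
rewrite ln_div ?posrE// => H.
have {}H : ln (t + 1) - ln y <= (t + 1) / y - 1.
  by apply: H; rewrite -subr_gt0 opprK subrK divr_gt0.
have : y * (ln (t + 1) - ln y) <= y * ((t + 1) / y - 1) by rewrite ler_pM2l.
have -> : y * ((t + 1) / y - 1) = t + 1 - y by field; rewrite gt_eqF.
lra.
Qed.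

Lemma continuous_gamma x t : 0 < t ->
  {for t, continuous (fun t : R => t `^ x * expR (- t))}.
Proof.
move=> t0; apply: continuousM.
  have := @continuous_powR_subl _ 0 x _ t0.
  by under [fun y => (y - 0) `^ x]eq_fun do rewrite subr0.
apply: continuous_comp; first exact: continuousN.
exact: continuous_expR.
Qed.

Lemma intg_gamma x : 0 < x -> intg `]0,
  +oo[ (fun t => t `^ (x - 1) * expR (- t)).
Proof.
move=> x0.
have x10 : 0 < x + 1 by lra.
have [K K0 HK] := exp_powR_bound x10.
(* The majorant t^(x - 1) (t + 1)^(- x - 1) is the derivative of (t / (t + 1))^x / x, a function
   bounded by 1 / x on the whole half-line; this treats 0 and infinity at once. *)
apply: (@intg_le _ _ _ (fun t => K * (t `^ (x - 1) * (t + 1) `^ (- x - 1)))).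
- exact: mitv.
- by apply: continuous_0y_measurable => t t0; exact: continuous_gamma.
- move=> t /=; rewrite in_itv/= andbT => t0; have t1 : 0 < t + 1 by lra.
  rewrite ger0_norm; last by rewrite mulr_ge0 ?powR_ge0 ?expR_ge0.
  rewrite mulrCA ler_wpM2l ?powR_ge0//.
  have -> : - x - 1 = - (x + 1) by ring.
  by rewrite powRN -ler_pdivrMr ?invr_gt0 ?powR_gt0// invrK mulrC HK// ltW.
- apply: intgZl; first exact: mitv.
  apply: (@intg_0y_bounded_primitive _ _ (fun t => x^-1 * (1 - (t + 1)^-1) `^ x)
    x^-1).
  + move=> t t0; have t1 : 0 < t + 1 by lra.
    have u0 : 0 < 1 - (t + 1)^-1.
      by rewrite subr_gt0 invf_lt1 ?ltrDr.
    have D1 : is_derive t 1 (fun t : R => 1 - (t + 1)^-1) ((t + 1) ^- 2).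
      have H0 : is_derive t 1 (fun t : R => t + 1) 1.
        by apply: is_derive_eq; rewrite addr0.
      have H := @is_deriveV R (fun t : R => t + 1) t 1 1 (lt0r_neq0 t1) H0.
      have D := is_deriveB (is_derive_cst (1 : R) t 1) H.
      apply: (is_derive_eq D); rewrite /GRing.scale/= sub0r.
      by rewrite mulr1 opprK.
    have D2 := @is_derive1_comp R (fun u => u `^ x) _ t _ _
      (is_derive1_powR x u0) D1.
    apply: is_derive_eq; rewrite /GRing.scale/= 2!mulrA mulVf ?gt_eqF// mul1r.
    have -> : 1 - (t + 1)^-1 = t * (t + 1)^-1 by field; rewrite gt_eqF.
    rewrite powRM ?(ltW t0) ?invr_ge0 ?(ltW t1)//.
    have -> : - x - 1 = - (x - 1) - 2 by ring.
    rewrite (powR_addl _ _ t1) powRN -mulrA; congr (_ * (_ * _)).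
      by rewrite -powR_inv1 ?(ltW t1)// -powRrM mulN1r powRN.
    by rewrite -powR_invn// ltW.
  + move=> t t0; have t1 : 0 < t + 1 by lra.
    apply: continuousM.
      have := @continuous_powR_subl _ 0 (x - 1) _ t0.
      by under [fun y => (y - 0) `^ _]eq_fun do rewrite subr0.
    have tm1 : -1 < t by lra.
    have := @continuous_powR_subl _ (-1) (- x - 1) _ tm1.
    by under [fun y => (y - -1) `^ _]eq_fun do rewrite opprK.
  + by move=> t _; rewrite mulr_ge0// powR_ge0.
  + move=> t t0; have t1 : 0 < t + 1 by lra.
    rewrite ger0_norm ?mulr_ge0 ?powR_ge0 ?invr_ge0 ?(ltW x0)//.
    rewrite -[leRHS]mulr1 ler_pM2l ?invr_gt0//.
    have u1 : 0 <= 1 - (t + 1)^-1 by rewrite subr_ge0 invf_le1 ?lerDr// ltW.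
    have := @ge0_ler_powR R x (ltW x0) (1 - (t + 1)^-1) 1.
    rewrite powR1; apply; rewrite ?nnegrE//.
    by rewrite gerBl invr_ge0 ltW.
Qed.

Lemma GammaE x : 0 < x -> Gamma x = Gamma_integral x.
Proof. by move=> x0; rewrite /Gamma x0. Qed.

Lemma Gamma_gt0 x : 0 < x -> 0 < Gamma x.
Proof.
move=> x0; rewrite GammaE// /Gamma_integral.
(* A positive lower bound of the integrand on ]1, 2[, valid for either sign of x - 1. *)
pose m := (1 `^ (1 - x) + 2 `^ (1 - x))^-1 * expR (-2).
have m0 : 0 < m by rewrite mulr_gt0 ?expR_gt0// invr_gt0 addr_gt0// powR_gt0.
have sub : `]1, 2[%classic `<=` (`]0, +oo[%classic : set R).
  by move=> t /=; rewrite !in_itv/= andbT => /andP[t1 _]; lra.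
have i := intg_gamma x0.
have i12 : intg `]1, 2[ (fun t => t `^ (x - 1) * expR (- t)).
  by apply: intgS i => //; exact: mitv.
have mle : forall t, 1 < t < 2 -> m <= t `^ (x - 1) * expR (- t).
  move=> t /andP[t1 t2]; have t0 : 0 < t by lra.
  apply: ler_pM; rewrite ?invr_ge0 ?addr_ge0 ?powR_ge0 ?expR_ge0//.
    have -> : x - 1 = - (1 - x) by ring.
    rewrite powRN lef_pV2 ?posrE ?powR_gt0 ?addr_gt0 ?powR_gt0//.
    by apply: powR_leD => //; rewrite !ltW.
  by rewrite ler_expR; lra.
apply: (@lt_le_trans _ _ (\int[mu]_(t in `]1, 2[) (t `^ (x - 1) * expR (- t))));
  last first.
  by apply: int_subset_le => // t _; rewrite mulr_ge0// ?powR_ge0 ?expR_ge0.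
apply: (@lt_le_trans _ _ (\int[mu]_(t in `]1, 2[) m)).
  by rewrite int_cst_oo ?ltr1n// mulr_gt0//; lra.
apply: le_Rintegral => //.
- apply: (@intg_bounded _ _ _ m) => //.
    by rewrite lebesgue_oo ?ltr1n// ltry.
  by move=> t _; rewrite ger0_norm// ltW.
Qed.

Lemma Gamma1 : Gamma 1 = 1 :> R.
Proof.
rewrite GammaE// /Gamma_integral.
have i := @intg_gamma 1 ltr01.
transitivity (0 - (-1) : R); last by rewrite sub0r opprK.
apply: (@FTC_0y _ _ (fun t => - expR (- t)) (-1) 0) => // [t t0|t t0| |].
- apply: is_derive_eq; rewrite subrr powRr0 mul1r /GRing.scale/=; ring.
- exact: continuous_gamma.
- have : {for 0, continuous (fun t : R => - expR (- t))}.
    apply: continuousN; apply: continuous_comp; first exact: continuousN.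
    exact: continuous_expR.
  by move/cvg_at_right_filter; rewrite oppr0 expR0.
- rewrite -oppr0; apply: cvgN; exact: cvgr_expR.
Qed.

Lemma Gamma_integralS x : 0 < x -> Gamma_integral (x + 1) =
  x * Gamma_integral x.
Proof.
move=> x0; have x10 : 0 < x + 1 by lra.
have i1 := intg_gamma x10; have i0 := intg_gamma x0.
have mD := @mitv R `]0, +oo[.
apply/eqP; rewrite -subr_eq0; apply/eqP.
rewrite /Gamma_integral -intZl// -intB//; last exact: intgZl.
have [K K0 HK] := exp_powR_bound x10.
transitivity (0 - 0 : R); last by rewrite subrr.
apply: (@FTC_0y _ _ (fun t => - (t `^ x * expR (- t))) 0 0) =>
  // [t t0|t t0| | |].
- have D1 := @is_derive1_powR R x t t0.
  apply: is_derive_eq; rewrite addrK /GRing.scale/=; ring.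
- apply: continuousB; first exact: continuous_gamma.
  apply: continuousM; first exact: cvg_cst.
  exact: continuous_gamma.
- by apply: intgB => //; exact: intgZl.
- rewrite -[X in _ --> X]oppr0; apply: cvgN.
  apply: (@squeeze_cvgr _ _ _ _ (fun=> 0) (fun t => t `^ x)).
  + near=> t; have t0 : 0 < t by near: t; exact: nbhs_right_gt.
    rewrite mulr_ge0 ?powR_ge0 ?expR_ge0//= ler_piMr ?powR_ge0//.
    by rewrite -expR0 ler_expR oppr_le0 ltW.
  + exact: cvg_cst.
  + exact: powR_cvg0.
- rewrite -[X in _ --> X]oppr0; apply: cvgN.
  apply: (@squeeze_cvgr _ _ _ _ (fun=> 0) (fun t => K * t^-1)).
  + near=> t; rewrite mulr_ge0 ?powR_ge0 ?expR_ge0//=.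
    have t0 : 0 < t by near: t; exact: nbhs_pinfty_gt.
    rewrite ler_pdivlMr// mulrAC.
    rewrite -{2}(powRr1 (ltW t0)) -powR_addl//.
    apply: le_trans (HK t (ltW t0)); rewrite ler_wpM2r ?expR_ge0//.
    by apply: ge0_ler_powR; rewrite ?nnegrE; lra.
  + exact: cvg_cst.
  + rewrite -[X in _ --> X](mulr0 K); apply: cvgM; first exact: cvg_cst.
    apply/cvgrPdist_le => e e0; near=> t.
    have te : e^-1 < t by near: t; apply: nbhs_pinfty_gt; exact: num_real.
    have ei : 0 < e^-1 by rewrite invr_gt0.
    have t0 : 0 < t by exact: lt_trans te.
    by rewrite sub0r normrN gtr0_norm ?invr_gt0// -[e]invrK lef_pV2 ?posrE//
      ltW.
Unshelve. all: by end_near. Qed.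

(** For x <= 0 the definition of [Gamma] shifts the argument by one particular number of steps. By
    the functional equation the quotient is the same for every shift that reaches positive
    arguments, provided that no factor vanishes. *)
Lemma Gamma_pole_free x N : (forall i, x + i%:R != 0) -> 0 < x + N%:R ->
  Gamma x * \prod_(i < N) (x + i%:R) = Gamma (x + N%:R).
Proof.
move=> xi xN.
have pn0 n : \prod_(i < n) (x + i%:R) != 0 by apply/prodf_neq0 => i _;
  exact: xi.
have step m n : 0 < x + m%:R ->
    Gamma_integral (x + (m + n)%:R) / \prod_(i < m + n) (x + i%:R) =
    Gamma_integral (x + m%:R) / \prod_(i < m) (x + i%:R).
  move=> xm; elim: n => [|n IH]; first by rewrite addn0.
  have xmn : 0 < x + (m + n)%:R by rewrite natrD addrA ltr_wpDr.
  rewrite -IH addnS big_ord_recr/= -natr1 addrA Gamma_integralS//.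
  have := pn0 (m + n)%N; have := xi (m + n)%N.
  by move: (_ + _ : R) (\prod_(i < _) _) (Gamma_integral _) => z P G z0 P0;
    field; rewrite z0 P0.
have stepN m : 0 < x + m%:R ->
    Gamma_integral (x + N%:R) / \prod_(i < N) (x + i%:R) =
    Gamma_integral (x + m%:R) / \prod_(i < m) (x + i%:R).
  move=> xm; have [mN|/ltnW Nm] := leqP m N.
    by rewrite -(subnKC mN) step.
  by rewrite -(subnKC Nm) step.
rewrite [RHS]GammaE// /Gamma; case: ifPn => [x0|x0].
  have := stepN 0; rewrite addr0 big_ord0 divr1 => <- //.
  by rewrite mulfVK.
rewrite -stepN ?mulfVK//.
have := truncnS_gt (- x).
by rewrite -subr_gt0 opprK addrC.
Qed.

Lemma GammaS x : 0 < x -> Gamma (x + 1) = x * Gamma x.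
Proof. by move=> x0; rewrite !GammaE ?Gamma_integralS// addr_gt0. Qed.

End gamma.

(** * The relation between Beta and Gamma *)

Section beta_gamma.
Context {R : realType}.
Local Notation mu := (@lebesgue_measure R).
Local Notation RT := (measurableTypeR R).
Implicit Types (a b s t x y : R).

Lemma measurable_powR_comp d (T : measurableType d) (D : set T) (f : T -> RT) s
  :
  measurable_fun D f -> measurable_fun D (fun z => (f z : R) `^ s).
Proof. by move=> mf; apply: (measurableT_comp (measurable_powR s)). Qed.

Lemma measurable_ltr_if d (T : measurableType d) (u v f : T -> R) :
  measurable_fun setT u -> measurable_fun setT v -> measurable_fun setT f ->
  measurable_fun setT (fun z => if u z < v z then f z else 0).
Proof.
move=> mu' mv mf; apply: measurable_fun_ifT => //.
exact: measurable_fun_ltr.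
Qed.

Lemma measurable_fst_RR : measurable_fun setT (fst : RT * RT -> RT).
Proof. exact: measurable_fst. Qed.

Lemma measurable_snd_RR : measurable_fun setT (snd : RT * RT -> RT).
Proof. exact: measurable_snd. Qed.

Lemma int_if (D E : set RT) (P : pred R) (f : R -> R) :
  (forall x, E x <-> D x /\ P x) ->
  \int[mu]_(x in D) (if P x then f x else 0) = \int[mu]_(x in E) f x.
Proof.
move=> H; rewrite [LHS]Rintegral_mkcond [RHS]Rintegral_mkcond.
apply: eq_Rintegral => x _; rewrite !patchE.
case: (boolP (x \in E)) => [/set_mem/H[Dx Px]|xE].
  by rewrite mem_set// Px.
case: ifPn => // /set_mem Dx; case: ifPn => // Px.
by move/negP : xE; case; apply/mem_set/H.
Qed.

Lemma eint_if (D E : set RT) (P : pred R) (f : R -> R) :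
  (forall x, E x <-> D x /\ P x) ->
  (\int[mu]_(x in D) (if P x then f x else 0)%:E =
    \int[mu]_(x in E) (f x)%:E)%E.
Proof.
move=> H; rewrite [LHS]integral_mkcond [RHS]integral_mkcond.
apply: eq_integral => x _; rewrite !patchE.
case: (boolP (x \in E)) => [/set_mem/H[Dx Px]|xE].
  by rewrite mem_set// Px.
case: ifPn => // /set_mem Dx; case: ifPn => // Px.
by move/negP : xE; case; apply/mem_set/H.
Qed.

Lemma eintE (D : set RT) (f : R -> R) : measurable D -> intg D f ->
  (\int[mu]_(x in D) (f x)%:E = (\int[mu]_(x in D) f x)%R%:E)%E.
Proof. by move=> mD fi; rewrite /Rintegral fineK//;
  exact: integrable_fin_num. Qed.

(** Fubini for exp(- v) s^(x - 1) (v - s)^(y - 1) on the region 0 < s < v: integrating over s first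
    produces Beta(x, y) times the integrand of Gamma(x + y), integrating over v first produces
    Gamma(y) times the integrand of Gamma(x). *)
Lemma Beta_Gamma x y : 0 < x -> 0 < y ->
  Beta x y * Gamma (x + y) = Gamma x * Gamma y.
Proof.
move=> x0 y0; have xy0 : 0 < x + y by lra.
pose f (p : RT * RT) : R := if (p.2 : R) < p.1 then
  expR (- p.1) * (p.2 `^ (x - 1) * (p.1 - p.2) `^ (y - 1)) else 0.
pose D : set RT := `]0, +oo[%classic.
have mD : measurable D := mitv _.
have m1 := measurable_fst_RR; have m2 := measurable_snd_RR.
have mf : measurable_fun setT f.
  apply: measurable_ltr_if => //.
  apply: measurable_funM.
    apply: (measurableT_comp (@measurable_expR R)).
    by apply: measurable_funN; exact: m1.
  apply: measurable_funM; first exact: measurable_powR_comp.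
  by apply: measurable_powR_comp; exact: measurable_funB.
have f0 p : 0 <= f p.
  rewrite /f; case: ifP => // _.
  by rewrite !mulr_ge0 ?expR_ge0 ?powR_ge0.
have E0v v s : 0 < v -> (`]0, v[%classic : set RT) s <-> D s /\ s < v.
  move=> v0; rewrite /D /= !in_itv/= andbT; split => [/andP[]|[]]//.
  by move=> -> ->.
have iB v : 0 < v -> intg `]0, v[
    (fun s => expR (- v) * (s `^ (x - 1) * (v - s) `^ (y - 1))).
  move=> v0; apply: intgZl; first exact: mitv.
  have := @intg_powR_sub_mul R 0 v (x - 1) (y - 1) v0.
  under [fun z => (z - 0) `^ _ * _]eq_fun do rewrite subr0.
  by apply; lra.
have IB v : 0 < v -> \int[mu]_(s in `]0, v[)
    (expR (- v) * (s `^ (x - 1) * (v - s) `^ (y - 1))) =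
    Beta x y * (v `^ (x + y - 1) * expR (- v)).
  move=> v0.
  have := @Rintegral_powR_Beta R 0 v x y v0 x0 y0.
  under [fun z => (z - 0) `^ _ * _]eq_fun do rewrite subr0.
  rewrite subr0 => E.
  rewrite intZl; [|exact: mitv|].
    by rewrite E; ring.
  have := @intg_powR_sub_mul R 0 v (x - 1) (y - 1) v0.
  under [fun z => (z - 0) `^ _ * _]eq_fun do rewrite subr0.
  by apply; lra.
pose g v := Beta x y * (v `^ (x + y - 1) * expR (- v)).
have ig : intg D g by apply: intgZl => //; exact: intg_gamma.
have mfD : measurable_fun (D `*` D) f.
  by apply: measurable_funS mf => //; exact: measurableX.
have fg v : D v -> (\int[mu]_(s in D) `|f (v, s)|%:E <= (g v)%:E)%E.
  rewrite /D/= in_itv/= andbT => v0.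
  under eq_integral do rewrite ger0_norm//.
  rewrite (eint_if _ (E0v v ^~ v0)) eintE; [|exact: mitv|exact: iB].
  by rewrite IB.
have [_ _ _ F] := Rintegral_Fubini mD mD mfD ig fg.
have -> : Gamma (x + y) = \int[mu]_(t in D) (t `^ (x + y - 1) * expR (- t)).
  by rewrite GammaE.
rewrite -(intZl _ mD (intg_gamma xy0)).
transitivity (\int[mu]_(v in D) \int[mu]_(s in D) f (v, s)).
  apply: eq_int => v; rewrite /D/= in_itv/= andbT => v0.
  by rewrite (int_if _ (E0v v ^~ v0)) IB.
rewrite {}F (GammaE x0).
transitivity (\int[mu]_(s in D) (Gamma y * (s `^ (x - 1) * expR (- s))));
  last first.
  by rewrite (intZl _ mD (intg_gamma x0)) mulrC.
apply: eq_int => s; rewrite /D/= in_itv/= andbT => s0.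
have Es v : (`]s, +oo[%classic : set RT) v <-> D v /\ s < v.
  rewrite /D /= !in_itv/= !andbT; split => [sv|[]//]; split => //.
  exact: lt_trans sv.
rewrite (int_if (fun v => expR (- v) * (s `^ (x - 1) * (v - s) `^ (y - 1))) Es).
pose k v := expR (- v) * (s `^ (x - 1) * (v - s) `^ (y - 1)).
have hE : (fun v => 1 * v + - s) @^-1` D = `]s, +oo[%classic.
  by apply/seteqP; split => v; rewrite /D/= !in_itv/= !andbT mul1r subr_gt0.
have [ik Ek] := @Rintegral_affine R 1 (- s) (oner_neq0 _) D _ mD
  (intg_gamma y0).
rewrite hE normr1 mul1r in ik Ek.
rewrite GammaE// /Gamma_integral Ek mulrC -intZl; [|exact: mitv|exact: ik].
apply: eq_int => v _; rewrite mul1r.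
have -> : - (v - s) = - v + s by ring.
have E : expR (- s) * expR s = 1 by rewrite -expRD addNr expR0.
rewrite expRD -[LHS]mulr1 -E; ring.
Qed.

End beta_gamma.

(** * Jacobi polynomials *)

Section jq.
Context {R : realType}.
Local Notation mu := (@lebesgue_measure R).
Local Notation RT := (measurableTypeR R).
Implicit Types (a b s t x y e u v : R) (p q : {poly R}).

Lemma horner_bounded q c : exists2 K, 0 <= K & forall x, `|x| <= c ->
  `|q.[x]| <= K.
Proof.
elim/poly_ind: q => [|q d [K K0 HK]].
  by exists 0 => // x _; rewrite horner0 normr0.
exists (K * `|c| + `|d|) => [|x xc]; first by rewrite addr_ge0// mulr_ge0.
rewrite hornerMXaddC (le_trans (ler_normD _ _))// lerD2r normrM.
by rewrite ler_pM// ?HK// (le_trans xc)// ler_norm.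
Qed.

Lemma horner_bounded_oo q a b : exists2 K, 0 <= K &
  forall x, a < x < b -> `|q.[x]| <= K.
Proof.
have [K K0 HK] := horner_bounded q (`|a| + `|b|).
exists K => // x /andP[ax xb]; apply: HK.
have := ler_norm b; have := ler_normr (- a) `|a|; rewrite ler_norml.
have := lerNnormlW (lexx `|a|).
have := normr_ge0 a; have := normr_ge0 b => H1 H2 H3 _ H4.
by apply/andP; split; lra.
Qed.

Lemma measurable_horner q (D : set RT) : measurable_fun D (fun x : RT => q.[x]).
Proof.
apply: measurable_funS (measurableT) (@subsetT _ _) _.
by apply: continuous_measurable_fun; exact: continuous_horner.
Qed.

Lemma intg_powR_poly a b u v q : a < b -> -1 < u -> -1 < v ->
  intg `]a, b[ (fun x => (x - a) `^ u * (b - x) `^ v * q.[x]).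
Proof.
move=> ab u1 v1; have [K K0 HK] := horner_bounded_oo q a b.
apply: (@intg_le _ _ _ (fun x => K * ((x - a) `^ u * (b - x) `^ v))).
- exact: mitv.
- apply: measurable_funM; last exact: measurable_horner.
  by apply: measurable_powR_sub_mul; exact: mitv.
- move=> x /=; rewrite in_itv/= => /HK qK.
  by rewrite normrM mulrC ler_pM// ger0_norm// mulr_ge0// powR_ge0.
- by apply: intgZl; [exact: mitv|exact: intg_powR_sub_mul].
Qed.

Lemma cvg_powR_subl0 a u : 0 < u -> (x - a) `^ u @[x --> a^'+] --> 0.
Proof.
move=> u0; apply/cvgrPdist_le => e e0.
have r0 : 0 < e `^ u^-1 by rewrite powR_gt0.
near=> x.
have ax : a < x by near: x; exact: nbhs_right_gt.
have xr : x <= a + e `^ u^-1 by near: x; apply: nbhs_right_le; rewrite ltrDl.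
rewrite sub0r normrN ger0_norm ?powR_ge0//.
have -> : e = (e `^ u^-1) `^ u by rewrite -powRrM mulVf ?gt_eqF// powRr1// ltW.
by apply: ge0_ler_powR; rewrite ?nnegrE ?powR_ge0; lra.
Unshelve. all: by end_near. Qed.

Lemma cvg_powR_subr0 b u : 0 < u -> (b - x) `^ u @[x --> b^'-] --> 0.
Proof.
move=> u0; apply/cvgrPdist_le => e e0.
have r0 : 0 < e `^ u^-1 by rewrite powR_gt0.
near=> x.
have ax : x < b by near: x; exact: nbhs_left_lt.
have xr : b - e `^ u^-1 <= x by near: x; apply: nbhs_left_ge;
  rewrite ltrBlDr ltrDl.
rewrite sub0r normrN ger0_norm ?powR_ge0//.
have -> : e = (e `^ u^-1) `^ u by rewrite -powRrM mulVf ?gt_eqF// powRr1// ltW.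
by apply: ge0_ler_powR; rewrite ?nnegrE ?powR_ge0; lra.
Unshelve. all: by end_near. Qed.

Lemma cvg_powR_poly_at_left_end a b u v q : a < b -> 0 < u ->
  (x - a) `^ u * (b - x) `^ v * q.[x] @[x --> a^'+] --> 0.
Proof.
move=> ab u0.
have H : (x - a) `^ u * (b - x) `^ v * q.[x] @[x --> a^'+] -->
    0 * (b - a) `^ v * q.[a].
  apply: cvgM; last by apply: cvg_at_right_filter; exact: continuous_horner.
  apply: cvgM; first exact: cvg_powR_subl0.
  by apply: cvg_at_right_filter; exact: continuous_powR_subr.
by rewrite !mul0r in H.
Qed.

Lemma cvg_powR_poly_at_right_end a b u v q : a < b -> 0 < v ->
  (x - a) `^ u * (b - x) `^ v * q.[x] @[x --> b^'-] --> 0.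
Proof.
move=> ab v0.
have H : (x - a) `^ u * (b - x) `^ v * q.[x] @[x --> b^'-] -->
    (b - a) `^ u * 0 * q.[b].
  apply: cvgM; last by apply: cvg_at_left_filter; exact: continuous_horner.
  apply: cvgM; last exact: cvg_powR_subr0.
  by apply: cvg_at_left_filter; exact: continuous_powR_subl.
by rewrite mulr0 mul0r in H.
Qed.

(* The k-th derivative of (x - a)^s (b - x)^t is (x - a)^(s - k) (b - x)^(t -
   k) times this polynomial. *)
Fixpoint jq a b s t (k : nat) : {poly R} :=
  if k is k'.+1 then
    ((s - k'%:R)%:P * (b%:P - 'X) - (t - k'%:R)%:P * ('X - a%:P)) *
      jq a b s t k' +
    ('X - a%:P) * (b%:P - 'X) * (jq a b s t k')^`()
  else 1.

Lemma jq0 a b s t : jq a b s t 0 = 1. Proof. by []. Qed.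

Lemma jqS a b s t k : jq a b s t k.+1 =
  ((s - k%:R)%:P * (b%:P - 'X) - (t - k%:R)%:P * ('X - a%:P)) * jq a b s t k +
  ('X - a%:P) * (b%:P - 'X) * (jq a b s t k)^`().
Proof. by []. Qed.

Arguments jq : simpl never.

(** Together with [jq_is_derive] this is the Jacobi differential equation: for s = beta + n, t = gam
    + n and k + 1 = n the factor is minus the eigenvalue n (n + beta + gam + 1). It makes the
    primitive of p_n w a multiple of (x - a)^(beta + 1) (b - x)^(gam + 1) p_n'. *)
Lemma jq_derivE a b s t k :
  (jq a b s t k.+1)^`() = (- (k.+1%:R * (s + t - k%:R)))%:P * jq a b s t k.
Proof.
elim: k => [|k IH].
  have d1 : (1 : {poly R})^`() = 0 by exact: derivC.
  rewrite jqS jq0 d1 mulr0 addr0 !mulr1 derivB !derivM !derivB !derivC !derivX.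
  rewrite !subr0 mul1r !(polyCN, polyCD); ring.
rewrite [jq _ _ _ _ k.+2]jqS derivD !derivM IH !derivM jqS.
rewrite !derivB !derivM !derivB !derivC !derivX.
move: (jq _ _ _ _ _) => Q.
rewrite -!natr1 !(polyCN, polyCB, polyCM, polyCD) polyC1; ring.
Qed.

Lemma size_jq a b s t k : (size (jq a b s t k) <= k.+1)%N.
Proof.
elim: k => [|k IH]; rewrite ?jqS; first by rewrite size_polyC oner_eq0.
have size_bX : (size (b%:P - 'X)%R <= 2)%N.
  by rewrite -opprB size_polyN size_XsubC.
have size_Xa : (size ('X - a%:P)%R <= 2)%N by rewrite size_XsubC.
rewrite (leq_trans (size_polyD _ _))// geq_max; apply/andP; split.
  rewrite (leq_trans (size_polyMleq _ _))//.
  have : (size ((s - k%:R)%:P * (b%:P - 'X) - (t - k%:R)%:P * ('X - a%:P))%R <=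
    2)%N.
    rewrite (leq_trans (size_polyD _ _))// size_polyN geq_max !mul_polyC.
    by rewrite !(leq_trans (size_scale_leq _ _)).
  by move: IH; move: (size _) (size _) => m n; lia.
rewrite (leq_trans (size_polyMleq _ _))//.
have H1 : (size (('X - a%:P) * (b%:P - 'X))%R <= 3)%N.
  rewrite (leq_trans (size_polyMleq _ _))// -ltnS; move: size_bX size_Xa.
  by move: (size _) (size _) => m n; lia.
have H2 : (size (jq a b s t k)^`() <= k)%N.
  have [->|p0] := eqVneq (jq a b s t k) 0; first by rewrite deriv0 size_poly0.
  by rewrite -ltnS (leq_trans (lt_size_deriv p0)).
by move: H1 H2; move: (size _) (size _) => m n; lia.
Qed.

(** Comparing the top coefficients in [jq_derivE] gives a recursion in k. *)
Lemma coef_jq a b s t k :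
  (jq a b s t k)`_k = \prod_(j < k) (- (s + t - j%:R)).
Proof.
elim: k => [|k IH]; first by rewrite jq0 coef1 big_ord0.
have /(congr1 (fun p => p`_k)) := jq_derivE a b s t k.
rewrite coef_deriv coefCM IH big_ord_recr/= -[LHS]mulr_natl => H.
have k0 : (k.+1%:R : R) != 0 by rewrite pnatr_eq0.
by apply: (mulfI k0); rewrite H; ring.
Qed.

Lemma is_derive_powR_poly a b u v q x : a < x < b ->
  is_derive x 1 (fun y => (y - a) `^ u * (b - y) `^ v * q.[y])
    ((x - a) `^ (u - 1) * (b - x) `^ (v - 1) *
      ((u * (b - x) - v * (x - a)) * q.[x] + (x - a) * (b - x) * q^`().[x])).
Proof.
move=> /andP[ax xb].
have D1 := is_derive_powR_subl u ax.
have D2 := is_derive_powR_subr v xb.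
have D3 := is_derive_poly q x.
apply: (is_derive_eq (is_deriveM (is_deriveM D1 D2) D3)).
transitivity ((x - a) `^ u * (b - x) `^ v * q^`().[x] +
  q.[x] * ((x - a) `^ u * - (v * (b - x) `^ (v - 1)) +
           (b - x) `^ v * (u * (x - a) `^ (u - 1)))); first by [].
have xa0 : 0 < x - a by rewrite subr_gt0.
have bx0 : 0 < b - x by rewrite subr_gt0.
rewrite (powR_sub1 u xa0) (powR_sub1 v bx0); ring.
Qed.

Lemma jq_is_derive a b s t k x : a < x < b ->
  is_derive x 1 (fun y => (y - a) `^ (s - k%:R) * (b - y) `^ (t - k%:R) *
      (jq a b s t k).[y])
    ((x - a) `^ (s - k.+1%:R) * (b - x) `^ (t - k.+1%:R) *
      (jq a b s t k.+1).[x]).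
Proof.
move=> axb; apply: (is_derive_eq (is_derive_powR_poly _ _ _ axb)).
have eS w : w - k.+1%:R = w - k%:R - 1 :> R by rewrite -natr1 opprD addrA.
rewrite !eS; congr (_ * _).
by rewrite jqS !(hornerD, hornerN, hornerM, hornerX, hornerC).
Qed.

Lemma jq_derive1n a b s t k x : a < x < b ->
  derive1n k (fun y : R => (y - a) `^ s * (b - y) `^ t) x =
  (x - a) `^ (s - k%:R) * (b - x) `^ (t - k%:R) * (jq a b s t k).[x].
Proof.
elim: k x => [|k IH] x axb.
  by rewrite derive1n0 !subr0 hornerC mulr1.
rewrite derive1nS derive1E.
rewrite (@near_eq_derive _ _ _ _ (fun y : R =>
    (y - a) `^ (s - k%:R) * (b - y) `^ (t - k%:R) * (jq a b s t k).[y])).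
  by have [_ ->] := jq_is_derive s t k axb.
have xab : x \in `]a, b[ by rewrite in_itv.
by apply: filterS (near_in_itvoo xab) => y yab; apply: IH; move: yab;
  rewrite in_itv.
Qed.

(** Integration by parts k times moves all derivatives onto (x - a)^e; the boundary terms vanish
    under the two exponent conditions. The exponent e is real because fractional integration of
    powers produces non-integral moments. *)
Lemma jq_moment a b s t e k : a < b -> -1 < e + s - k%:R -> -1 < t - k%:R ->
  \int[mu]_(x in `]a, b[)
    ((x - a) `^ (e + s - k%:R) * (b - x) `^ (t - k%:R) * (jq a b s t k).[x]) =
  (-1) ^+ k * (\prod_(j < k) (e - j%:R)) *
  \int[mu]_(x in `]a, b[) ((x - a) `^ (e - k%:R + s) * (b - x) `^ t).
Proof.
move=> ab; elim: k e => [|k IH] e es tk.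
  rewrite expr0 big_ord0 !mul1r; apply: eq_int => x _.
  by rewrite !subr0 hornerC mulr1.
have eS w : w - k.+1%:R = w - k%:R - 1 by rewrite -natr1 opprD addrA.
have es' : 0 < e + s - k%:R by rewrite eS in es; lra.
have tk' : 0 < t - k%:R by rewrite eS in tk; lra.
have i1 := @intg_powR_poly a b (e - 1 + s - k%:R) (t - k%:R) (jq a b s t k) ab.
have i2 := @intg_powR_poly a b (e + s - k.+1%:R) (t - k.+1%:R) (jq a b s t k.+1)
  ab es tk.
have {}i1 := i1 ltac:(lra) ltac:(lra).
set q := jq a b s t k in i1 *.
set q1 := jq a b s t k.+1 in i2 *.
pose F x := (x - a) `^ (e + s - k%:R) * (b - x) `^ (t - k%:R) * q.[x].
(* The product rule for (x - a)^e times the k-th derivative: the first summand is the integral for k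
   with e - 1 in place of e, the second is the wanted integrand for k + 1. *)
pose f x := e * ((x - a) `^ (e - 1 + s - k%:R) * (b - x) `^ (t - k%:R) * q.[x])
  +
   (x - a) `^ (e + s - k.+1%:R) * (b - x) `^ (t - k.+1%:R) * q1.[x].
have dF x : a < x < b -> is_derive x 1 F (f x).
  move=> axb; apply: (is_derive_eq (is_derive_powR_poly _ _ _ axb)).
  have /andP[ax xb] := axb; have bx0 : 0 < b - x by rewrite subr_gt0.
  rewrite /f !eS (_ : e - 1 + s - k%:R = e + s - k%:R - 1); last by ring.
  rewrite (powR_sub1 (t - k%:R) bx0) /q1 jqS -/q.
  rewrite !(hornerD, hornerN, hornerM, hornerX, hornerC).
  move: (_ `^ _) (_ `^ _) => P1 P2; ring.
have cf x : a < x < b -> {for x, continuous f}.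
  move=> /andP[ax xb]; apply: continuousD.
    apply: continuousM; first exact: cvg_cst.
    apply: continuousM; last exact: continuous_horner.
    by apply: continuousM; [exact: continuous_powR_subl|exact:
      continuous_powR_subr].
  apply: continuousM; last exact: continuous_horner.
  by apply: continuousM; [exact: continuous_powR_subl|exact:
    continuous_powR_subr].
have fi : intg `]a, b[ f.
  by apply: intgD; [exact: mitv|apply: intgZl;
    [exact: mitv|exact: i1]|exact: i2].
have FA : F x @[x --> a^'+] --> 0 by exact: cvg_powR_poly_at_left_end.
have FB : F x @[x --> b^'-] --> 0 by exact: cvg_powR_poly_at_right_end.
have := FTC_oo ab dF cf fi FA FB.
rewrite subrr /f intD; [|exact: mitv|by apply: intgZl;
  [exact: mitv|exact: i1]|exact: i2].
rewrite (intZl _ (mitv _) i1) IH; [|lra|lra].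
move=> /eqP; rewrite addrC addr_eq0 => /eqP ->.
rewrite exprS big_ord_recl/= subr0.
have -> : \prod_(i < k) (e - (bump 0 i)%:R) = \prod_(j < k) (e - 1 - j%:R).
  by apply: eq_bigr => i _; rewrite /bump/= add1n -nat1r opprD addrA.
rewrite (_ : e - k.+1%:R = e - 1 - k%:R); last by rewrite eS; ring.
ring.
Qed.

End jq.

(** * Orthonormality of the Jacobi polynomials *)

Section jacobi.
Context {R : realType}.
Local Notation mu := (@lebesgue_measure R).
Local Notation RT := (measurableTypeR R).
Variables (a b beta gam : R).
Hypothesis ab : a < b.
Hypothesis hb : - (1 / 2) <= beta.
Hypothesis hg : - (1 / 2) <= gam.
Implicit Types (x e : R) (p q : {poly R}).

Local Notation w := (weight a b beta gam).
Local Notation Jp := (jacobi_poly a b beta gam).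
Local Notation delta := (jacobi_delta a b beta gam).
Local Notation y n := (jq a b (beta + n%:R) (gam + n%:R) n).

Lemma poly_eq_oo p q : (forall x, a < x < b -> p.[x] = q.[x]) -> p = q.
Proof.
move=> pq; apply/eqP; rewrite -subr_eq0; apply/eqP; set r := p - q.
apply: (@roots_geq_poly_eq0 _ r [seq a + (b - a) / (i.+2)%:R | i <- iota 0
  (size r)]).
- apply/allP => _ /mapP[i _ ->]; rewrite /root /r hornerD hornerN subr_eq0.
  apply/eqP/pq; have L0 : 0 < b - a by rewrite subr_gt0.
  rewrite ltrDl divr_gt0//= -ltrBrDl ltr_pdivrMr// ltr_pMr// ltr1n//.
- rewrite map_inj_uniq ?iota_uniq// => i j /addrI /mulfI.
  rewrite subr_eq0 gt_eqF// => /(_ isT) /invr_inj /eqP.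
  by rewrite eqr_nat => /eqP[].
- by rewrite size_map size_iota.
Qed.

Lemma rodriguesE n x : a < x < b -> rodrigues a b beta gam n x = (y n).[x].
Proof.
move=> axb; have /andP[ax xb] := axb.
rewrite /rodrigues jq_derive1n// !addrK mulrA mulrACA.
by rewrite -!powR_addl ?subr_gt0// !addNr !powRr0 !mul1r.
Qed.

Lemma jacobi_polyE n : Jp n = delta n *: y n.
Proof.
apply: poly_eq_oo => x axb; rewrite jacobi_polyP ?in_itv// hornerZ.
by rewrite rodriguesE.
Qed.

Lemma hbg1 : 0 <= beta + gam + 1. Proof. by move: hb hg => h1 h2; lra. Qed.
Lemma hb1 : 0 < beta + 1. Proof. by move: hb => h1; lra. Qed.
Lemma hg1 : 0 < gam + 1. Proof. by move: hg => h1; lra. Qed.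

(** Used twice: for integral e < n the falling factorial vanishes, which is orthogonality, and for e
    = k + alpha it gives the entries of the matrix of the fractional integral. *)
Lemma jacobi_moment n e : -1 < e + beta ->
  \int[mu]_(x in `]a, b[) ((x - a) `^ (e + beta) * (b - x) `^ gam * (y n).[x]) =
  (-1) ^+ n * (\prod_(j < n) (e - j%:R)) *
  ((b - a) `^ (e + beta + gam + n%:R + 1) * Beta (e + beta + 1) (gam + n%:R +
    1)).
Proof.
move=> eb; have := hg1; have n0 : 0 <= n%:R :> R by [].
move=> hg1'; have := @jq_moment R a b (beta + n%:R) (gam + n%:R) e n ab.
rewrite !addrA !addrK => -> //; [|lra].
congr (_ * _).
rewrite (_ : e - n%:R + beta + n%:R = e + beta); last by ring.
have RB := @Rintegral_powR_Beta R a b (e + beta + 1) (gam + n%:R + 1) ab.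
rewrite !addrK in RB; rewrite RB; [|lra|lra].
by congr (_ `^ _ * _); ring.
Qed.

Lemma taylor_coef q n : (size q <= n.+1)%N -> q^`N(n) = (q`_n)%:P.
Proof.
move=> sq; apply/polyP => i; rewrite coef_nderivn coefC.
case: i => [|i]; first by rewrite addn0 binn mulr1n.
by rewrite nth_default ?mul0rn// (leq_trans sq)// addnS ltnS leq_addr.
Qed.

(** After a Taylor expansion of q at a, the falling factorial in [jacobi_moment] kills every power
    below the n-th, so only the top coefficient of q survives. *)
Lemma jacobi_pairing q n : (size q <= n.+1)%N ->
  \int[mu]_(x in `]a, b[) (w x * q.[x] * (y n).[x]) =
  (-1) ^+ n * n`!%:R * q`_n *
  ((b - a) `^ (beta + gam + 2 * n%:R + 1) * Beta (beta + n%:R + 1) (gam + n%:R +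
    1)).
Proof.
move=> sq.
have mD := @mitv R `]a, b[.
have hb1' := hb1; have hg1' := hg1.
have ib i : intg `]a, b[ (fun x => (x - a) `^ (i%:R + beta) * (b - x) `^ gam *
  (y n).[x]).
  by apply: intg_powR_poly => //; have : 0 <= i%:R :> R by []; lra.
transitivity (\int[mu]_(x in `]a, b[) (\sum_(i < n.+1) (q^`N(i)).[a] *
   ((x - a) `^ (i%:R + beta) * (b - x) `^ gam * (y n).[x]))).
  apply: eq_int => x /=; rewrite in_itv/= => /andP[ax xb].
  have xa0 : 0 < x - a by rewrite subr_gt0.
  have -> : q.[x] = q.[a + (x - a)] by rewrite addrC subrK.
  rewrite (nderiv_taylor_wide _ sq); last exact: mulrC.
  rewrite mulr_sumr mulr_suml; apply: eq_bigr => i _.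
  by rewrite powR_addl// powR_mulrn ?(ltW xa0)// /weight; ring.
rewrite Rintegral_sum//; last by move=> i _; exact: intgZl.
rewrite big_ord_recr/= big1 ?add0r; last first.
  move=> i _; rewrite intZl// jacobi_moment; last first.
    by have : 0 <= i%:R :> R by []; lra.
  rewrite (bigD1 (Ordinal (ltn_ord i)))//= subrr mul0r !mulr0 mul0r mulr0//.
rewrite intZl// jacobi_moment; last by have : 0 <= n%:R :> R by []; lra.
rewrite taylor_coef// hornerC.
have -> : \prod_(j < n) (n%:R - j%:R) = n`!%:R :> R.
  rewrite fact_prod natr_prod -(big_mkord xpredT (fun j => n%:R - j%:R)).
  rewrite big_nat_rev/= add0n big_add1/= !big_mkord; apply: eq_bigr => i _.
  rewrite -natrB ?leq_subr//; congr (_%:R).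
  by case: i => i /= Hi; lia.
rewrite (_ : n%:R + beta + gam + n%:R + 1 = beta + gam + 2 * n%:R + 1);
  last by ring.
rewrite (_ : n%:R + beta + 1 = beta + n%:R + 1); last by ring.
ring.
Qed.

Lemma jacobi_delta_neq0 n : delta n != 0.
Proof.
have hb1' := hb1; have hg1' := hg1; have hbg := hbg1.
have n0 : 0 <= n%:R :> R by [].
have L0 : 0 < b - a by rewrite subr_gt0.
rewrite /jacobi_delta; case: ifPn => [/andP[/eqP n00 bg]|nbg].
  by rewrite mul1r invr_eq0 gt_eqF// sqrtr_gt0 mulr_gt0// Gamma_gt0.
have H : 0 < beta + gam + n%:R + 1.
  case: n n0 nbg => [_ /=|n _ _]; first by rewrite addr0 lt_neqAle eq_sym => ->.
  by rewrite -natr1; have : 0 <= n%:R :> R by []; lra.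
rewrite !mulf_neq0 ?signr_eq0 ?invr_eq0 ?gt_eqF ?powR_gt0// sqrtr_gt0.
  lra.
rewrite divr_gt0 ?Gamma_gt0// !mulr_gt0 ?Gamma_gt0 ?ltr0n ?fact_gt0//; lra.
Qed.

Lemma size_jacobi_poly n : size (Jp n) = n.+1.
Proof.
rewrite jacobi_polyE size_scale ?jacobi_delta_neq0//.
apply/eqP; rewrite eqn_leq size_jq/= ltnNge; apply/negP => sn.
have : (y n)`_n = 0 by rewrite nth_default.
rewrite coef_jq => /eqP; apply/negP/prodf_neq0 => i _.
have := hbg1; have := ltn_ord i; rewrite oppr_eq0 -(ltr_nat R) => iR.
have [n0|n0] : (n = 0 \/ 0 < n)%N by case: (n) => [|m]; [left|right].
  by move: (ltn_ord i); rewrite {2}n0.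
have : 1 <= n%:R :> R by rewrite ler1n.
by move=> n1 h; apply: lt0r_neq0; lra.
Qed.

(** [Beta_Gamma] rewrites the Beta value, and [Gamma_pole_free] turns the product in the leading
    coefficient into the quotient of Gamma(beta + gam + 2n + 1) by Gamma(beta + gam + n + 1). For n
    = 0 and beta + gam + 1 = 0 the denominator would be at a pole, and the special value of delta_0
    is checked directly. *)
Lemma jacobi_norm n :
  delta n ^+ 2 * ((-1) ^+ n * n`!%:R * (y n)`_n *
  ((b - a) `^ (beta + gam + 2 * n%:R + 1) * Beta (beta + n%:R + 1) (gam + n%:R +
    1))) = 1.
Proof.
have hb1' := hb1; have hg1' := hg1; have hbg := hbg1.
have n0 : 0 <= n%:R :> R by [].
have L0 : 0 < b - a by rewrite subr_gt0.
have bn : 0 < beta + n%:R + 1 by lra.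
have gn : 0 < gam + n%:R + 1 by lra.
have := Beta_Gamma bn gn.
set Ga := Gamma (beta + n%:R + 1); set Gb := Gamma (gam + n%:R + 1).
have Ga0 : 0 < Ga by exact: Gamma_gt0.
have Gb0 : 0 < Gb by exact: Gamma_gt0.
set Bt := Beta _ _.
have f0 : n`!%:R != 0 :> R by rewrite pnatr_eq0 -lt0n fact_gt0.
rewrite coef_jq.
have -> : (-1) ^+ n * n`!%:R *
    \prod_(j < n) - (beta + n%:R + (gam + n%:R) - j%:R) =
    n`!%:R * \prod_(j < n) (beta + gam + n%:R + 1 + j%:R) :> R.
  rewrite prodrN cardT size_enum_ord mulrACA mulrCA mulrA -mulrA -exprMn.
  rewrite mulrNN mulr1 expr1n mul1r; congr (_ * _).
  rewrite (reindex_inj rev_ord_inj)/=; apply: eq_bigr => i _.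
  rewrite natrB ?ltn_ord// -natr1; ring.
rewrite /jacobi_delta; case: ifPn => [/andP[/eqP n00 /eqP bg]|nbg].
  subst n; rewrite (_ : beta + 0%:R + 1 + (gam + 0%:R + 1) = beta + gam + 1 +
    1); last by ring.
  rewrite {1}bg add0r.
  rewrite Gamma1 mulr1 => ->.
  rewrite fact0 big_ord0 !mul1r mulr0 addr0 bg powRr0 mul1r.
  rewrite exprVn sqr_sqrtr; last by rewrite mulr_ge0// ltW// Gamma_gt0.
  move: Ga0 Gb0; rewrite /Ga /Gb !addr0 => Ga0 Gb0.
  by rewrite mulVf// gt_eqF// mulr_gt0.
have H : 0 < beta + gam + n%:R + 1.
  case: n n0 nbg {bn gn Ga Gb Ga0 Gb0 Bt f0} => [_ /=|n _ _];
    first by rewrite addr0 lt_neqAle eq_sym => ->.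
  by rewrite -natr1; have : 0 <= n%:R :> R by []; lra.
have Hi i : beta + gam + n%:R + 1 + i%:R != 0.
  by rewrite gt_eqF// ltr_wpDr.
have Hn : 0 < beta + gam + n%:R + 1 + n%:R by rewrite ltr_wpDr.
have PF := Gamma_pole_free Hi Hn.
have := GammaS Hn.
rewrite (_ : beta + gam + n%:R + 1 + n%:R + 1 = beta + n%:R + 1 +
  (gam + n%:R + 1)); last by ring.
move=> ->; rewrite -PF.
set Gx := Gamma (beta + gam + n%:R + 1).
have Gx0 : 0 < Gx by exact: Gamma_gt0.
set Pr := \prod_(j < n) _ => BG.
have s1 : Num.sqrt (beta + gam + 2 * n%:R + 1) ^+ 2 = beta + gam + 2 * n%:R + 1.
  by rewrite sqr_sqrtr//; lra.
have s2 : Num.sqrt (Gx / (n`!%:R * Ga * Gb)) ^+ 2 = Gx / (n`!%:R * Ga * Gb).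
  by rewrite sqr_sqrtr// divr_ge0 ?mulr_ge0 ?ltW.
have s3 : ((b - a) `^ (n%:R + (beta + gam + 1) / 2)) ^+ 2 =
    (b - a) `^ (beta + gam + 2 * n%:R + 1).
  by rewrite expr2 -powR_addl//; congr (_ `^ _); field.
rewrite !exprMn exprVn s1 s2 s3 sqrr_sign mul1r.
set Lp := _ `^ _; have Lp0 : 0 < Lp by rewrite powR_gt0.
transitivity (Bt * ((beta + gam + n%:R + 1 + n%:R) * (Gx * Pr)) / (Ga * Gb)).
  by field; rewrite f0 !gt_eqF.
by rewrite BG mulfV// gt_eqF// mulr_gt0.
Qed.

Lemma weight_ge0 x : 0 <= w x. Proof. by rewrite mulr_ge0// powR_ge0. Qed.

Lemma intg_weight_poly q : intg `]a, b[ (fun x => w x * q.[x]).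
Proof. by apply: intg_powR_poly => //; have := hb1; have := hg1; lra. Qed.

Lemma jacobi_orth_low q n : (size q <= n)%N ->
  \int[mu]_(x in `]a, b[) (w x * q.[x] * (Jp n).[x]) = 0.
Proof.
move=> qn.
rewrite (@eq_int _ _ _ (fun x => delta n * (w x * q.[x] * (y n).[x])));
  last first.
  by move=> x _; rewrite jacobi_polyE hornerZ; ring.
rewrite intZl; [|exact: mitv|].
  rewrite jacobi_pairing; last exact: leqW.
  by rewrite [q`_n]nth_default// mulr0 mul0r mulr0.
apply: (@eq_intg _ _ (fun x => w x * (q * y n).[x])); first exact: mitv.
  by move=> x _; rewrite hornerM mulrA.
exact: intg_weight_poly.
Qed.

Lemma jacobi_orthonormal m n :
  \int[mu]_(x in `]a, b[) (w x * (Jp m).[x] * (Jp n).[x]) = (m == n)%:R.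
Proof.
have [mn|nm|->] := ltngtP m n.
- by rewrite jacobi_orth_low// size_jacobi_poly.
- transitivity (\int[mu]_(x in `]a, b[) (w x * (Jp n).[x] * (Jp m).[x])).
    by apply: eq_int => x _; ring.
  by rewrite jacobi_orth_low// size_jacobi_poly.
- rewrite -(jacobi_norm n).
  rewrite (@eq_int _ _ _ (fun x => delta n ^+ 2 *
    (w x * (y n).[x] * (y n).[x]))); last first.
    by move=> x _; rewrite jacobi_polyE hornerZ; ring.
  rewrite intZl; [|exact: mitv|].
    by rewrite jacobi_pairing// size_jq.
  apply: (@eq_intg _ _ (fun x => w x * (y n * y n).[x])); first exact: mitv.
    by move=> x _; rewrite hornerM mulrA.
  exact: intg_weight_poly.
Qed.

End jacobi.

(** * Functions with vanishing moments *)

Section moments.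
Context {R : realType}.
Local Notation mu := (@lebesgue_measure R).
Local Notation RT := (measurableTypeR R).
Implicit Types (a b c x u : R) (G : R -> R).

Lemma bernoulli_ge u n : 0 <= u -> 1 + n%:R * u <= (1 + u) ^+ n.
Proof.
move=> u0; elim: n => [|n IH]; first by rewrite mul0r addr0 expr0.
rewrite exprS -natr1; have n0 : 0 <= n%:R :> R by [].
have := ler_wpM2l (addr_ge0 ler01 u0) IH; nra.
Qed.

Lemma bernoulli_le u n : 0 <= u <= 1 -> 1 - n%:R * u <= (1 - u) ^+ n.
Proof.
move=> /andP[u0 u1]; elim: n => [|n IH]; first by rewrite mul0r subr0 expr0.
rewrite exprS -natr1; have n0 : 0 <= n%:R :> R by [].
have u1' : 0 <= 1 - u by lra.
have := ler_wpM2l u1' IH; nra.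
Qed.

Lemma bernoulli_inv u n : 0 <= u <= 1 -> (1 - u) ^+ n * (1 + n%:R * u) <= 1.
Proof.
move=> /andP[u0 u1]; have u1' : 0 <= 1 - u by lra.
apply: (@le_trans _ _ ((1 - u) ^+ n * (1 + u) ^+ n)).
  by rewrite ler_wpM2l ?exprn_ge0// bernoulli_ge.
rewrite -exprMn exprn_ile1//; first by rewrite mulr_ge0//; lra.
nra.
Qed.

(* The polynomials (1 - xi^k)^N with N = ceil(theta^-k) converge boundedly to
   the indicator of xi < theta. *)
Let N (th : R) k := (Num.truncn (th ^- k)).+1.

Let N_bounds th k : 0 < th < 1 -> th ^- k <= (N th k)%:R <= 2 * th ^- k.
Proof.
move=> /andP[t0 t1].
have h1 : 1 <= th ^- k by rewrite -exprVn exprn_ege1// invf_ge1// ltW.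
have h0 : 0 <= th ^- k by lra.
have /andP[A B] := truncn_itv h0.
by rewrite (ltW B)/= /N -natr1; lra.
Qed.

Let step_poly (th xi : R) k : R := (1 - xi ^+ k) ^+ (N th k).

Let step_poly_bound th xi k : 0 < xi < 1 -> 0 <= step_poly th xi k <= 1.
Proof.
move=> /andP[x0 x1]; have := exprn_ile1 k (ltW x0) (ltW x1).
have := exprn_ge0 k (ltW x0) => h0 h1.
by rewrite exprn_ge0 ?exprn_ile1//; lra.
Qed.

Let step_poly_cvg1 th xi : 0 < th < 1 -> 0 < xi < th ->
  step_poly th xi k @[k --> \oo] --> (1 : R).
Proof.
move=> /andP[t0 t1] /andP[x0 xt].
apply: (@squeeze_cvgr _ _ _ _ (fun k => 1 - 2 * (xi / th) ^+ k) (fun=> 1)).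
- near=> k; have x1 : xi < 1 by lra.
  have x01 : 0 < xi < 1 by rewrite x0.
  have /andP[_ ->] := step_poly_bound th k x01; rewrite andbT.
  apply: (@le_trans _ _ (1 - (N th k)%:R * xi ^+ k)).
    have t01 : 0 < th < 1 by rewrite t0.
    have /andP[_ NB] := N_bounds k t01.
    rewrite lerB// exprMn exprVn.
    have := ler_wpM2r (exprn_ge0 k (ltW x0)) NB; lra.
  apply: bernoulli_le; rewrite exprn_ge0 ?(ltW x0)//= exprn_ile1// ltW//.
- rewrite -[X in _ --> X]subr0 -(mulr0 2).
  apply: cvgB; first exact: cvg_cst.
  apply: cvgM; first exact: cvg_cst.
  apply: cvg_expr; rewrite ger0_norm ?divr_ge0 ?ltW// ltr_pdivrMr// mul1r//.
- exact: cvg_cst.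
Unshelve. all: by end_near. Qed.

Let step_poly_cvg0 th xi : 0 < th < 1 -> th < xi < 1 ->
  step_poly th xi k @[k --> \oo] --> (0 : R).
Proof.
move=> /andP[t0 t1] /andP[tx x1]; have x0 : 0 < xi by lra.
apply: (@squeeze_cvgr _ _ _ _ (fun=> 0) (fun k => (th / xi) ^+ k)).
- near=> k.
  have x01 : 0 < xi < 1 by rewrite x0.
  have /andP[s0 s1] := step_poly_bound th k x01; rewrite s0/=.
  have t01 : 0 < th < 1 by rewrite t0.
  have /andP[NB _] := N_bounds k t01.
  have xk0 : 0 < xi ^+ k by rewrite exprn_gt0.
  have tk0 : 0 < th ^+ k by rewrite exprn_gt0.
  have xk : 0 <= xi ^+ k <= 1 by rewrite ltW//= exprn_ile1// ltW.
  have := bernoulli_inv (N th k) xk; rewrite -/(step_poly th xi k) => H.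
  have H2 : step_poly th xi k * (th ^- k * xi ^+ k) <= 1.
    apply: le_trans H; rewrite ler_wpM2l//.
    have := ler_wpM2r (ltW xk0) NB; lra.
  rewrite exprMn exprVn ler_pdivlMr// -[leRHS]mul1r -ler_pdivrMr//.
  by apply: le_trans H2; rewrite le_eqVlt mulrAC mulrA; apply/orP; left;
    apply/eqP; ring.
- exact: cvg_cst.
- apply: cvg_expr; rewrite ger0_norm ?divr_ge0 ?ltW// ltr_pdivrMr// mul1r//.
Unshelve. all: by end_near. Qed.

(** The step polynomials stay between 0 and 1 on the interval, so dominated convergence replaces
    them by the indicator of ]a, c[. The point c, where nothing is claimed, is a null set. *)
Lemma moments_zero_initial a b c G : a < c < b -> intg `]a, b[ G ->
  (forall q : {poly R}, \int[mu]_(x in `]a, b[) (G x * q.[x]) = 0) ->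
  \int[mu]_(x in `]a, c[) G x = 0.
Proof.
move=> /andP[ac cb] iG G0.
have ab : a < b by exact: lt_trans cb.
have L0 : 0 < b - a by rewrite subr_gt0.
pose th := (c - a) / (b - a).
have th01 : 0 < th < 1.
  by rewrite divr_gt0 ?subr_gt0//= ltr_pdivrMr// mul1r ltrD2r.
pose D : set RT := `]a, b[%classic.
have mD : measurable D := mitv _.
pose q k : {poly R} := (1 - ((b - a)^-1 *: ('X - a%:P)) ^+ k) ^+ (N th k).
have qE k x : (q k).[x] = step_poly th ((x - a) / (b - a)) k.
  rewrite /q /step_poly horner_exp hornerD hornerN horner_exp hornerZ
    hornerXsubC.
  by rewrite -[1]/(1%:P) hornerC mulrC.
pose f k x := G x * (q k).[x].
pose f' x : R := if x < c then G x else 0.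
have mG := intg_measurable iG.
have mf k : measurable_fun D (EFin \o f k).
  by apply/measurable_EFinP; apply: measurable_funM => //;
    exact: measurable_horner.
have mf' : measurable_fun D (EFin \o f').
  apply/measurable_EFinP.
  have -> : f' = (fun x => G x * (if x < c then 1 else 0)).
    by apply/funext => x; rewrite /f'; case: ifP; rewrite ?mulr1 ?mulr0.
  apply: measurable_funM => //; apply: (measurable_funS measurableT) => //.
  apply: (@measurable_ltr_if R _ RT id (cst c) (cst 1)) => //.
have cvgf : {ae mu, forall x, D x -> (f k x)%:E @[k --> \oo] --> (f' x)%:E}.
  exists [set c]; split; [exact: measurable_set1|exact: lebesgue_measure_set1|].
  move=> x /=; apply: contra_notP => /eqP xc.
  rewrite /D/= in_itv/= => /andP[ax xb].
  have xi0 : 0 < (x - a) / (b - a) by rewrite divr_gt0// subr_gt0.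
  have cv : G x * step_poly th ((x - a) / (b - a)) k @[k --> \oo] --> f' x.
    rewrite /f'; case: (ltgtP x c) xc => // xc _.
      rewrite -[X in _ --> X]mulr1; apply: cvgM; first exact: cvg_cst.
      by apply: step_poly_cvg1 => //; rewrite xi0/= ltr_pM2r ?invr_gt0// ltrD2r.
    rewrite -[X in _ --> X](mulr0 (G x)); apply: cvgM; first exact: cvg_cst.
    apply: step_poly_cvg0 => //; rewrite ltr_pM2r ?invr_gt0// ltrD2r xc/=.
    by rewrite ltr_pdivrMr// mul1r ltrD2r.
  rewrite /f; under eq_fun do rewrite qE.
  by apply: cvg_EFin; [exact: nearW|exact: cv].
have domf : {ae mu, forall x k, D x -> (`|(f k x)%:E| <= `|G x|%:E)%E}.
  apply: aeW => x k; rewrite /D/= in_itv/= => /andP[ax xb].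
  rewrite lee_fin normrM ler_piMr// qE.
  have : 0 < (x - a) / (b - a) < 1.
    by rewrite divr_gt0 ?subr_gt0//= ltr_pdivrMr// mul1r ltrD2r.
  by move=> /(step_poly_bound th k)/andP[s0 s1]; rewrite ger0_norm.
have [if' _ H] := dominated_convergence mD mf mf' cvgf (intg_norm mD iG) domf.
have E : (\int[mu]_(x in D) (f' x)%:E)%E = 0%E.
  apply/esym/(cvg_unique _ _ H) => //.
  rewrite [X in X @ _](_ : _ = fun=> 0%E); first exact: cvg_cst.
  apply/funext => k /=; rewrite eintE//; first by rewrite G0.
  apply: (@intg_le _ _ _ (fun x => `|G x|)) => //.
  - exact/measurable_EFinP.
  - move=> x; rewrite /D/= in_itv/= => /andP[ax xb].
    rewrite normrM ler_piMr// qE.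
    have : 0 < (x - a) / (b - a) < 1.
      by rewrite divr_gt0 ?subr_gt0//= ltr_pdivrMr// mul1r ltrD2r.
    by move=> /(step_poly_bound th k)/andP[s0 s1]; rewrite ger0_norm.
  - exact: intg_norm.
have DE x : (`]a, c[%classic : set RT) x <-> D x /\ x < c.
  rewrite /D/= !in_itv/=; split => [/andP[ax xc]|[/andP[ax _] xc]].
    by rewrite ax (lt_trans xc).
  by rewrite ax.
by rewrite -(int_if G DE) /Rintegral -/f' E.
Qed.

(** The indefinite integral of G vanishes by [moments_zero_initial], and by Lebesgue's
    differentiation theorem its derivative is G almost everywhere. *)
Lemma moments_zero_ae a b G : a < b -> intg `]a, b[ G ->
  (forall q : {poly R}, \int[mu]_(x in `]a, b[) (G x * q.[x]) = 0) ->
  {ae mu, forall x, a < x < b -> G x = 0}.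
Proof.
move=> ab iG G0.
pose D : set RT := `]a, b[%classic.
have mD : measurable D := mitv _.
pose g := G \_ D.
have ig : intg setT g := intg_patch mD iG.
have lg : locally_integrable [set: R] g by exact: integrable_locally iG.
have igy y : intg `]-oo, y] g.
  by apply: intgS ig => //; exact: mitv.
have := FTC1Ny igy lg; apply: filterS;
  first exact: (ae_filter_ringOfSetsType mu).
move=> x [dF F'] /andP[ax xb].
have xD : x \in D by apply/mem_set; rewrite /D/= in_itv/= ax.
have <- : g x = G x by rewrite /g patchE xD.
rewrite -F' derive1E.
rewrite (@near_eq_derive _ _ _ _ (cst 0)) ?derive_cst//.
have xab : x \in `]a, b[ by rewrite in_itv/= ax.
apply: filterS (near_in_itvoo xab) => z; rewrite in_itv/= => /andP[az zb].
rewrite /g -Rintegral_mkcondr.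
rewrite (_ : _ `&` _ = `]a, z]%classic); last first.
  apply/seteqP; split => v; rewrite /D/= !in_itv/=.
    by move=> [-> /andP[->]].
  by move=> /andP[av vz]; rewrite vz av (le_lt_trans vz).
rewrite -Rintegral_itv_bndo_bndc.
  by apply: moments_zero_initial iG G0; rewrite az.
apply: intgS iG => // v /=; rewrite !in_itv/= => /andP[-> vz].
exact: lt_trans zb.
Qed.

End moments.

(** * Endpoint bounds for Jacobi polynomials *)

Section sonin.
Context {R : realType}.
Local Notation mu := (@lebesgue_measure R).
Local Notation RT := (measurableTypeR R).
Variables (a b beta gam lam : R).
Hypothesis ab : a < b.
Hypothesis hbeta : - (1 / 2) <= beta <= 1 / 2.
Hypothesis hgam : - (1 / 2) <= gam <= 1 / 2.
Hypothesis lam1 : 1 <= lam.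
Variables (y P : R -> R).
Local Notation w := (weight a b beta gam).
Hypothesis dP : forall x, a < x < b -> is_derive x 1 P (w x * y x).
Hypothesis dy : forall x, a < x < b ->
  is_derive x 1 y (- lam * P x / ((x - a) * (b - x) * w x)).

Let B := beta + 1 / 2.
Let C := gam + 1 / 2.
(** This is the Liouville normal form. Let dx/dtheta = ((x - a) (b - x))^(1/2) and u = r^(1/2) y.
    Then du/dtheta = r^(-1/2) D and u'' + phi u = 0 in the variable theta, so that u^2 + u'^2 / phi
    is the classical Sonin function. Here B (1 - B) = 1/4 - beta^2, and the condition |beta|, |gam|
    <= 1/2 makes phi >= lam. *)
Let r (x : R) := (x - a) `^ B * (b - x) `^ C.
Let phi x := lam + (B + C) ^+ 2 / 4 +
  (b - a) / 4 * (B * (1 - B) * (x - a)^-1 + C * (1 - C) * (b - x)^-1).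
Let dphi x := (b - a) / 4 *
  (C * (1 - C) * (b - x) ^- 2 - B * (1 - B) * (x - a) ^- 2).
Let D x := 2^-1 * (B * (b - x) - C * (x - a)) * w x * y x - lam * P x.
(* Sonin's energy: F' = - D^2 phi' / (r phi^2), where phi' is bounded above
   away from the right end; so F' >= - K F there, and F at x is controlled by
   F at any later point. *)
Let F x := r x * y x ^+ 2 + D x ^+ 2 / (r x * phi x).

Let L0 : 0 < b - a. Proof. by rewrite subr_gt0. Qed.
Let B01 : 0 <= B <= 1. Proof. by move: hbeta; rewrite /B => /andP[h1 h2];
  apply/andP; split; lra. Qed.
Let C01 : 0 <= C <= 1. Proof. by move: hgam; rewrite /C => /andP[h1 h2];
  apply/andP; split; lra. Qed.

Let w_gt0 x : a < x < b -> 0 < w x.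
Proof. by move=> /andP[ax xb]; rewrite mulr_gt0// powR_gt0// subr_gt0. Qed.

Let r_gt0 x : a < x < b -> 0 < r x.
Proof. by move=> /andP[ax xb]; rewrite mulr_gt0// powR_gt0// subr_gt0. Qed.

Let r2 x : a < x < b -> r x ^+ 2 = w x ^+ 2 * ((x - a) * (b - x)).
Proof.
move=> /andP[ax xb].
have X0 : 0 < x - a by rewrite subr_gt0.
have Y0 : 0 < b - x by rewrite subr_gt0.
have E (z s : R) : 0 < z -> (z `^ (s + 1 / 2)) ^+ 2 = (z `^ s) ^+ 2 * z.
  move=> z0; rewrite !expr2 -!powR_addl//.
  by rewrite -{3}(powRr1 (ltW z0)) -powR_addl//; congr (_ `^ _); field.
by rewrite /r /weight /B /C !exprMn (E _ beta X0) (E _ gam Y0); ring.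
Qed.

Let dw x : a < x < b ->
  is_derive x 1 w (w x * (beta * (b - x) - gam * (x - a)) /
    ((x - a) * (b - x))).
Proof.
move=> axb; have /andP[ax xb] := axb.
have X0 : 0 < x - a by rewrite subr_gt0.
have Y0 : 0 < b - x by rewrite subr_gt0.
have D1 := is_derive_powR_subl beta ax.
have D2 := is_derive_powR_subr gam xb.
apply: (is_derive_eq (is_deriveM D1 D2)).
rewrite /weight /GRing.scale/= (powR_sub1 beta X0) (powR_sub1 gam Y0).
by field; rewrite !gt_eqF.
Qed.

Let dr x : a < x < b ->
  is_derive x 1 r (r x * (B * (b - x) - C * (x - a)) / ((x - a) * (b - x))).
Proof.
move=> axb; have /andP[ax xb] := axb.
have X0 : 0 < x - a by rewrite subr_gt0.
have Y0 : 0 < b - x by rewrite subr_gt0.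
have D1 := is_derive_powR_subl B ax.
have D2 := is_derive_powR_subr C xb.
apply: (is_derive_eq (is_deriveM D1 D2)).
rewrite /r /GRing.scale/= (powR_sub1 B X0) (powR_sub1 C Y0).
by field; rewrite !gt_eqF.
Qed.

Let is_derive_invX x : a < x -> is_derive x (1 : R) (fun z : R => (z - a)^-1)
  (- (x - a) ^- 2).
Proof.
move=> ax; have X0 : x - a != 0 by rewrite gt_eqF// subr_gt0.
have D1 : is_derive x (1 : R) (fun z : R => z - a) 1.
  by apply: is_derive_eq; rewrite subr0.
apply: (is_derive_eq (@is_deriveV R _ x 1 1 X0 D1)).
by rewrite /GRing.scale/= mulr1.
Qed.

Let is_derive_invY x : x < b -> is_derive x (1 : R) (fun z : R => (b - z)^-1)
  ((b - x) ^- 2).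
Proof.
move=> xb; have Y0 : b - x != 0 by rewrite gt_eqF// subr_gt0.
have D1 : is_derive x (1 : R) (fun z : R => b - z) (-1).
  by apply: (is_derive_eq (is_deriveB (is_derive_cst b x 1)
    (is_derive_id x 1))); rewrite sub0r.
apply: (is_derive_eq (@is_deriveV R _ x (-1) 1 Y0 D1)).
by rewrite /GRing.scale/= mulrN1 opprK.
Qed.

Let is_derive_phi x : a < x < b -> is_derive x 1 phi (dphi x).
Proof.
move=> /andP[ax xb].
have D1 := is_derive_invX ax; have D2 := is_derive_invY xb.
have D3 := is_deriveD (is_deriveZ (B * (1 - B)) D1) (is_deriveZ (C * (1 - C))
  D2).
have D4 := is_deriveD (is_derive_cst (lam + (B + C) ^+ 2 / 4) x 1)
  (is_deriveZ ((b - a) / 4) D3).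
apply: (is_derive_eq D4).
by rewrite /GRing.scale/= /dphi; ring.
Qed.

Let phi_ge x : a < x < b -> lam <= phi x.
Proof.
move=> /andP[ax xb]; have /andP[B0 B1] := B01; have /andP[C0 C1] := C01.
rewrite /phi -addrA lerDl addr_ge0// ?divr_ge0 ?sqr_ge0//.
rewrite mulr_ge0 ?divr_ge0 ?(ltW L0)// addr_ge0// mulr_ge0 ?invr_ge0 ?subr_ge0
  ?(ltW ax) ?(ltW xb)// mulr_ge0// subr_ge0//.
Qed.

Let is_derive_D x : a < x < b -> is_derive x 1 D
  (- phi x * w x * y x + 2^-1 * (B * (b - x) - C * (x - a)) * D x /
    ((x - a) * (b - x))).
Proof.
move=> axb; have /andP[ax xb] := axb.
have X0 : 0 < x - a by rewrite subr_gt0.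
have Y0 : 0 < b - x by rewrite subr_gt0.
have w0 := w_gt0 axb.
have D1 : is_derive x (1 : R) (fun z => 2^-1 * (B * (b - z) - C * (z - a)))
  (- (2^-1 * (B + C))).
  apply: is_derive_eq; rewrite /GRing.scale/=; ring.
have D2 := is_deriveB (is_deriveM (is_deriveM D1 (dw axb)) (dy axb))
  (is_deriveZ lam (dP axb)).
apply: (is_derive_eq D2).
rewrite /GRing.scale/= /D /phi.
rewrite /B /C.
transitivity (2^-1 * (B * (b - x) - C * (x - a)) * w x *
  (- lam * P x / ((x - a) * (b - x) * w x)) +
 y x * (2^-1 * (B * (b - x) - C * (x - a)) *
   (w x * (beta * (b - x) - gam * (x - a)) / ((x - a) * (b - x))) +
   w x * - (2^-1 * (B + C))) - lam * (w x * y x)); first by [].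
move: (w x) w0 (y x) (P x) => W W0 Yv Pv; rewrite /B /C.
by field; rewrite !gt_eqF.
Qed.

Let is_derive_F x : a < x < b ->
  is_derive x 1 F (- (D x ^+ 2 * dphi x / (r x * phi x ^+ 2))).
Proof.
move=> axb; have /andP[ax xb] := axb.
have X0 : 0 < x - a by rewrite subr_gt0.
have Y0 : 0 < b - x by rewrite subr_gt0.
have w0 := w_gt0 axb; have r0 := r_gt0 axb.
have phi0 : 0 < phi x by rewrite (lt_le_trans _ (phi_ge axb))//
  (lt_le_trans ltr01).
have rp0 : r x * phi x != 0 by rewrite mulf_neq0// gt_eqF.
have D1 := is_deriveM (dr axb) (is_deriveX 2 (dy axb)).
have D2 := is_deriveX 2 (is_derive_D axb).
have D3 := @is_deriveV R _ x _ 1 rp0 (is_deriveM (dr axb) (is_derive_phi axb)).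
have D4 := is_deriveD D1 (is_deriveM D2 D3).
apply: (is_derive_eq D4).
pose X := x - a; pose Y := b - x.
pose dy' := - lam * P x / (X * Y * w x).
pose dr' := r x * (B * Y - C * X) / (X * Y).
transitivity (r x * (2 * y x * dy') + y x ^+ 2 * dr' +
  (D x ^+ 2 * (- (r x * phi x) ^- 2 * (r x * dphi x + phi x * dr')) +
  (r x * phi x)^-1 * (2 * D x * (- phi x * w x * y x +
     2^-1 * (B * Y - C * X) * D x / (X * Y))))); first by [].
have E1 : dy' = (D x - 2^-1 * (B * Y - C * X) * w x * y x) / (X * Y * w x).
  by rewrite /dy' /D; congr (_ / _); rewrite /X /Y; ring.
rewrite {}E1 /dr'; have := r2 axb; rewrite -/X -/Y.
rewrite -/X in X0; rewrite -/Y in Y0.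
move: (w x) w0 (r x) r0 (phi x) phi0 (dphi x) (y x) (D x) =>
  W W0 Rr R0 Ph Ph0 dPh yv Dv E2.
(* The mixed term in y D is proportional to r^2 - w^2 (x - a) (b - x), which is zero by [r2]. *)
transitivity (- (Dv ^+ 2 * dPh / (Rr * Ph ^+ 2)) +
  2 * yv * Dv * (Rr ^+ 2 - W ^+ 2 * (X * Y)) / (X * Y * W * Rr)).
  by field; rewrite !gt_eqF.
by rewrite E2 subrr mulr0 mul0r addr0.
Qed.

Let phi_gt0 x : a < x < b -> 0 < phi x.
Proof. by move=> axb; apply: lt_le_trans (phi_ge axb);
  exact: lt_le_trans lam1. Qed.

Let Dq_ge0 x : a < x < b -> 0 <= D x ^+ 2 / (r x * phi x).
Proof.
move=> axb; rewrite divr_ge0 ?sqr_ge0// ltW//.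
by apply: mulr_gt0; [exact: r_gt0|exact: phi_gt0].
Qed.

Let F_ge0 x : a < x < b -> 0 <= F x.
Proof.
move=> axb; rewrite /F addr_ge0//; last exact: Dq_ge0.
by rewrite mulr_ge0 ?sqr_ge0// ltW// r_gt0.
Qed.

(** The term of the left end is nonpositive, and up to three quarters of the interval the right end
    is at distance at least (b - a) / 4, while C (1 - C) <= 1/4. *)
Let dphi_le x : a < x -> x <= a + 3 / 4 * (b - a) -> dphi x <= (b - a)^-1.
Proof.
move=> ax xm; have /andP[B0 B1] := B01; have /andP[C0 C1] := C01; have L0' :=
  L0.
have X0 : 0 < x - a by rewrite subr_gt0.
have Y4 : (b - a) / 4 <= b - x by lra.
have Y0 : 0 < b - x by lra.
have c4 : C * (1 - C) <= 4^-1 by have := sqr_ge0 (C - 1 / 2); lra.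
have c0 : 0 <= C * (1 - C) by rewrite mulr_ge0// subr_ge0.
have b0 : 0 <= B * (1 - B) by rewrite mulr_ge0// subr_ge0.
apply: (@le_trans _ _ ((b - a) / 4 * (4^-1 * ((b - a) / 4) ^- 2))); last first.
  by rewrite le_eqVlt; apply/orP; left; apply/eqP; field; rewrite gt_eqF.
rewrite /dphi ler_wpM2l ?divr_ge0 ?(ltW L0)//.
apply: (@le_trans _ _ (C * (1 - C) * (b - x) ^- 2)).
  by rewrite lerBlDr lerDl mulr_ge0// invr_ge0 sqr_ge0.
apply: ler_pM => //; first by rewrite invr_ge0 sqr_ge0.
rewrite lef_pV2 ?posrE ?exprn_gt0 ?divr_gt0//.
by rewrite lerXn2r// ?nnegrE ltW// divr_gt0.
Qed.

(** As phi >= 1, the bound on phi' gives F' >= - F / (b - a). Thus F(z) exp(z / (b - a)) is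
    nondecreasing, and the exponential varies by a factor of at most e over the interval. *)
Let F_growth x x' : a < x -> x <= x' -> x' <= a + 3 / 4 * (b - a) ->
  F x <= expR 1 * F x'.
Proof.
move=> ax xx' x'm; have L0' := L0.
have zin z : x <= z <= x' -> a < z < b by move=> /andP[h1 h2]; apply/andP;
  split; lra.
pose G z := F z * expR (z / (b - a)).
pose dG z := - (D z ^+ 2 * dphi z / (r z * phi z ^+ 2)) * expR (z / (b - a)) +
   F z * (expR (z / (b - a)) / (b - a)).
have dGz z : x <= z <= x' -> is_derive z 1 G (dG z).
  move=> /zin zab.
  have D1 : is_derive z (1 : R) (fun z : R => z / (b - a)) (b - a)^-1.
    have := is_deriveZ (b - a)^-1 (is_derive_id z (1 : R)).
    rewrite (_ : (b - a)^-1 \*: id = fun z => z / (b - a)); last first.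
      by apply/funext => u; rewrite /GRing.scale/= mulrC.
    by rewrite /GRing.scale/= mulr1.
  have D2 := @is_derive1_comp R expR _ z _ _ (is_derive_expR _) D1.
  apply: (is_derive_eq (is_deriveM (is_derive_F zab) D2)).
  by rewrite /dG /GRing.scale/=; ring.
have dG0 z : x <= z <= x' -> 0 <= dG z.
  move=> zx; have zab := zin _ zx; have /andP[az zb] := zab.
  have r0 := r_gt0 zab; have ph1 := le_trans lam1 (phi_ge zab).
  have ph0 : 0 < phi z by rewrite (lt_le_trans _ ph1).
  have zm : z <= a + 3 / 4 * (b - a) by move/andP : zx => [_ h];
    exact: le_trans x'm.
  have dl := dphi_le az zm.
  rewrite /dG; have -> : - (D z ^+ 2 * dphi z / (r z * phi z ^+ 2)) *
    expR (z / (b - a)) +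
   F z * (expR (z / (b - a)) / (b - a)) =
   (F z / (b - a) - D z ^+ 2 * dphi z / (r z * phi z ^+ 2)) *
     expR (z / (b - a)) by ring.
  rewrite mulr_ge0 ?expR_ge0// subr_ge0.
  have q0 := Dq_ge0 zab.
  apply: (@le_trans _ _ (D z ^+ 2 / (r z * phi z) / (b - a))); last first.
    rewrite ler_wpM2r ?invr_ge0 ?(ltW L0)// /F lerDr mulr_ge0 ?sqr_ge0
      ?(ltW r0)//.
  have -> : D z ^+ 2 * dphi z / (r z * phi z ^+ 2) = D z ^+ 2 / (r z * phi z) *
    (dphi z / phi z).
    by field; rewrite !gt_eqF.
  rewrite ler_wpM2l//; apply: (@le_trans _ _ ((b - a)^-1 / phi z)).
    by rewrite ler_wpM2r ?invr_ge0 ?(ltW ph0).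
  by rewrite ler_piMr ?invr_ge0 ?(ltW L0)// invf_le1.
have GG : G x <= G x'.
  have Gc : {within `[x, x'], continuous G}.
    apply: continuous_in_subspaceT => z /set_mem/=; rewrite in_itv/= => zx.
    exact: is_derive_continuous (dGz z zx).
  have [|c cx E] := @MVT_segment R G dG x x' xx' _ Gc.
    by move=> z; rewrite in_itv/= => /andP[h1 h2]; apply: dGz; rewrite !ltW.
  by rewrite -subr_ge0 E mulr_ge0 ?subr_ge0// dG0//; move: cx; rewrite in_itv.
have E0 : 0 < expR (x / (b - a)) by exact: expR_gt0.
rewrite -(ler_pM2r E0); apply: (le_trans GG).
rewrite /G mulrAC mulrC ler_wpM2r//; first by apply: F_ge0;
  rewrite zin// xx' lexx.
have e1 : 1 + x / (b - a) = (b - a + x) / (b - a) by field; exact: lt0r_neq0.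
by rewrite -expRD ler_expR e1 ler_pM2r ?invr_gt0//; lra.
Qed.

Let S_bounds x : a < x < b -> exists2 S, 0 < S & [/\ S ^+ 2 = (x - a) * (b - x),
  r x = w x * S & S <= b - a].
Proof.
move=> axb; have /andP[ax xb] := axb; have w0 := w_gt0 axb;
  have r0 := r_gt0 axb.
have S0 : 0 < r x / w x by rewrite divr_gt0.
have S2 : (r x / w x) ^+ 2 = (x - a) * (b - x).
  by rewrite expr_div_n r2// mulrAC mulfV ?mul1r// expf_neq0// gt_eqF.
exists (r x / w x) => //; split => //.
  by rewrite mulrC mulfVK// gt_eqF.
have L0' := L0.
rewrite -(@ler_sqr _ (r x / w x)) ?nnegrE ?(ltW S0) ?(ltW L0)// S2; nra.
Qed.

Let D2_le x : a < x < b ->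
  D x ^+ 2 <= 2^-1 * (b - a) ^+ 2 * (w x * y x) ^+ 2 + 2 * (lam * P x) ^+ 2.
Proof.
move=> /andP[ax xb]; have /andP[B0 B1] := B01; have /andP[C0 C1] := C01.
rewrite /D; set k := B * (b - x) - C * (x - a).
have k2 : k ^+ 2 <= (b - a) ^+ 2.
  have : - (b - a) <= k <= b - a by rewrite /k; apply/andP; split; nra.
  move=> /andP[h1 h2]; nra.
have := sqr_ge0 (2^-1 * k * w x * y x + lam * P x).
have : k ^+ 2 * (w x * y x) ^+ 2 <= (b - a) ^+ 2 * (w x * y x) ^+ 2.
  by rewrite ler_wpM2r ?sqr_ge0.
move: (w x) (y x) (P x) => W Yv Pv; lra.
Qed.

(** In the middle of the interval ((x - a) (b - x))^(1/2) lies between (b - a) / 4 and b - a, so F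
    is comparable with the quantity that [jacobi_energy] controls by averaging. *)
Let F_mid x M : a + (b - a) / 2 <= x <= a + 3 / 4 * (b - a) ->
  w x * y x ^+ 2 + lam * P x ^+ 2 / ((x - a) * (b - x) * w x) <= M ->
  F x <= 3 * (b - a) * M.
Proof.
move=> /andP[xl xr] hM; have L0' := L0.
have axb : a < x < b by apply/andP; split; lra.
have w0 := w_gt0 axb; have r0 := r_gt0 axb.
have [S S0 [S2 rE SL]] := S_bounds axb.
have S4 : (b - a) / 4 <= S.
  rewrite -(@ler_sqr _ ((b - a) / 4)) ?nnegrE ?(ltW S0) ?divr_ge0 ?(ltW L0)//
    S2; nra.
have phi0 := lt_le_trans ltr01 (le_trans lam1 (phi_ge axb)).
have lam0 : 0 < lam by exact: lt_le_trans lam1.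
have D2 := D2_le axb.
have wy0 : 0 <= w x * y x ^+ 2 by apply: mulr_ge0; [exact: ltW|exact: sqr_ge0].
have h4 : 0 <= lam * P x ^+ 2 / (S ^+ 2 * w x).
  apply: divr_ge0; first by apply: mulr_ge0; [exact: ltW|exact: sqr_ge0].
  by apply: mulr_ge0; [exact: sqr_ge0|exact: ltW].
have h1 : r x * y x ^+ 2 <= (b - a) * (w x * y x ^+ 2).
  by rewrite rE mulrAC mulrC ler_wpM2r.
have h2 : D x ^+ 2 / (r x * phi x) <= D x ^+ 2 / (r x * lam).
  have rl : r x * lam <= r x * phi x by rewrite ler_pM2l//; exact: phi_ge.
  have rl0 : 0 < r x * lam by exact: mulr_gt0.
  rewrite ler_wpM2l ?sqr_ge0// lef_pV2// posrE//.
  exact: lt_le_trans rl.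
have h3 : D x ^+ 2 / (r x * lam) <= 2 * (b - a) * (w x * y x ^+ 2) +
    2 * (b - a) * (lam * P x ^+ 2 / ((x - a) * (b - x) * w x)).
  have : D x ^+ 2 / (r x * lam) <= (2^-1 * (b - a) ^+ 2 * (w x * y x) ^+ 2 + 2 *
    (lam * P x) ^+ 2) / (r x * lam).
    by rewrite ler_wpM2r// invr_ge0 mulr_ge0 ?ltW.
  move=> /le_trans; apply; rewrite rE -S2 mulrDl lerD//.
    have -> : 2^-1 * (b - a) ^+ 2 * (w x * y x) ^+ 2 / (w x * S * lam) =
      (w x * y x ^+ 2) * (2^-1 * (b - a) ^+ 2 / (S * lam)).
      by field; rewrite !gt_eqF.
    rewrite mulrC ler_wpM2r//.
    rewrite ler_pdivrMr ?mulr_gt0//.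
    have : (b - a) / 4 * 1 <= S * lam by rewrite ler_pM// ?divr_ge0 ?(ltW L0).
    nra.
  have -> : 2 * (lam * P x) ^+ 2 / (w x * S * lam) =
      2 * S * (lam * P x ^+ 2 / (S ^+ 2 * w x)).
    by field; rewrite !gt_eqF.
  by rewrite ler_wpM2r// ler_pM2l.
rewrite S2 in h4 h3.
rewrite /F; apply: (@le_trans _ _ (3 * (b - a) * (w x * y x ^+ 2 + lam *
  P x ^+ 2 / ((x - a) * (b - x) * w x)))).
  by have := mulr_ge0 (ltW L0) h4; lra.
by rewrite ler_wpM2l// mulr_ge0// ltW.
Qed.

Variables (x0 M : R).
Hypothesis hx0 : a + (b - a) / 2 <= x0 <= a + 3 / 4 * (b - a).
Hypothesis hM : w x0 * y x0 ^+ 2 + lam * P x0 ^+ 2 /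
  ((x0 - a) * (b - x0) * w x0) <= M.

Let F_left x : a < x <= a + (b - a) / 2 -> F x <= 3 * expR 1 * (b - a) * M.
Proof.
move=> /andP[ax xm]; have /andP[h1 h2] := hx0.
apply: (le_trans (F_growth ax (le_trans xm h1) h2)).
by have := ler_wpM2l (expR_ge0 1) (F_mid hx0 hM); lra.
Qed.

Lemma sonin_y x : a < x <= a + (b - a) / 2 ->
  (x - a) `^ (beta + 1 / 2) * (b - x) `^ (gam + 1 / 2) * y x ^+ 2
  <= 3 * expR 1 * (b - a) * M.
Proof.
move=> axm; apply: le_trans (F_left axm).
have L0' := L0; have axb : a < x < b by move/andP : axm => [h1 h2]; apply/andP;
  split; lra.
have phi0 := lt_le_trans ltr01 (le_trans lam1 (phi_ge axb)).
by rewrite /F lerDl; exact: Dq_ge0.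
Qed.

(** lam P is the first summand of D minus D, and both are bounded through F: D^2 <= K r phi. The
    last factor is the size of phi, which may grow like 1 / (x - a) at the left end. *)
Lemma sonin_P x : a < x <= a + (b - a) / 2 ->
  (lam * P x) ^+ 2 <= 6 * (3 * expR 1 * (b - a) * M) *
  ((x - a) `^ (beta + 1 / 2) * (b - x) `^ (gam + 1 / 2)) *
  (lam + (b - a) / (x - a)).
Proof.
move=> axm; have Fl := F_left axm; have yl := sonin_y axm; have L0' := L0.
have axb : a < x < b by move/andP : axm => [h1 h2]; apply/andP; split; lra.
have /andP[ax xb] := axb; have /andP[_ xm] := axm.
have w0 := w_gt0 axb; have r0 := r_gt0 axb.
have phi1 := le_trans lam1 (phi_ge axb); have phi0 := lt_le_trans ltr01 phi1.
set K := 3 * _ * _ * M in Fl yl *; rewrite -/(r x) in yl *.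
have X0 : 0 < x - a by rewrite subr_gt0.
have Y0 : 0 < b - x by rewrite subr_gt0.
have Y2 : (b - a) / 2 <= b - x by lra.
have K0 : 0 <= K by apply: le_trans yl; rewrite mulr_ge0 ?sqr_ge0 ?ltW.
have Dl : D x ^+ 2 <= K * r x * phi x.
  have : D x ^+ 2 / (r x * phi x) <= K.
    by apply: le_trans Fl; rewrite /F lerDr mulr_ge0 ?sqr_ge0 ?ltW.
  rewrite ler_pdivrMr; last exact: mulr_gt0.
  by rewrite mulrA.
have wy : (w x * y x) ^+ 2 <= K * r x * (2 / ((x - a) * (b - a))).
  have -> : (w x * y x) ^+ 2 = r x * y x ^+ 2 * r x / ((x - a) * (b - x)).
    transitivity (r x ^+ 2 * y x ^+ 2 / ((x - a) * (b - x))).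
      by rewrite r2// exprMn; field; rewrite !gt_eqF.
    by move: (r x) => Rr; ring.
  apply: ler_pM.
  - apply: mulr_ge0; last exact: ltW.
    by apply: mulr_ge0; [exact: ltW|exact: sqr_ge0].
  - by rewrite invr_ge0; apply: mulr_ge0; exact: ltW.
  - by rewrite ler_wpM2r// ltW.
  - have -> : 2 / ((x - a) * (b - a)) = ((x - a) * ((b - a) / 2))^-1.
      by field; rewrite !gt_eqF.
    by rewrite lef_pV2 ?posrE ?mulr_gt0 ?divr_gt0// ler_pM2l.
have phil : phi x <= 3 * lam + (b - a) / (x - a).
  have /andP[B0 B1] := B01; have /andP[C0 C1] := C01.
  have c4 : C * (1 - C) <= 4^-1 by have := sqr_ge0 (C - 1 / 2); lra.
  have c0 : 0 <= C * (1 - C) by rewrite mulr_ge0// subr_ge0.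
  have b4 : B * (1 - B) <= 4^-1 by have := sqr_ge0 (B - 1 / 2); lra.
  have b0 : 0 <= B * (1 - B) by rewrite mulr_ge0// subr_ge0.
  have bc : (B + C) ^+ 2 / 4 <= 1 by nra.
  have hX : B * (1 - B) / (x - a) <= 4^-1 / (x - a) by rewrite ler_wpM2r//
    invr_ge0 ltW.
  have hY : C * (1 - C) / (b - x) <= 4^-1 * (2 / (b - a)).
    apply: ler_pM => //; first by rewrite invr_ge0 ltW.
    have -> : 2 / (b - a) = ((b - a) / 2)^-1 by field; rewrite gt_eqF.
    by rewrite lef_pV2 ?posrE ?divr_gt0.
  have h : (b - a) / 4 * (B * (1 - B) / (x - a) + C * (1 - C) / (b - x)) <=
     (b - a) / 4 * (4^-1 / (x - a) + 4^-1 * (2 / (b - a))).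
    by rewrite ler_wpM2l ?divr_ge0 ?(ltW L0)// lerD.
  have e1 : (b - a) / 4 * (4^-1 / (x - a) + 4^-1 * (2 / (b - a))) = 16^-1 *
    ((b - a) / (x - a)) + 8^-1.
    by field; rewrite !gt_eqF.
  have q0 : 0 <= (b - a) / (x - a) by rewrite divr_ge0 ?ltW.
  by rewrite /phi; move: lam1 => ?; lra.
have lp : (lam * P x) ^+ 2 <= 2^-1 * (b - a) ^+ 2 * (w x * y x) ^+ 2 + 2 *
  D x ^+ 2.
  have /andP[B0 B1] := B01; have /andP[C0 C1] := C01.
  set k := B * (b - x) - C * (x - a).
  have k2 : k ^+ 2 <= (b - a) ^+ 2.
    have : - (b - a) <= k <= b - a by rewrite /k; apply/andP; split; nra.
    move=> /andP[h1 h2]; nra.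
  have -> : lam * P x = 2^-1 * k * w x * y x - D x by rewrite /D /k; ring.
  have := sqr_ge0 (2^-1 * k * w x * y x + D x).
  have : k ^+ 2 * (w x * y x) ^+ 2 <= (b - a) ^+ 2 * (w x * y x) ^+ 2.
    by rewrite ler_wpM2r ?sqr_ge0.
  move: (w x) (y x) (D x) => W Yv Dv; lra.
apply: (le_trans lp).
have Kr0 : 0 <= K * r x by rewrite mulr_ge0// ltW.
have h1 : 2^-1 * (b - a) ^+ 2 * (w x * y x) ^+ 2 <= K * r x *
  ((b - a) / (x - a)).
  have -> : K * r x * ((b - a) / (x - a)) = 2^-1 * (b - a) ^+ 2 *
    (K * r x * (2 / ((x - a) * (b - a)))).
    by field; rewrite !gt_eqF.
  by rewrite ler_wpM2l// mulr_ge0 ?sqr_ge0.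
have h2 := ler_wpM2l Kr0 phil.
have q0 : 0 <= (b - a) / (x - a) by rewrite divr_ge0 ?ltW.
have h3 := mulr_ge0 Kr0 q0.
have lam0 : 0 <= lam by exact: le_trans lam1.
have h4 := mulr_ge0 Kr0 lam0.
move: ((b - a) / (x - a)) h1 h2 h3 phil q0 => Q h1 h2 h3 _ _; lra.
Qed.

End sonin.

(** * Pointwise bounds at the left endpoint *)

Section left_bound.
Context {R : realType}.
Implicit Types (x u v : R).

Lemma derive_ge0_le (f df : R -> R) u v : u <= v ->
  (forall z, u <= z <= v -> is_derive z 1 f (df z)) ->
  (forall z, u <= z <= v -> 0 <= df z) -> f u <= f v.
Proof.
move=> uv dfz df0.
have fc : {within `[u, v], continuous f}.
  apply: continuous_in_subspaceT => z /set_mem/=; rewrite in_itv/= => zx.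
  exact: is_derive_continuous (dfz z zx).
have [|c cx E] := @MVT_segment R f df u v uv _ fc.
  by move=> z; rewrite in_itv/= => /andP[h1 h2]; apply: dfz; rewrite !ltW.
by rewrite -subr_ge0 E mulr_ge0 ?subr_ge0// df0//; move: cx; rewrite in_itv.
Qed.

Lemma derive_ge0_ge0 (f df : R -> R) (a c x : R) :
  (forall z, a < z <= c -> is_derive z 1 f (df z)) ->
  (forall z, a < z <= c -> 0 <= df z) ->
  f z @[z --> a^'+] --> 0 -> a < x <= c -> 0 <= f x.
Proof.
move=> dfz df0 f0 /andP[ax xc].
rewrite leNgt; apply/negP => fx0.
suff: \forall z \near a^'+, False by move/filter_ex => [].
near=> z.
have fz : f x < f z by near: z; exact: (cvgr_gt 0 f0).
have az : a < z by near: z; exact: nbhs_right_gt.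
have zx : z <= x by near: z; exact: nbhs_right_le.
have : f z <= f x; last by rewrite leNgt fz.
apply: (@derive_ge0_le f df) => // v /andP[zv vx].
- by apply: dfz; rewrite (lt_le_trans az)//= (le_trans vx).
- by apply: df0; rewrite (lt_le_trans az)//= (le_trans vx).
Unshelve. all: by end_near. Qed.

Lemma sqr_le_norm_le u v : 0 <= v -> u ^+ 2 <= v ^+ 2 -> `|u| <= v.
Proof. by move=> v0; rewrite -(ler_sqr (normr_ge0 u))// real_normK ?num_real.
  Qed.

Variables (a b beta gam kap : R).
Hypothesis ab : a < b.
Hypothesis hbeta : - (1 / 2) <= beta <= 1 / 2.
Hypothesis hgam : - (1 / 2) <= gam <= 1 / 2.
Hypothesis hkap : 0 < kap <= 1 / 8.
Local Notation w := (weight a b beta gam).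

(** The Jacobi differential equation as a first-order system for y and a primitive P of w y. In this
    form the estimate at the left end also applies to reflected polynomials, which gives the right
    end. *)
Definition jacobi_system (lam : R) (y P : R -> R) :=
  (forall x, a < x < b -> is_derive x 1 P (w x * y x)) /\
  (forall x, a < x < b ->
    is_derive x 1 y (- lam * P x / ((x - a) * (b - x) * w x))).

Let B := beta + 1 / 2.
Let C := gam + 1 / 2.
Let L := b - a.

(** K does not depend on lam, so the bounds are uniform in the degree. For (x - a) lam >= 1 the
    estimate [sonin_P] is sharp enough; closer to the end it degenerates, and P is estimated instead
    by integrating the bound for w y from a. The exponent kap interpolates between the two regimes:
    a small power of lam is given up for additional vanishing at a. *)
Lemma jacobi_system_left_bound : exists2 K, 0 < K &
  forall lam y P x0, 1 <= lam -> jacobi_system lam y P ->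
  P x @[x --> a^'+] --> 0 ->
  a + (b - a) / 2 <= x0 <= a + 3 / 4 * (b - a) ->
  w x0 * y x0 ^+ 2 + lam * P x0 ^+ 2 / ((x0 - a) * (b - x0) * w x0) <=
    13 / (b - a) ->
  forall x, a < x <= a + (b - a) / 2 ->
    `|y x| <= K * (x - a) `^ (- ((beta + 1 / 2) / 2)) /\
    `|P x| <= K * lam `^ (- (1 / 2) + 2 * kap) *
      (x - a) `^ ((beta + 1 / 2) / 2 + 2 * kap).
Proof.
have /andP[b1 b2] := hbeta; have /andP[g1 g2] := hgam; have /andP[k1 k2] :=
  hkap.
have L0 : 0 < L by rewrite subr_gt0.
pose h := L / 2; have h0 : 0 < h by rewrite divr_gt0.
have bnd s : exists2 c, 0 < c & forall v, h <= v <= L -> v `^ s <= c.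
  exists (h `^ s + L `^ s); first by apply: addr_gt0; rewrite powR_gt0.
  by move=> v; exact: powR_leD.
have [c1 c10 c1b] := bnd (- C).
have [c2 c20 c2b] := bnd gam.
have [c3 c30 c3b] := bnd C.
have [K0 K0E K00] : exists2 K0, K0 = 3 * expR 1 * L * (13 / L) & 0 < K0.
  by eexists; first reflexivity; rewrite !mulr_gt0 ?expR_gt0 ?invr_gt0.
have t1 : 0 < K0 * c1 by exact: mulr_gt0.
have [K1 K10 K1s] : exists2 K1, 0 < K1 & K0 * c1 <= K1 ^+ 2.
  by exists (K0 * c1 + 1); [exact: addr_gt0|nra].
have t2 : 0 < c2 * K1 by exact: mulr_gt0.
have [K2 K2E K20] : exists2 K2, K2 = 2 * (c2 * K1) & 0 < K2.
  by eexists; first reflexivity; exact: mulr_gt0.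
have q0 : 0 < 6 * K0 * c3 * (1 + L) by rewrite !mulr_gt0// addr_gt0.
have [K3 K3E K30] : exists2 K3, K3 = 6 * K0 * c3 * (1 + L) + K2 ^+ 2 & 0 < K3.
  by eexists; first reflexivity; apply: addr_gt0 => //; exact: exprn_gt0.
exists (K1 + (K3 + 1)); first by rewrite addr_gt0// addr_gt0.
move=> lam y P x0 lam1 [dP dy] P0 hx0 hM.
have lam0 : 0 < lam by exact: lt_le_trans lam1.
have yb x : a < x <= a + (b - a) / 2 -> `|y x| <= K1 * (x - a) `^ (- (B / 2)).
  move=> axm; have /andP[ax xm] := axm.
  have X0 : 0 < x - a by rewrite subr_gt0.
  have Y2 : h <= b - x <= L by rewrite /h /L; apply/andP; split; lra.
  have Y0 : 0 < b - x by case/andP : Y2 => [hY _]; exact: lt_le_trans hY.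
  have := sonin_y ab hbeta hgam lam1 dP dy hx0 hM axm.
  rewrite -/B -/C -/L -K0E => H.
  apply: sqr_le_norm_le; first by rewrite mulr_ge0 ?powR_ge0 ?ltW.
  rewrite exprMn [(_ `^ (- _)) ^+ 2]expr2 -powR_addl//.
  rewrite (_ : - (B / 2) + - (B / 2) = - B); last by field.
  apply: (@le_trans _ _ (K0 * c1 * (x - a) `^ (- B))); last first.
    by rewrite ler_wpM2r// powR_ge0.
  have Yc := c1b _ Y2.
  have -> : y x ^+ 2 = (x - a) `^ B * (b - x) `^ C * y x ^+ 2 *
    (b - x) `^ (- C) * (x - a) `^ (- B).
    have e1 : (x - a) `^ B * (x - a) `^ (- B) = 1 by rewrite -powR_addl// subrr
      powRr0.
    have e2 : (b - x) `^ C * (b - x) `^ (- C) = 1 by rewrite -powR_addl// subrr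
      powRr0.
    by rewrite -[LHS]mulr1 -[X in _ * X]mulr1 -{1}e1 -e2; ring.
  rewrite ler_wpM2r ?powR_ge0//; apply: ler_pM => //; last exact: powR_ge0.
  by rewrite mulr_ge0 ?sqr_ge0 ?mulr_ge0 ?powR_ge0.
have Pb1 x : a < x <= a + (b - a) / 2 -> `|P x| <=
  K2 * (x - a) `^ ((B + 1) / 2).
  have s2 : 1 / 2 <= (B + 1) / 2 by rewrite /B; lra.
  have s0 : 0 < (B + 1) / 2 by lra.
  (* For e = 1 and e = -1 this function tends to 0 at a and is nondecreasing by the bound on y,
     hence nonnegative. The factor 2 in [K2] compensates (B + 1) / 2 >= 1/2 in the derivative. *)
  pose f (e : R) z := K2 * (z - a) `^ ((B + 1) / 2) - e * P z.
  pose df (e : R) z := K2 * ((B + 1) / 2 * (z - a) `^ ((B + 1) / 2 - 1)) - e *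
    (w z * y z).
  have dfz e z : a < z <= a + (b - a) / 2 -> is_derive z 1 (f e) (df e z).
    move=> /andP[az zm]; have zab : a < z < b by rewrite az/=; rewrite /L in L0;
      lra.
    have D1 := is_derive_powR_subl ((B + 1) / 2) az.
    exact: (is_derive_eq (is_deriveB (is_deriveZ K2 D1)
      (is_deriveZ e (dP z zab)))).
  have df0 e z : `|e| = 1 -> a < z <= a + (b - a) / 2 -> 0 <= df e z.
    move=> e1 azm; have /andP[az zm] := azm; have yz := yb z azm.
    have X0 : 0 < z - a by rewrite subr_gt0.
    have Y2 : h <= b - z <= L by rewrite /h /L; apply/andP; split; lra.
    rewrite subr_ge0 (le_trans (ler_norm _))// normrM e1 mul1r normrM.
    rewrite [`|w z|]ger0_norm ?weight_ge0//.
    apply: (@le_trans _ _ ((z - a) `^ beta * c2 *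
      (K1 * (z - a) `^ (- (B / 2))))).
      apply: ler_pM => //; first exact: weight_ge0.
      by rewrite /weight ler_wpM2l ?powR_ge0// c2b.
    have -> : (z - a) `^ beta * c2 * (K1 * (z - a) `^ (- (B / 2))) =
       c2 * K1 * (z - a) `^ ((B + 1) / 2 - 1).
      rewrite (_ : (B + 1) / 2 - 1 = beta + - (B / 2)) ?(powR_addl _ _ X0);
        last by rewrite /B; field.
      ring.
    rewrite mulrA ler_wpM2r ?powR_ge0// K2E; nra.
  have f0 e : f e z @[z --> a^'+] --> 0.
    rewrite -[X in _ --> X](subrr 0) -{1}(mulr0 K2) -[X in _ - X](mulr0 e).
    apply: cvgB; first by apply: cvgM; [exact: cvg_cst|exact: cvg_powR_subl0].
    by apply: cvgM; [exact: cvg_cst|exact: P0].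
  move=> axm.
  have A := derive_ge0_ge0 (dfz 1) (fun z => @df0 1 z (normr1 _)) (f0 1) axm.
  have N1 : `|-1 : R| = 1 by rewrite normrN normr1.
  have A' := derive_ge0_ge0 (dfz (-1)) (fun z => @df0 (-1) z N1) (f0 (-1)) axm.
  by rewrite ler_norml; move: A A'; rewrite /f => A A'; apply/andP; split; lra.
move=> x axm; split.
  apply: (le_trans (yb x axm)); rewrite ler_wpM2r ?powR_ge0//.
  by rewrite lerDl addr_ge0// ltW.
have /andP[ax xm] := axm.
have X0 : 0 < x - a by rewrite subr_gt0.
have lX0 : 0 < lam * (x - a) by rewrite mulr_gt0.
have Y2 : h <= b - x <= L by rewrite /h /L; apply/andP; split; lra.
(* Where lam (x - a) >= 1 the last factor is at least 1; where lam (x - a) < 1 it dominates lam (x -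
   a) itself, since 4 kap < 1. *)
have key : P x ^+ 2 <= K3 * ((x - a) `^ B * lam^-1 * (lam * (x - a)) `^ (4 *
  kap)).
  have XB0 : 0 <= (x - a) `^ B * lam^-1 by rewrite mulr_ge0 ?powR_ge0 ?invr_ge0
    ?ltW.
  have [l1|l1] := leP 1 (lam * (x - a)).
    have l4 : 1 <= (lam * (x - a)) `^ (4 * kap).
      by have := @ler_powR R _ l1 0 (4 * kap); rewrite powRr0; apply; lra.
    have := sonin_P ab hbeta hgam lam1 dP dy hx0 hM axm.
    rewrite -/B -/C -/L -K0E => H.
    have Yc := c3b _ Y2.
    have LX : L / (x - a) <= lam * L.
      by rewrite ler_pdivrMr// mulrAC ler_peMl// ltW.
    have H2 : (lam * P x) ^+ 2 <= 6 * K0 * ((x - a) `^ B * c3) *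
      (lam * (1 + L)).
      apply: (le_trans H); apply: ler_pM.
      - by rewrite mulr_ge0 ?mulr_ge0 ?powR_ge0 ?ltW.
      - by rewrite addr_ge0 ?divr_ge0 ?ltW.
      - by rewrite ler_wpM2l ?ler_wpM2l ?powR_ge0// mulr_ge0 ?ltW.
      - by rewrite mulrDr mulr1 lerD2l.
    have E : P x ^+ 2 = (lam * P x) ^+ 2 / lam ^+ 2.
      by rewrite exprMn mulrAC mulfV ?mul1r// expf_neq0// gt_eqF.
    rewrite E; apply: (@le_trans _ _ (6 * K0 * ((x - a) `^ B * c3) *
      (lam * (1 + L)) / lam ^+ 2)).
      by rewrite ler_wpM2r// invr_ge0 sqr_ge0.
    have -> : 6 * K0 * ((x - a) `^ B * c3) * (lam * (1 + L)) / lam ^+ 2 =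
       6 * K0 * c3 * (1 + L) * ((x - a) `^ B * lam^-1 * 1).
      by field; rewrite gt_eqF.
    apply: ler_pM; [exact: ltW|by rewrite mulr1| |by rewrite ler_wpM2l].
    by rewrite K3E lerDl sqr_ge0.
  have l4 : lam * (x - a) <= (lam * (x - a)) `^ (4 * kap).
    rewrite -{1}(powRr1 (ltW lX0)); apply: ger_powR; last by lra.
    by rewrite lX0 ltW.
  apply: (@le_trans _ _ (K2 ^+ 2 * ((x - a) `^ B * lam^-1 * (lam * (x - a)))));
    last first.
    apply: ler_pM; [exact: sqr_ge0|by rewrite mulr_ge0// ltW| |by
      rewrite ler_wpM2l].
    by rewrite K3E lerDr ltW.
  have -> : K2 ^+ 2 * ((x - a) `^ B * lam^-1 * (lam * (x - a))) =
    (K2 * (x - a) `^ ((B + 1) / 2)) ^+ 2.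
    rewrite exprMn [(_ `^ ((B + 1) / 2)) ^+ 2]expr2 -powR_addl//.
    rewrite (_ : (B + 1) / 2 + (B + 1) / 2 = B + 1); last by field.
    by rewrite (powR_addl _ _ X0) powRr1 ?(ltW X0)//; field; rewrite gt_eqF.
  rewrite -[leLHS](real_normK (num_real _)) lerXn2r ?nnegrE ?normr_ge0//.
    by rewrite mulr_ge0 ?powR_ge0 ?ltW.
  exact: Pb1.
apply: sqr_le_norm_le.
  by rewrite !mulr_ge0 ?powR_ge0// addr_ge0 ?(ltW K10)// addr_ge0 ?(ltW K30).
apply: (le_trans key).
rewrite !exprMn [(lam `^ _) ^+ 2]expr2 [(_ `^ (_ + 2 * kap)) ^+ 2]expr2
  -!powR_addl//.
rewrite powRM ?(ltW lam0) ?(ltW X0)//.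
rewrite -(powR_inv1 (ltW lam0)) -!/B.
have -> : (x - a) `^ B * lam `^ (-1) * (lam `^ (4 * kap) * (x - a) `^ (4 * kap))
  =
   lam `^ (- (1 / 2) + 2 * kap + (- (1 / 2) + 2 * kap)) *
   (x - a) `^ (B / 2 + 2 * kap + (B / 2 + 2 * kap)).
  rewrite (_ : - (1 / 2) + 2 * kap + (- (1 / 2) + 2 * kap) = -1 + 4 * kap);
    last by field.
  rewrite (_ : B / 2 + 2 * kap + (B / 2 + 2 * kap) = B + 4 * kap);
    last by field.
  by rewrite !powR_addl//; ring.
rewrite -mulrA ler_wpM2r ?mulr_ge0 ?powR_ge0//; nra.
Qed.

End left_bound.

(** * Primitives of p_n w and an interior point of small energy *)

Section jacobi_bounds.
Context {R : realType}.
Local Notation mu := (@lebesgue_measure R).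
Local Notation RT := (measurableTypeR R).
Variables (a b beta gam : R).
Hypothesis ab : a < b.
Hypothesis hbeta : - (1 / 2) <= beta <= 1 / 2.
Hypothesis hgam : - (1 / 2) <= gam <= 1 / 2.
Implicit Types (x u v : R).

Local Notation w := (weight a b beta gam).
Local Notation Jp := (jacobi_poly a b beta gam).
Local Notation delta := (jacobi_delta a b beta gam).

Let hb : - (1 / 2) <= beta. Proof. by case/andP : hbeta. Qed.
Let hg : - (1 / 2) <= gam. Proof. by case/andP : hgam. Qed.
Let L0 : 0 < b - a. Proof. by rewrite subr_gt0. Qed.

Definition jacobi_lam n : R := n%:R * (n%:R + beta + gam + 1).

(* The primitive of [Jp n * w] vanishing at both endpoints, for n > 0. *)
Definition jacobi_prim n x : R :=
  - ((x - a) `^ (beta + 1) * (b - x) `^ (gam + 1) * ((Jp n)^`()).[x]) /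
  jacobi_lam n.

Lemma jacobi_lam_ge n : n%:R ^+ 2 <= jacobi_lam n.
Proof.
have := hbg1 hb hg => h; have n0 : 0 <= n%:R :> R by [].
by rewrite expr2 ler_wpM2l//; lra.
Qed.

Lemma jacobi_lam_gt0 n : (0 < n)%N -> 0 < jacobi_lam n.
Proof.
by move=> n0; apply: lt_le_trans (jacobi_lam_ge n); rewrite exprn_gt0// ltr0n.
Qed.

Lemma jacobi_primE n x : jacobi_prim n.+1 x = delta n.+1 *
  ((x - a) `^ (beta + 1) * (b - x) `^ (gam + 1) *
   (jq a b (beta + n.+1%:R) (gam + n.+1%:R) n).[x]).
Proof.
rewrite /jacobi_prim jacobi_polyE// derivZ jq_derivE hornerZ hornerM hornerC.
have l0 := jacobi_lam_gt0 (ltn0Sn n).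
rewrite (_ : n.+1%:R * _ = jacobi_lam n.+1); last by rewrite /jacobi_lam -natr1;
  ring.
by field; rewrite gt_eqF.
Qed.

Lemma jacobi_prim_system n : (0 < n)%N ->
  jacobi_system a b beta gam (jacobi_lam n) (fun x => (Jp n).[x])
    (jacobi_prim n).
Proof.
case: n => // n _; split => x axb.
- have := is_deriveZ (delta n.+1) (jq_is_derive (beta + n.+1%:R) (gam + n.+1%:R)
    n axb).
  rewrite (_ : beta + n.+1%:R - n%:R = beta + 1); last by rewrite -natr1; ring.
  rewrite (_ : gam + n.+1%:R - n%:R = gam + 1); last by rewrite -natr1; ring.
  rewrite !addrK => D.
  rewrite (_ : jacobi_prim n.+1 = fun x => delta n.+1 * ((x - a) `^ (beta + 1) *
    (b - x) `^ (gam + 1) * (jq a b (beta + n.+1%:R) (gam + n.+1%:R) n).[x]));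
      last first.
    by apply/funext => z; exact: jacobi_primE.
  apply: (is_derive_eq D); rewrite jacobi_polyE// hornerZ /weight
    /GRing.scale/=.
  ring.
- have /andP[ax xb] := axb.
  have X0 : 0 < x - a by rewrite subr_gt0.
  have Y0 : 0 < b - x by rewrite subr_gt0.
  have l0 := jacobi_lam_gt0 (ltn0Sn n).
  apply: (is_derive_eq (is_derive_poly (Jp n.+1) x)).
  rewrite /jacobi_prim /weight !powR_addl// !powRr1 ?(ltW X0) ?(ltW Y0)//.
  by field; rewrite !gt_eqF ?powR_gt0.
Qed.

Lemma jacobi_prim_left n : jacobi_prim n x @[x --> a^'+] --> 0.
Proof.
have hb1' := hb1 hb.
rewrite -[X in _ --> X](mul0r (jacobi_lam n)^-1) -oppr0.
apply: cvgM; last exact: cvg_cst.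
by apply: cvgN; exact: cvg_powR_poly_at_left_end.
Qed.

Lemma jacobi_prim_right n : jacobi_prim n x @[x --> b^'-] --> 0.
Proof.
have hg1' := hg1 hg.
rewrite -[X in _ --> X](mul0r (jacobi_lam n)^-1) -oppr0.
apply: cvgM; last exact: cvg_cst.
by apply: cvgN; exact: cvg_powR_poly_at_right_end.
Qed.

Lemma int_cst_cc u v K : u <= v ->
  intg `[u, v] (cst K) /\ \int[mu]_(x in `[u, v]) K = K * (v - u).
Proof.
move=> uv; have [i E] := @FTC_cc R (fun x => K * x) (cst K) u v uv
  (fun x _ => is_derive_eq (is_deriveZ K (is_derive_id x (1 : R))) (mulr1 K))
  (fun x _ => cvg_cst _).
by split => //; rewrite E mulrBr.
Qed.

(* Averages (y P)' = w y^2 - lam P^2 / ((x - a) (b - x) w). *)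
Lemma jacobi_energy n u v : (0 < n)%N -> a < u -> v < b -> v = u + (b - a) /
  4 ->
  exists2 x0, u <= x0 <= v &
  w x0 * (Jp n).[x0] ^+ 2 +
  jacobi_lam n * jacobi_prim n x0 ^+ 2 / ((x0 - a) * (b - x0) * w x0)
  <= 13 / (b - a).
Proof.
move=> n0 au vb vE; have [dP dy] := jacobi_prim_system n0.
set y := fun x => (Jp n).[x] in dP dy *; set P := jacobi_prim n in dP dy *.
set lam := jacobi_lam n in dy *.
pose H x := w x * y x ^+ 2 +
  lam * P x ^+ 2 * ((x - a) `^ (- (beta + 1)) * (b - x) `^ (- (gam + 1))).
have HE x : a < x < b -> w x * y x ^+ 2 + lam * P x ^+ 2 /
  ((x - a) * (b - x) * w x) = H x.
  move=> /andP[ax xb]; congr (_ + _).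
  have X0 : 0 < x - a by rewrite subr_gt0.
  have Y0 : 0 < b - x by rewrite subr_gt0.
  rewrite !powRN /weight !powR_addl// !powRr1 ?(ltW X0) ?(ltW Y0)//.
  by field; rewrite !gt_eqF ?powR_gt0.
have cw x : a < x < b -> {for x, continuous w}.
  by move=> /andP[ax xb]; apply: continuousM;
    [exact: continuous_powR_subl|exact: continuous_powR_subr].
have cy x : {for x, continuous y} by exact: continuous_horner.
have cP x : a < x < b -> {for x, continuous P} by move=>
  /dP/is_derive_continuous.
have cy2 x : a < x < b -> {for x, continuous (fun x => w x * y x ^+ 2)}.
  by move=> axb; apply: continuousM; [exact: cw|apply: continuousM; exact: cy].
have cH x : a < x < b -> {for x, continuous H}.
  move=> axb; have /andP[ax xb] := axb; apply: continuousD; first exact: cy2.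
  apply: continuousM; last first.
    by apply: continuousM; [exact: continuous_powR_subl|exact:
      continuous_powR_subr].
  apply: continuousM; first exact: cvg_cst.
  by apply: continuousM; exact: cP.
have uv : u <= v by rewrite vE lerDl divr_ge0 ?(ltW L0).
have uvab x : u <= x <= v -> a < x < b.
  by move=> /andP[ux xv]; rewrite (lt_le_trans au)//= (le_lt_trans xv).
have H0 x : a < x < b -> 0 <= H x.
  move=> axb; rewrite /H; apply: addr_ge0.
    by apply: mulr_ge0; [exact: weight_ge0|exact: sqr_ge0].
  apply: mulr_ge0; last by apply: mulr_ge0; exact: powR_ge0.
  by apply: mulr_ge0; [exact/ltW/jacobi_lam_gt0|exact: sqr_ge0].
have yP0a : y x * P x @[x --> a^'+] --> 0.
  rewrite -[X in _ --> X](mulr0 (y a)); apply: cvgM;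
    last exact: jacobi_prim_left.
  by apply: cvg_at_right_filter; exact: cy.
have yP0b : y x * P x @[x --> b^'-] --> 0.
  rewrite -[X in _ --> X](mulr0 (y b)); apply: cvgM;
    last exact: jacobi_prim_right.
  by apply: cvg_at_left_filter; exact: cy.
(* The points c and d are so close to the ends that the boundary values of y P contribute at most
   1/2 each. The integral of H over [c, d] is then below 2 + 1 = 3, whereas H > 13 / (b - a)
   throughout [u, v], of length (b - a) / 4, would make it at least 13/4. *)
have [c /andP[ac cu] hc] : exists2 c, a < c < u & y c * P c < 1 / 2.
  suff : \forall c \near a^'+, a < c < u /\ y c * P c < 1 / 2.
    by move/filter_ex => [c [h1 h2]]; exists c.
  near=> c; split.
    by apply/andP; split; near: c; [exact: nbhs_right_gt|exact: nbhs_right_lt].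
  by near: c; apply: (cvgr_lt 0 yP0a); lra.
have [d /andP[vd db] hd] : exists2 d, v < d < b & - (1 / 2) < y d * P d.
  suff : \forall d \near b^'-, v < d < b /\ - (1 / 2) < y d * P d.
    by move/filter_ex => [d [h1 h2]]; exists d.
  near=> d; split.
    by apply/andP; split; near: d; [exact: nbhs_left_gt|exact: nbhs_left_lt].
  by near: d; apply: (cvgr_gt 0 yP0b); lra.
have cd : c <= d by lra.
have cdab x : c <= x <= d -> a < x < b.
  by move=> /andP[cx xd]; rewrite (lt_le_trans ac)//= (le_lt_trans xd).
pose f x := 2 * (w x * y x ^+ 2) - H x.
have df x : c <= x <= d -> is_derive x 1 (fun x => y x * P x) (f x).
  move=> /cdab axb; apply: (is_derive_eq (is_deriveM (dy x axb) (dP x axb))).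
  have -> : f x = w x * y x ^+ 2 - lam * P x ^+ 2 / ((x - a) * (b - x) * w x).
    by rewrite /f -HE//; ring.
  transitivity (y x * (w x * y x) + P x *
    (- lam * P x / ((x - a) * (b - x) * w x))).
    by [].
  by ring.
have cf x : c <= x <= d -> {for x, continuous f}.
  move=> /cdab axb; apply: continuousB; last exact: cH.
  by apply: continuousM; [exact: cvg_cst|exact: cy2].
have [fi fE] := FTC_cc cd df cf.
have mcd := @mitv R `[c, d].
have mD := @mitv R `]a, b[.
have cdD : (`[c, d]%classic : set RT) `<=` `]a, b[%classic.
  by move=> x /=; rewrite !in_itv/=; exact: cdab.
have iw : intg `]a, b[ (fun x => w x * y x ^+ 2).
  apply: (@eq_intg _ _ (fun x => w x * (Jp n ^+ 2).[x])) => //.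
    by move=> x _; rewrite horner_exp.
  exact: intg_weight_poly.
have iwcd : intg `[c, d] (fun x => w x * y x ^+ 2) by exact: intgS iw.
have iHcd : intg `[c, d] H.
  apply: (@eq_intg _ _ (fun x => 2 * (w x * y x ^+ 2) - f x)) => //.
    by move=> x _; rewrite /f; ring.
  by apply: intgB => //; exact: intgZl.
have I1 : \int[mu]_(x in `[c, d]) (w x * y x ^+ 2) <= 1.
  have := jacobi_orthonormal ab hb hg n n; rewrite eqxx mulr1n => <-.
  rewrite (@eq_int _ `]a, b[ _ (fun x => w x * y x ^+ 2)); last first.
    by move=> x _; rewrite /y expr2 mulrA.
  apply: int_subset_le => // x _.
  by apply: mulr_ge0; [exact: weight_ge0|exact: sqr_ge0].
have I2 : \int[mu]_(x in `[c, d]) H x <= 2 * 1 - (y d * P d - y c * P c).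
  rewrite -fE (@eq_int _ `[c, d] H (fun x => 2 * (w x * y x ^+ 2) - f x));
    last first.
    by move=> x _; rewrite /f; ring.
  rewrite intB//; last exact: intgZl.
  by rewrite intZl// lerD2r ler_pM2l.
have uvcd : (`[u, v]%classic : set RT) `<=` `[c, d]%classic.
  move=> x /=; rewrite !in_itv/= => /andP[ux xv].
  by rewrite (le_trans (ltW cu) ux) (le_trans xv (ltW vd)).
have I3 : \int[mu]_(x in `[u, v]) H x <= \int[mu]_(x in `[c, d]) H x.
  apply: int_subset_le => //.
  by move=> x; rewrite /= in_itv/= => /cdab; exact: H0.
have [/asboolP//|no] := boolP (`[< exists2 x0, u <= x0 <= v & H x0 <=
  13 / (b - a) >]).
  move=> [x0 h1 h2]; exists x0 => //.
  by have := HE x0 (uvab x0 h1); rewrite /y /P /lam => ->.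
have big x : u <= x <= v -> 13 / (b - a) <= H x.
  move=> uxv; have [//|Hx] := leP (13 / (b - a)) (H x).
  by case/asboolP : no; exists x => //; exact: ltW.
have [ic Ec] := int_cst_cc (13 / (b - a)) uv.
have : 13 / (b - a) * (v - u) <= \int[mu]_(x in `[u, v]) H x.
  have muv := @mitv R `[u, v]; have iHuv : intg `[u, v] H by exact: intgS iHcd.
  rewrite -Ec; apply: int_le => //.
have -> : 13 / (b - a) * (v - u) = 13 / 4.
  by rewrite vE; field; rewrite gt_eqF.
by move=> I4; have := le_trans I4 (le_trans I3 I2); lra.
Unshelve. all: by end_near.
Qed.

End jacobi_bounds.

Lemma powR_homo_le {R : realType} (s x y : R) :
  0 <= s -> 0 <= x -> x <= y -> x `^ s <= y `^ s.
Proof.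
move=> s0 x0 xy; apply: ge0_ler_powR; rewrite ?nnegrE//.
exact: le_trans xy.
Qed.

(** * Pointwise bounds at both endpoints *)

Section jacobi_bounds_full.
Context {R : realType}.
Local Notation mu := (@lebesgue_measure R).
Variables (a b beta gam kap : R).
Hypothesis ab : a < b.
Hypothesis hbeta : - (1 / 2) <= beta <= 1 / 2.
Hypothesis hgam : - (1 / 2) <= gam <= 1 / 2.
Hypothesis hkap : 0 < kap <= 1 / 8.
Local Notation w := (weight a b beta gam).
Local Notation Jp := (jacobi_poly a b beta gam).
Local Notation prim := (jacobi_prim a b beta gam).
Local Notation lam := (jacobi_lam beta gam).
Implicit Types x : R.

Let hb : - (1 / 2) <= beta. Proof. by case/andP : hbeta. Qed.
Let hg : - (1 / 2) <= gam. Proof. by case/andP : hgam. Qed.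
Let L0 : 0 < b - a. Proof. by rewrite subr_gt0. Qed.

Lemma jacobi_lam_pow n : (0 < n)%N ->
  lam n `^ (- (1 / 2) + 2 * kap) <= n%:R `^ (-1 + 4 * kap).
Proof.
move=> n0; have n0R : 0 < n%:R :> R by rewrite ltr0n.
have -> : -1 + 4 * kap = 2%:R * (- (1 / 2) + 2 * kap) by field.
rewrite powRrM powR_mulrn ?(ltW n0R)//.
have s0 : - (1 / 2) + 2 * kap <= 0 by move: hkap => /andP[h1 h2]; lra.
have -> : - (1 / 2) + 2 * kap = - - (- (1 / 2) + 2 * kap) by rewrite opprK.
rewrite 2!(powRN _ (- (- (1 / 2) + 2 * kap))) lef_pV2 ?posrE ?powR_gt0
  ?exprn_gt0//; last first.
  exact: jacobi_lam_gt0.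
apply: powR_homo_le; [by rewrite oppr_ge0|exact: sqr_ge0|].
exact: jacobi_lam_ge.
Qed.

Lemma jacobi_lam_ge1 n : (0 < n)%N -> 1 <= lam n.
Proof.
move=> n0; apply: le_trans (jacobi_lam_ge hbeta hgam n).
by rewrite exprn_ege1// ler1n.
Qed.

Lemma jacobi_left_bounds : exists2 K, 0 < K & forall n x, (0 < n)%N ->
  a < x <= a + (b - a) / 2 ->
  `|(Jp n).[x]| <= K * (x - a) `^ (- ((beta + 1 / 2) / 2)) /\
  `|prim n x| <= K * n%:R `^ (-1 + 4 * kap) *
     (x - a) `^ ((beta + 1 / 2) / 2 + 2 * kap).
Proof.
have [K K0 HK] := jacobi_system_left_bound ab hbeta hgam hkap.
exists K => // n x n0 hx.
have [x0 hx0 E] := @jacobi_energy R a b beta gam ab hbeta hgam n (a + (b - a) /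
  2)
  (a + 3 / 4 * (b - a)) n0 ltac:(lra) ltac:(lra) ltac:(lra).
have [h1 h2] := HK _ _ _ x0 (jacobi_lam_ge1 n0) (jacobi_prim_system ab hbeta
  hgam n0)
  (jacobi_prim_left gam ab hbeta n) hx0 E x hx.
split => //; apply: le_trans h2 _.
apply: ler_wpM2r; first exact: powR_ge0.
apply: ler_wpM2l; first exact: ltW.
exact: jacobi_lam_pow.
Qed.

(** The reflection x -> a + b - x exchanges beta and gam, preserves the eigenvalue and changes the
    sign of the primitive. *)
Lemma jacobi_reflected_system n : (0 < n)%N ->
  jacobi_system a b gam beta (lam n) (fun z => (Jp n).[a + b - z])
    (fun z => - prim n (a + b - z)).
Proof.
move=> n0; have [dP dy] := jacobi_prim_system ab hbeta hgam n0.
have dr (z : R) : is_derive z 1 (fun z => a + b - z) (-1).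
  by apply: (is_derive_eq (is_deriveB (is_derive_cst (a + b) z 1)
    (is_derive_id z (1 : R)))); rewrite sub0r.
have wE z : weight a b gam beta z = w (a + b - z).
  rewrite /weight mulrC; congr (_ `^ _ * _ `^ _); ring.
split => z azb; have azb' : a < a + b - z < b by move: azb => /andP[az zb];
  apply/andP; split; lra.
- apply: (is_derive_eq (is_deriveN (@is_derive1_comp R (prim n) (fun z =>
    a + b - z) z _ _ (dP _ azb') (dr z)))).
  by rewrite wE mulrN1 opprK.
- apply: (is_derive_eq (@is_derive1_comp R (horner (Jp n)) (fun z => a + b - z)
    z _ _ (dy _ azb') (dr z))).
  rewrite wE (_ : a + b - z - a = b - z); last by ring.
  rewrite (_ : b - (a + b - z) = z - a); last by ring.
  by rewrite (mulrC (b - z)) mulrN1 mulrN 2!mulNr.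
Qed.

Lemma jacobi_right_bounds : exists2 K, 0 < K & forall n x, (0 < n)%N ->
  a + (b - a) / 2 <= x < b ->
  `|(Jp n).[x]| <= K * (b - x) `^ (- ((gam + 1 / 2) / 2)) /\
  `|prim n x| <= K * n%:R `^ (-1 + 4 * kap) *
     (b - x) `^ ((gam + 1 / 2) / 2 + 2 * kap).
Proof.
have [K K0 HK] := jacobi_system_left_bound ab hgam hbeta hkap.
exists K => // n x n0 /andP[hx1 hx2].
have [x0 /andP[hx01 hx02] E] := @jacobi_energy R a b beta gam ab hbeta hgam n
  (a + (b - a) / 4)
  (a + 1 / 2 * (b - a)) n0 ltac:(lra) ltac:(lra) ltac:(lra).
have hl : - prim n (a + b - z) @[z --> a^'+] --> 0.
  rewrite -[X in _ --> X](mulr0 (- jacobi_delta a b beta gam n)).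
  case: n n0 {E} => // n _.
  under eq_fun do rewrite jacobi_primE//.
  rewrite (_ : (fun z => _) = (fun z => - jacobi_delta a b beta gam n.+1 *
    ((z - a) `^ (gam + 1) *
    (b - z) `^ (beta + 1) *
    (jq a b (beta + n.+1%:R) (gam + n.+1%:R) n \Po ((a + b)%:P - 'X)).[z])));
      last first.
    apply/funext => z; rewrite horner_comp hornerD hornerN hornerX hornerC.
    rewrite (_ : a + b - z - a = b - z); last by ring.
    rewrite (_ : b - (a + b - z) = z - a); last by ring.
    by rewrite mulNr (mulrC (_ `^ (beta + 1))).
  apply: cvgM; first exact: cvg_cst.
  by apply: cvg_powR_poly_at_left_end => //; exact: hg1 hg.
have E' : weight a b gam beta (a + b - x0) * (Jp n).[a + b - (a + b - x0)] ^+ 2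
  +
  lam n * (- prim n (a + b - (a + b - x0))) ^+ 2 /
  ((a + b - x0 - a) * (b - (a + b - x0)) * weight a b gam beta (a + b - x0)) <=
  13 / (b - a).
  rewrite sqrrN (_ : a + b - (a + b - x0) = x0); last by ring.
  rewrite (_ : weight a b gam beta (a + b - x0) = w x0); last first.
    by rewrite /weight mulrC; congr (_ `^ _ * _ `^ _); ring.
  rewrite (_ : a + b - x0 - a = b - x0); last by ring.
  by rewrite (_ : b - (a + b - x0) = x0 - a) 1?(mulrC (b - x0))//; ring.
have [] := HK _ _ _ (a + b - x0) (jacobi_lam_ge1 n0) (jacobi_reflected_system
  n0)
  hl ltac:(lra) E' (a + b - x) ltac:(lra).
rewrite (_ : a + b - (a + b - x) = x); last by ring.
rewrite (_ : a + b - x - a = b - x); last by ring.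
rewrite normrN => h1 h2.
split => //; apply: le_trans h2 _.
apply: ler_wpM2r; first exact: powR_ge0.
apply: ler_wpM2l; first exact: ltW.
exact: jacobi_lam_pow.
Qed.

(** On either half the distance to the far end is bounded below, so a bound in terms of the near end
    implies one in terms of the far end. *)
Let opposite s t : 0 <= s -> 0 <= t -> exists2 M, 1 <= M & forall x,
  (a < x <= a + (b - a) / 2 -> (x - a) `^ s <= M * (b - x) `^ t) /\
  (a + (b - a) / 2 <= x < b -> (b - x) `^ t <= M * (x - a) `^ s).
Proof.
move=> s0 t0; have h0 : 0 < (b - a) / 2 by rewrite divr_gt0.
have hs : 0 < ((b - a) / 2) `^ s by exact: powR_gt0.
have ht : 0 < ((b - a) / 2) `^ t by exact: powR_gt0.
set u := _ `^ s in hs *; set v := _ `^ t in ht *.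
have m1 : 0 < u / v by exact: divr_gt0.
have m2 : 0 < v / u by exact: divr_gt0.
exists (1 + u / v + v / u) => [|x]; first lra.
split=> /andP[h1 h2].
- have : (x - a) `^ s <= u by apply: powR_homo_le; lra.
  have : v <= (b - x) `^ t by apply: powR_homo_le; lra.
  move=> hv hu; apply: le_trans hu _.
  rewrite -[leLHS](divfK (lt0r_neq0 ht)); apply: ler_pM;
    [exact: ltW|exact: ltW| |exact: hv].
  lra.
- have : (b - x) `^ t <= v by apply: powR_homo_le; lra.
  have : u <= (x - a) `^ s by apply: powR_homo_le; lra.
  move=> hv hu; apply: le_trans hu _.
  rewrite -[leLHS](divfK (lt0r_neq0 hs)); apply: ler_pM;
    [exact: ltW|exact: ltW| |exact: hv].
  lra.
Qed.

(** The primitive is bounded by a power of the distance to each end separately: in the final pairing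
    each summand of the endpoint weight is multiplied by the bound that vanishes at its own
    singularity. For n = 0 the polynomial is constant, and only its own bound is asserted. *)
Lemma jacobi_bounds : exists2 K, 0 < K & forall n x, a < x < b ->
  `|(Jp n).[x]| <= K * ((x - a) `^ (- ((beta + 1 / 2) / 2)) +
                        (b - x) `^ (- ((gam + 1 / 2) / 2))) /\
  ((0 < n)%N ->
    `|prim n x| <= K * n%:R `^ (-1 + 4 * kap) *
       (x - a) `^ ((beta + 1 / 2) / 2 + 2 * kap) /\
    `|prim n x| <= K * n%:R `^ (-1 + 4 * kap) *
       (b - x) `^ ((gam + 1 / 2) / 2 + 2 * kap)).
Proof.
have [K1 K10 H1] := jacobi_left_bounds; have [K2 K20 H2] := jacobi_right_bounds.
have /andP[k1 k2] := hkap.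
have b0 : 0 <= (beta + 1 / 2) / 2 by move: (hb); lra.
have g0 : 0 <= (gam + 1 / 2) / 2 by move: (hg); lra.
have [M M1 HM] := @opposite ((beta + 1 / 2) / 2 + 2 * kap) ((gam + 1 / 2) / 2 +
  2 * kap)
  ltac:(lra) ltac:(lra).
have [c cE] : exists c, Jp 0 = c%:P.
  by exists ((Jp 0)`_0); apply: size1_polyC; rewrite size_jacobi_poly.
have [l lE l0] : exists2 l, l = (b - a) `^ ((beta + 1 / 2) / 2) & 0 < l.
  by eexists; [reflexivity|exact: powR_gt0].
have cl : 0 <= `|c| * l by apply: mulr_ge0; [exact: normr_ge0|exact: ltW].
have KM1 : K1 <= K1 * M by rewrite ler_peMr// ltW.
have KM2 : K2 <= K2 * M by rewrite ler_peMr// ltW.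
exists (K1 * M + K2 * M + `|c| * l) => [|n x /andP[ax xb]]; first lra.
have pX s : 0 <= (x - a) `^ s by exact: powR_ge0.
have pY s : 0 <= (b - x) `^ s by exact: powR_ge0.
have weak k k' u v : k <= k' -> 0 <= u -> u <= v -> 0 <= k' -> k * u <= k' * v.
  move=> kk u0 uv k0; apply: (@le_trans _ _ (k' * u)); first exact: ler_wpM2r.
  exact: ler_wpM2l.
have [n0|n0] := posnP n; first subst n.
  split => //; rewrite cE hornerC.
  have e1 : 1 <= l * (x - a) `^ (- ((beta + 1 / 2) / 2)).
    have X0 : 0 < (x - a) `^ ((beta + 1 / 2) / 2) by rewrite powR_gt0//
      subr_gt0.
    have lX : (x - a) `^ ((beta + 1 / 2) / 2) <= l.
      by rewrite lE; apply: powR_homo_le; lra.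
    by rewrite powRN (ler_pdivlMr _ _ X0) [leLHS]mul1r.
  apply: (@le_trans _ _ ((`|c| * l) * (x - a) `^ (- ((beta + 1 / 2) / 2)))).
    by rewrite -mulrA ler_peMr.
  apply: weak => //; [lra|by rewrite lerDl|lra].
have nk : 0 <= n%:R `^ (-1 + 4 * kap) :> R by exact: powR_ge0.
set N := n%:R `^ _ in H1 H2 nk *.
have [xm|xm] := leP x (a + (b - a) / 2).
  have hx : a < x <= a + (b - a) / 2 by rewrite ax.
  have [h1 h2] := H1 n x n0 hx.
  split; first by apply: (le_trans h1); apply: weak => //;
    [lra|by rewrite lerDl|lra].
  move=> _; rewrite -!(mulrA _ N) in h2 *; split; apply: (le_trans h2).
    apply: weak => //; [lra|by apply: mulr_ge0|lra].
  apply: (@le_trans _ _ ((K1 * M) *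
    (N * (b - x) `^ ((gam + 1 / 2) / 2 + 2 * kap)))).
    rewrite -(mulrA K1) ler_pM2l// mulrCA; apply: ler_wpM2l => //.
    by have [+ _] := HM x; exact.
  apply: weak => //; [lra|by apply: mulr_ge0|lra].
have hx : a + (b - a) / 2 <= x < b by rewrite ltW.
have [h1 h2] := H2 n x n0 hx.
split; first by apply: (le_trans h1); apply: weak => //;
  [lra|by rewrite lerDr|lra].
move=> _; rewrite -!(mulrA _ N) in h2 *; split; apply: (le_trans h2).
  apply: (@le_trans _ _ ((K2 * M) *
    (N * (x - a) `^ ((beta + 1 / 2) / 2 + 2 * kap)))).
    rewrite -(mulrA K2) ler_pM2l// mulrCA; apply: ler_wpM2l => //.
    by have [_] := HM x; exact.
  apply: weak => //; [lra|by apply: mulr_ge0|lra].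
apply: weak => //; [lra|by apply: mulr_ge0|lra].
Qed.

End jacobi_bounds_full.

(** * Jacobi coefficients of weighted L_p functions *)

Section sums.
Context {R : realType}.

(** A form of Young's inequality with constant 1: either v <= u^(p - 1 - del), and the first term
    dominates, or u is bounded by a power of v, and the second does. *)
Lemma powR_split_le (p del u v : R) : 0 < del -> 1 + del < p -> 0 <= u ->
  0 < v ->
  u `^ (1 + del) * v <= u `^ p + v `^ (p / (p - 1 - del)).
Proof.
move=> d0 dp u0 v0; set r := p / _.
have D0 : 0 < p - 1 - del by lra.
have [->|un0] := eqVneq u 0.
  rewrite powR0 ?mul0r; last by rewrite gt_eqF//; lra.
  by rewrite addr_ge0 ?powR_ge0.
have u1 : 0 < u by rewrite lt_def un0.
have [vu|uv] := leP v (u `^ (p - 1 - del)).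
  apply: (@le_trans _ _ (u `^ p)); last by rewrite lerDl powR_ge0.
  have -> : p = (1 + del) + (p - 1 - del) by ring.
  by rewrite (powR_addl (1 + del) _ u1) ler_wpM2l// powR_ge0.
apply: (@le_trans _ _ (v `^ r)); last by rewrite lerDr powR_ge0.
have -> : r = (p - 1 - del)^-1 * (1 + del) + 1 by rewrite /r; field;
  rewrite gt_eqF.
rewrite (powR_addl _ 1 v0) powRr1 ?(ltW v0)// ler_wpM2r ?(ltW v0)//.
rewrite powRrM; apply: powR_homo_le => //; first lra.
have {1}-> : u = (u `^ (p - 1 - del)) `^ (p - 1 - del)^-1.
  by rewrite -powRrM mulfV ?powRr1// gt_eqF.
by apply: powR_homo_le; [rewrite invr_ge0 ltW|exact: powR_ge0|exact: ltW].
Qed.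

Lemma mulr_sqr_sum (z : R) (e J : nat -> R) N :
  z * ((\sum_(0 <= n < N) e n * J n) * (\sum_(0 <= n < N) e n * J n)) =
  \sum_(0 <= n < N) e n * \sum_(0 <= m < N) e m * (z * J n * J m).
Proof.
rewrite mulr_suml mulr_sumr; apply: eq_bigr => n _.
by rewrite !mulr_sumr; apply: eq_bigr => m _; ring.
Qed.

Lemma sum_delta (e : nat -> R) n N : (n < N)%N ->
  \sum_(0 <= m < N) e m * (n == m)%:R = e n.
Proof.
move=> nN; rewrite (bigD1_seq n)/= ?mem_index_iota ?iota_uniq// eqxx mulr1.
by rewrite big1 ?addr0// => m /negPf; rewrite eq_sym => ->; rewrite mulr0.
Qed.

(** On the block from 2^k to 2^(k + 1) the weight n^s is at most 2^(k s), so the block contributes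
    at most a constant times 2^((s + t) k), a convergent geometric series. *)
Lemma dyadic_summable (c : nat -> R) (C s t : R) : (forall n, 0 <= c n) -> 0 <=
  C ->
  s <= 0 -> 0 <= t -> s + t < 0 ->
  (forall N, (0 < N)%N -> \sum_(0 <= n < N) c n <= C * N%:R `^ t) ->
  cvgn (series (fun n => c n * n%:R `^ s)).
Proof.
move=> c0 C0 s0 t0 st HC.
have s1 : s < 0 by lra.
pose u n := c n * n%:R `^ s.
have u0 n : 0 <= u n by apply: mulr_ge0 => //; exact: powR_ge0.
pose r : R := 2 `^ (s + t).
have r0 : 0 < r by exact: powR_gt0.
have r1 : r < 1.
  have -> : r = (2 `^ (- (s + t)))^-1 by rewrite -powRN opprK.
  rewrite invf_lt1 ?powR_gt0//.
  have e0 : 0 < - (s + t) by lra.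
  have := gt0_ltr_powR e0; move=> /(_ 1 2); rewrite powR1 !nnegrE; apply; lra.
have blk k : \sum_(2 ^ k <= n < 2 ^ k.+1) u n <= C * 2 `^ t * r ^+ k.
  apply: (@le_trans _ _ (\sum_(2 ^ k <= n < 2 ^ k.+1) c n * (2 ^ k)%:R `^ s)).
    rewrite big_nat_cond [leRHS]big_nat_cond; apply: ler_sum =>
      n /andP[/andP[kn _] _].
    apply: ler_wpM2l => //.
    rewrite -[s]opprK 2!(powRN _ (- s)) lef_pV2 ?posrE ?powR_gt0 ?ltr0n
      ?expn_gt0//; last first.
      by apply: leq_trans kn; rewrite expn_gt0.
    by apply: powR_homo_le; [rewrite oppr_ge0|by []|rewrite ler_nat].
  rewrite -mulr_suml.
  have h : \sum_(2 ^ k <= n < 2 ^ k.+1) c n <= C * (2 ^ k.+1)%:R `^ t.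
    apply: le_trans (HC _ _); last by rewrite expn_gt0.
    rewrite (@big_cat_nat _ _ _ (2 ^ k) 0 (2 ^ k.+1))//=;
      last by rewrite leq_exp2l.
    by rewrite lerDr sumr_ge0.
  apply: (le_trans (ler_wpM2r _ h)); first exact: powR_ge0.
  have e2 j : (2 ^ j)%:R = 2 `^ j%:R :> R by rewrite natrX powR_mulrn.
  have er : r ^+ k = 2 `^ ((s + t) * k%:R).
    by rewrite powRrM powR_mulrn// powR_ge0.
  rewrite er !e2 -!powRrM.
  rewrite -mulrA -powRD ?pnatr_eq0 ?implybT// -mulrA -powRD ?pnatr_eq0
    ?implybT//.
  by rewrite (_ : k.+1%:R * t + k%:R * s = t + (s + t) * k%:R)// -natr1; ring.
have tot k : \sum_(1 <= n < 2 ^ k) u n <= C * 2 `^ t * (1 - r)^-1.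
  have r1' : 0 < 1 - r by lra.
  suff : \sum_(1 <= n < 2 ^ k) u n <= C * 2 `^ t * ((1 - r ^+ k) / (1 - r)).
    move/le_trans; apply; apply: ler_wpM2l; first by rewrite mulr_ge0 ?powR_ge0.
    rewrite ler_pdivrMr// mulVf ?gt_eqF// gerBl; exact/ltW/exprn_gt0.
  elim: k => [|k IH].
    by rewrite big_geq// expr0 subrr mul0r mulr0.
  rewrite (@big_cat_nat _ _ _ (2 ^ k))//= ?expn_gt0// ?leq_exp2l//.
  apply: le_trans (lerD IH (blk k)) _.
  rewrite -mulrDr; apply: ler_wpM2l; first by rewrite mulr_ge0 ?powR_ge0.
  rewrite le_eqVlt; apply/orP; left; apply/eqP.
  by rewrite exprS; field; rewrite gt_eqF.
apply: nondecreasing_is_cvgn.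
  apply/nondecreasing_seqP => n; rewrite /series/= big_nat_recr//= lerDl.
  exact: u0.
exists (u 0%N + C * 2 `^ t * (1 - r)^-1) => _ [n _ <-]; rewrite /series/=.
apply: (@le_trans _ _ (\sum_(0 <= k < 2 ^ n) u k)).
  rewrite (@big_cat_nat _ _ _ n 0 (2 ^ n))//=; last exact/ltnW/ltn_expl.
  by rewrite lerDl sumr_ge0.
by rewrite big_ltn ?expn_gt0// lerD2l.
Qed.

(** At an end with exponent e, the condition p > 4 (e + 1) / (2e + 3) rearranges to (e + 1) (p - 1)
    > p (e + 1/2) / 2: the bound for the p_n to the power p / (p - 1) is integrable against the
    weight. The exponent p / (p - 1 - del) is a perturbation of this conjugate exponent. Also p > 1,
    because that fraction is at least 1 for e >= -1/2. *)
Lemma exponent_params (beta gam p : R) :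
  - (1 / 2) <= beta <= 1 / 2 -> - (1 / 2) <= gam <= 1 / 2 ->
  (exponent_M beta gam < p%:E)%E ->
  exists kap del, [/\ 0 < kap <= 1 / 8, 0 < del <= 1, 16 * kap < del,
    1 + del < p &
    ((beta + 1 / 2) / 2 + kap) * (p / (p - 1 - del)) < beta + 1 /\
    ((gam + 1 / 2) / 2 + kap) * (p / (p - 1 - del)) < gam + 1].
Proof.
move=> hb hg hM.
have side e : - (1 / 2) <= e <= 1 / 2 ->
  (4%:E * efrac (e + 1) (2 * e + 3) < p%:E)%E ->
    1 < p /\ 0 < (e + 1) * (p - 1) - (e + 1 / 2) / 2 * p.
  move=> he; have e3 : 0 < 2 * e + 3 by lra.
  rewrite /efrac gt_eqF// -EFinM lte_fin mulrA ltr_pdivrMr// => h.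
  split; last by lra.
  by rewrite -(ltr_pM2r e3) mul1r; apply: le_lt_trans h; lra.
have mono e : (e <= Order.max (efrac (beta + 1) (2 * beta + 3))
  (efrac (gam + 1) (2 * gam + 3)))%E ->
    (4%:E * e < p%:E)%E.
  by move=> h; apply: le_lt_trans hM; rewrite /exponent_M lee_pmul2l.
have mb : (4%:E * efrac (beta + 1) (2 * beta + 3) < p%:E)%E.
  by apply: mono; rewrite le_max lexx.
have mg : (4%:E * efrac (gam + 1) (2 * gam + 3) < p%:E)%E.
  by apply: mono; rewrite le_max lexx orbT.
have [p1 sb] := side beta hb mb.
have [_ sg] := side gam hg mg.
move: sb sg; set sb := (X in 0 < X -> _); set sg := (X in _ -> 0 < X -> _) =>
  sb0 sg0.
(* All available slack. The division by 2 (p + 2) below makes the combined cost (e + 1) del + kap p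
   smaller than d, with kap = del / 32 and e + 1 <= 3/2. *)
pose d := Num.min (Num.min 1 (p - 1)) (Num.min sb sg).
have d0 : 0 < d by rewrite !lt_min; apply/andP; split; apply/andP; split => //;
  lra.
have [d1 dp] : d <= 1 /\ d <= p - 1 by split; rewrite /d !ge_min lexx ?orbT.
have [dsb dsg] : d <= sb /\ d <= sg by split; rewrite /d !ge_min lexx ?orbT.
pose del := d / (2 * (p + 2)).
have P0 : 0 < 2 * (p + 2) by lra.
have del0 : 0 < del by exact: divr_gt0.
have delE : del * (2 * (p + 2)) = d by rewrite /del divfK// gt_eqF.
have del2 : del * 2 <= d.
  by rewrite -delE ler_pM2l//; lra.
exists (del / 32), del; split; [lra|lra|lra|lra|].
have D0 : 0 < p - 1 - del by lra.
by split; rewrite mulrA ltr_pdivrMr// -subr_gt0;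
  rewrite /sb /sg in dsb dsg; nra.
Qed.

End sums.

(* For s = (beta + 1/2)/2 + kap and t = (gam + 1/2)/2 + kap it dominates all
   the orthonormal Jacobi polynomials; the slack kap > 0 makes the primitives
   of the p_n w integrable against the derivative of such a weight. *)
Definition endpoint_weight {R : realType} (a b s t x : R) : R :=
  (x - a) `^ (- s) + (b - x) `^ (- t).

(** * Average size of the Jacobi coefficients *)

Section weighted_functions.
Context {R : realType}.
Local Notation mu := (@lebesgue_measure R).
Local Notation RT := (measurableTypeR R).
Variables (a b beta gam kap del : R).
Hypothesis ab : a < b.
Hypothesis hbeta : - (1 / 2) <= beta <= 1 / 2.
Hypothesis hgam : - (1 / 2) <= gam <= 1 / 2.
Hypothesis hkap : 0 < kap <= 1 / 8.
Hypothesis hdel : 0 < del <= 1.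
Hypothesis hkd : 16 * kap < del.
Local Notation w := (weight a b beta gam).
Local Notation Jp := (jacobi_poly a b beta gam).
Local Notation D := (`]a, b[%classic : set RT).
Local Notation G := (endpoint_weight a b ((beta + 1 / 2) / 2 + kap)
  ((gam + 1 / 2) / 2 + kap)).
Implicit Types (f : R -> R) (x : R).

Let hb : - (1 / 2) <= beta. Proof. by case/andP : hbeta. Qed.
Let hg : - (1 / 2) <= gam. Proof. by case/andP : hgam. Qed.
Let L0 : 0 < b - a. Proof. by rewrite subr_gt0. Qed.
Let mD : measurable D. Proof. exact: mitv. Qed.

Lemma endpoint_weight_ge0 s t x : 0 <= endpoint_weight a b s t x.
Proof. by apply: addr_ge0; exact: powR_ge0. Qed.

Lemma measurable_endpoint_weight s t :
  measurable_fun D (endpoint_weight a b s t).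
Proof.
by apply: measurable_funD; apply: measurable_powR_comp;
  apply: measurable_funB.
Qed.

Lemma measurable_weight : measurable_fun D w.
Proof. exact: measurable_powR_sub_mul. Qed.

Lemma intg_weight : intg D w.
Proof.
apply: (eq_intg _ _ (intg_weight_poly ab hb hg 1)) => // x _.
by rewrite hornerC mulr1.
Qed.

Lemma intg_endpoint_weight s t : s < beta + 1 -> t < gam + 1 ->
  intg D (fun x => endpoint_weight a b s t x * w x).
Proof.
move=> hs ht; have h1 := hb1 hb; have h2 := hg1 hg.
apply: (@eq_intg _ _ (fun x => (x - a) `^ (beta - s) * (b - x) `^ gam +
                               (x - a) `^ beta * (b - x) `^ (gam - t))) => //.
  move=> x /=; rewrite in_itv/= => /andP[ax xb].
  have X0 : 0 < x - a by rewrite subr_gt0.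
  have Y0 : 0 < b - x by rewrite subr_gt0.
  rewrite (powR_addl beta (- s) X0) (powR_addl gam (- t) Y0).
  by rewrite /endpoint_weight /weight; ring.
by apply: intgD => //; apply: intg_powR_sub_mul => //; lra.
Qed.

Lemma endpoint_weight_bounds : exists2 K, 0 < K & forall x, a < x < b ->
  1 <= K * G x /\ (x - a) `^ (- ((beta + 1 / 2) / 2)) +
    (b - x) `^ (- ((gam + 1 / 2) / 2)) <= K * G x.
Proof.
have /andP[k1 k2] := hkap; have := hb; have := hg => h1 h2.
have [l lE l0] : exists2 l, l = (b - a) `^ kap & 0 < l by eexists;
  [reflexivity|exact: powR_gt0].
have [m mE m0] : exists2 m, m = (b - a) `^ ((beta + 1 / 2) / 2 + kap) & 0 < m.
  by eexists; [reflexivity|exact: powR_gt0].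
exists (l + m) => [|x /andP[ax xb]]; first lra.
have X0 : 0 < x - a by rewrite subr_gt0.
have Y0 : 0 < b - x by rewrite subr_gt0.
have P0 s : 0 <= (x - a) `^ s by exact: powR_ge0.
have Q0 s : 0 <= (b - x) `^ s by exact: powR_ge0.
have up z s r : 0 < z -> z <= b - a -> 0 <= r -> z `^ (- s) <= (b - a) `^ r *
  z `^ (- (s + r)).
  move=> z0 zb r0; have -> : - s = r + - (s + r) by ring.
  rewrite powR_addl//; apply: ler_wpM2r; first exact: powR_ge0.
  by apply: powR_homo_le => //; exact: ltW.
have G0 := endpoint_weight_ge0 ((beta + 1 / 2) / 2 + kap) ((gam + 1 / 2) / 2 +
  kap) x.
split.
- apply: (@le_trans _ _ (m * G x)); last by rewrite ler_wpM2r// lerDr ltW.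
  apply: (@le_trans _ _ (m * (x - a) `^ (- ((beta + 1 / 2) / 2 + kap)))).
    have := up (x - a) 0 ((beta + 1 / 2) / 2 + kap) X0 ltac:(lra) ltac:(lra).
    by rewrite oppr0 powRr0 add0r mE.
  by apply: ler_wpM2l; [exact: ltW|rewrite lerDl].
- apply: (@le_trans _ _ (l * G x)); last by rewrite ler_wpM2r// lerDl ltW.
  rewrite /endpoint_weight mulrDr lE.
  by apply: lerD; apply: up => //; lra.
Qed.

Lemma jacobi_poly_bound : exists2 K, 0 < K & forall n x, a < x < b ->
  `|(Jp n).[x]| <= K * G x.
Proof.
have [K K0 HK] := jacobi_bounds ab hbeta hgam hkap.
have [M M0 HM] := endpoint_weight_bounds.
exists (K * M) => [|n x axb]; first exact: mulr_gt0.
have [h _] := HK n x axb; have [_ h2] := HM x axb.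
apply: (le_trans h); rewrite -mulrA; apply: ler_wpM2l => //; exact: ltW.
Qed.

(** [powR_split_le] applied to each of the two powers in G leaves |f|^p and an endpoint weight whose
    exponents are multiplied by r = p / (p - 1 - del); the hypotheses on r make the latter
    integrable against w. *)
Lemma Lp_intg p f : 1 + del < p ->
  ((beta + 1 / 2) / 2 + kap) * (p / (p - 1 - del)) < beta + 1 ->
  ((gam + 1 / 2) / 2 + kap) * (p / (p - 1 - del)) < gam + 1 ->
  measurable_fun D f -> intg D (fun x => `|f x| `^ p * w x) ->
  intg D (fun x => `|f x| `^ (1 + del) * (G x * w x)).
Proof.
move=> dp hs ht mf fi; set r := p / _ in hs ht.
have /andP[d0 d1] := hdel.
apply: (@intg_le _ _ _ (fun x => 2 * (`|f x| `^ p * w x) +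
   endpoint_weight a b (((beta + 1 / 2) / 2 + kap) * r)
     (((gam + 1 / 2) / 2 + kap) * r) x * w x)) => //.
- apply: measurable_funM; last first.
    by apply: measurable_funM;
      [exact: measurable_endpoint_weight|exact: measurable_weight].
  by apply: measurable_powR_comp; exact: measurableT_comp.
- move=> x /=; rewrite in_itv/= => /andP[ax xb].
  have X0 : 0 < x - a by rewrite subr_gt0.
  have Y0 : 0 < b - x by rewrite subr_gt0.
  have w0 := weight_ge0 a b beta gam x.
  rewrite ger0_norm; last first.
    by apply: mulr_ge0; [exact: powR_ge0|apply: mulr_ge0;
      [exact: endpoint_weight_ge0|]].
  rewrite mulrA [leRHS](_ : _ =
    (2 * `|f x| `^ p + endpoint_weight a b (((beta + 1 / 2) / 2 + kap) * r)
    (((gam + 1 / 2) / 2 + kap) * r) x) * w x); last by ring.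
  apply: ler_wpM2r => //.
  rewrite /endpoint_weight mulrDr.
  have := powR_split_le d0 dp (normr_ge0 (f x))
    (powR_gt0 (- ((beta + 1 / 2) / 2 + kap)) X0).
  have := powR_split_le d0 dp (normr_ge0 (f x))
    (powR_gt0 (- ((gam + 1 / 2) / 2 + kap)) Y0).
  by rewrite -/r -!powRrM !mulNr; lra.
- by apply: intgD => //; [exact: intgZl|exact: intg_endpoint_weight].
Qed.

Lemma intg_G : intg D (fun x => G x * w x).
Proof.
have := hb; have := hg; have /andP[k1 k2] := hkap => h1 h2.
by apply: intg_endpoint_weight; move: hbeta hgam => /andP[? ?] /andP[? ?]; lra.
Qed.

Lemma intg_powR_G f : measurable_fun D f ->
  intg D (fun x => `|f x| `^ (1 + del) * (G x * w x)) ->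
  intg D (fun x => `|f x| * (G x * w x)).
Proof.
move=> mf fi; have /andP[d0 d1] := hdel.
have Gw0 x : 0 <= G x * w x by apply: mulr_ge0;
  [exact: endpoint_weight_ge0|exact: weight_ge0].
apply: (@intg_le _ _ _ (fun x => `|f x| `^ (1 + del) * (G x * w x) + G x * w x))
  => //.
- apply: measurable_funM; first exact: measurableT_comp.
  by apply: measurable_funM;
    [exact: measurable_endpoint_weight|exact: measurable_weight].
- move=> x _; rewrite ger0_norm; last by apply: mulr_ge0.
  rewrite [leRHS](_ : _ = (`|f x| `^ (1 + del) + 1) * (G x * w x));
    last by ring.
  apply: ler_wpM2r => //.
  have [f1|f1] := leP `|f x| 1; first by rewrite (le_trans f1)// lerDr powR_ge0.
  rewrite ler_wpDr// le1r_powR//; lra.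
- by apply: intgD => //; exact: intg_G.
Qed.


Section coefficients.
Variable f : R -> R.
Hypothesis mf : measurable_fun D f.
Hypothesis fi : intg D (fun x => `|f x| `^ (1 + del) * (G x * w x)).

Definition jcoef (g : R -> R) n := \int[mu]_(x in D) (g x * ((Jp n).[x] * w x)).

Lemma intg_jacobi n : intg D (fun x => f x * ((Jp n).[x] * w x)).
Proof.
have [K K0 HK] := jacobi_poly_bound.
apply: (@intg_le _ _ _ (fun x => K * (`|f x| * (G x * w x)))) => //.
- apply: measurable_funM => //.
  by apply: measurable_funM;
    [exact: measurable_horner|exact: measurable_weight].
- move=> x /=; rewrite in_itv/= => axb; have w0 := weight_ge0 a b beta gam x.
  rewrite normrM [X in _ * X]normrM (ger0_norm w0) [leRHS]mulrCA;
    apply: ler_wpM2l; first exact: normr_ge0.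
  by rewrite [leRHS]mulrA; apply: ler_wpM2r => //; exact: HK.
- by apply: intgZl => //; exact: intg_powR_G.
Qed.

(* f is cut at the height T = N^(1/4). Against q = sum of the +- p_n, the
   bounded part is estimated by |q| <= (sqrt N + q^2 / sqrt N) / 2 and the
   orthonormality of the p_n, while the rest gains the factor T^(- del). *)
Lemma jcoef_sum_le : exists2 C, 0 <= C & forall N, (0 < N)%N ->
  \sum_(0 <= n < N) `|jcoef f n| <= C * N%:R `^ (1 - del / 4).
Proof.
have [K K0 HK] := jacobi_poly_bound; have /andP[d0 d1] := hdel.
set W := \int[mu]_(x in D) w x.
set F := \int[mu]_(x in D) (`|f x| `^ (1 + del) * (G x * w x)).
have W0 : 0 <= W by apply: Rintegral_ge0 => x _; exact: weight_ge0.
have Gw0 x : 0 <= G x * w x by apply: mulr_ge0;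
  [exact: endpoint_weight_ge0|exact: weight_ge0].
have F0 : 0 <= F.
  by apply: Rintegral_ge0 => x _; apply: mulr_ge0; [exact: powR_ge0|].
have KF0 : 0 <= K * F by apply: mulr_ge0 => //; exact: ltW.
exists ((W + 1) / 2 + K * F) => [|N N0]; first lra.
pose e n := Num.sg (jcoef f n).
pose q : {poly R} := \sum_(0 <= n < N) e n *: Jp n.
have qE x : q.[x] = \sum_(0 <= n < N) e n * (Jp n).[x].
  by rewrite /q horner_sum; apply: eq_bigr => n _; rewrite hornerZ.
have NR : 1 <= N%:R :> R by rewrite ler1n.
have NR0 : 0 < N%:R :> R by rewrite ltr0n.
have [T TE T0] : exists2 T : R, T = N%:R `^ 4^-1 & 0 < T by eexists;
  [reflexivity|exact: powR_gt0].
have [S SE S0] : exists2 S : R, S = N%:R `^ 2^-1 & 0 < S by eexists;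
  [reflexivity|exact: powR_gt0].
have e1 n : `|e n| <= 1 by rewrite /e normr_sg; case: (_ != _).
have qb x : a < x < b -> `|q.[x]| <= N%:R * (K * G x).
  move=> axb; rewrite qE; apply: le_trans (ler_norm_sum _ _ _) _.
  apply: (@le_trans _ _ (\sum_(0 <= n < N) K * G x)).
    apply: ler_sum => n _; rewrite normrM -[leRHS]mul1r.
    by apply: ler_pM => //; exact: HK.
  by rewrite sumr_const_nat subn0 mulr_natl.
have qi : intg D (fun x => w x * (q ^+ 2).[x]) by exact: intg_weight_poly.
have qN : \int[mu]_(x in D) (w x * (q ^+ 2).[x]) <= N%:R.
  have -> : \int[mu]_(x in D) (w x * (q ^+ 2).[x]) =
      \sum_(0 <= n < N) e n * \sum_(0 <= m < N) e m * (n == m)%:R.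
    transitivity (\int[mu]_(x in D) \sum_(0 <= n < N) e n * \sum_(0 <= m < N)
        e m * (w x * (Jp n).[x] * (Jp m).[x])).
      by apply: eq_int => x _; rewrite horner_exp expr2 !qE mulr_sqr_sum.
    have ij n m : intg D (fun x => w x * (Jp n).[x] * (Jp m).[x]).
      apply: (eq_intg _ _ (intg_weight_poly ab hb hg (Jp n * Jp m))) => // x _.
      by rewrite hornerM mulrA.
    rewrite Rintegral_sum//; last first.
      by move=> n _; apply: intgZl => //; apply: intg_sum => // m _;
        exact: intgZl.
    apply: eq_bigr => n _; rewrite intZl//; last by apply: intg_sum => // m _;
      exact: intgZl.
    rewrite Rintegral_sum//; last by move=> m _; exact: intgZl.
    congr (_ * _); apply: eq_bigr => m _; rewrite intZl//.
    by rewrite jacobi_orthonormal.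
  apply: (@le_trans _ _ (\sum_(0 <= n < N) 1));
    last by rewrite sumr_const_nat subn0.
  rewrite big_nat_cond [leRHS]big_nat_cond; apply: ler_sum =>
    n /andP[/andP[_ nN] _].
  rewrite sum_delta//.
  by apply: le_trans (ler_norm _) _; rewrite normrM -[leRHS]mul1r ler_pM.
have -> : \sum_(0 <= n < N) `|jcoef f n| =
  \int[mu]_(x in D) (f x * (q.[x] * w x)).
  transitivity (\int[mu]_(x in D) \sum_(0 <= n < N) e n *
    (f x * ((Jp n).[x] * w x))).
    rewrite Rintegral_sum//; last by move=> n _; apply: intgZl => //;
      exact: intg_jacobi.
    apply: eq_bigr => n _; rewrite intZl//; last exact: intg_jacobi.
    by rewrite normrEsg.
  apply: eq_int => x _; rewrite qE mulr_suml mulr_sumr; apply: eq_bigr => n _.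
  by move: (w x) (e n) (f x) (Jp n).[x] => ? ? ? ?; ring.
have iw := intg_weight.
have i1 : intg D (fun x => S * w x + S^-1 * (w x * (q ^+ 2).[x])).
  by apply: intgD => //; exact: intgZl.
have i2 : intg D (fun x => T / 2 * (S * w x + S^-1 * (w x * (q ^+ 2).[x])))
  by exact: intgZl.
have i3 : intg D (fun x => T `^ (- del) * N%:R * K *
  (`|f x| `^ (1 + del) * (G x * w x))).
  exact: intgZl.
pose g' x := T / 2 * (S * w x + S^-1 * (w x * (q ^+ 2).[x])) +
  T `^ (- del) * N%:R * K * (`|f x| `^ (1 + del) * (G x * w x)).
apply: (@le_trans _ _ (\int[mu]_(x in D) g' x)).
  apply: le_trans (ler_norm _) _; apply: norm_Rintegral_le => //;
    last exact: intgD.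
    apply: measurable_funM => //.
    by apply: measurable_funM;
      [exact: measurable_horner|exact: measurable_weight].
  move=> x /=; rewrite in_itv/= => axb; have w0 := weight_ge0 a b beta gam x.
  have h1 : 0 <= T / 2 * (S * w x + S^-1 * (w x * (q ^+ 2).[x])).
    apply: mulr_ge0; first lra.
    apply: addr_ge0; apply: mulr_ge0 => //;
      [exact: ltW|by rewrite invr_ge0 ltW|].
    by apply: mulr_ge0 => //; rewrite horner_exp; exact: sqr_ge0.
  have h2 : 0 <= T `^ (- del) * N%:R * K * (`|f x| `^ (1 + del) * (G x * w x)).
    apply: mulr_ge0; last by apply: mulr_ge0; [exact: powR_ge0|].
    by apply: mulr_ge0; [apply: mulr_ge0; [exact: powR_ge0|]|exact: ltW].
  rewrite normrM [X in _ * X]normrM (ger0_norm w0) /g'.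
  have [fT|fT] := leP `|f x| T.
    apply: (@le_trans _ _ (T / 2 * (S * w x + S^-1 * (w x * (q ^+ 2).[x]))));
      last by rewrite lerDl.
    have -> : T / 2 * (S * w x + S^-1 * (w x * (q ^+ 2).[x])) =
      T * ((S + S^-1 * q.[x] ^+ 2) / 2 * w x).
      by rewrite horner_exp; field; rewrite gt_eqF.
    apply: ler_pM => //; first by apply: mulr_ge0 => //; exact: normr_ge0.
    apply: ler_wpM2r => //.
    rewrite -(real_normK (num_real q.[x])); move: `|q.[x]| => z.
    rewrite -subr_ge0 (_ : _ - _ = S^-1 * (S - z) ^+ 2 / 2); last by field;
      rewrite gt_eqF.
    by apply: mulr_ge0 => //; apply: mulr_ge0;
      [rewrite invr_ge0 ltW|exact: sqr_ge0].
  apply: (@le_trans _ _ (T `^ (- del) * N%:R * K *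
    (`|f x| `^ (1 + del) * (G x * w x)))); last by rewrite lerDr.
  have f0 : 0 < `|f x| by exact: lt_trans fT.
  rewrite (powR_addl 1 del f0) powRr1 ?(ltW f0)//.
  have -> : T `^ (- del) * N%:R * K * (`|f x| * `|f x| `^ del * (G x * w x)) =
    `|f x| * ((T `^ (- del) * `|f x| `^ del) * (N%:R * (K * G x)) * w x)
      by ring.
  apply: ler_wpM2l; first exact: ltW.
  apply: ler_wpM2r => //; rewrite -[leLHS]mul1r; apply: ler_pM => //;
    last exact: qb.
  rewrite powRN mulrC ler_pdivlMr ?powR_gt0// [leLHS]mul1r.
  by apply: powR_homo_le; exact: ltW.
rewrite /g' intD// intZl// intD//; [|exact: intgZl|exact: intgZl].
rewrite !intZl// -/W -/F.
(* The bounded part has size T S = N^(3/4), which fits into N^(1 - del/4) because del <= 1; the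
   unbounded part has exactly the size T^(- del) N = N^(1 - del/4). *)
have pT : T * S <= N%:R `^ (1 - del / 4).
  rewrite TE SE -powRD ?(gt_eqF NR0) ?implybT//; apply: ler_powR => //; lra.
have pd : T `^ (- del) * N%:R = N%:R `^ (1 - del / 4).
  rewrite TE -powRrM -[X in _ * X]powRr1 ?ltW// -powRD ?(gt_eqF NR0) ?implybT//.
  by congr (_ `^ _); field.
have hS : S^-1 * N%:R = S.
  rewrite SE -powRN -[X in _ * X]powRr1 ?ltW// -powRD ?(gt_eqF NR0) ?implybT//.
  by congr (_ `^ _); field.
set V := N%:R `^ (1 - del / 4) in pT pd *.
rewrite mulrDl; apply: lerD; last by rewrite pd -mulrA mulrC.
apply: (@le_trans _ _ (T / 2 * (S * W + S^-1 * N%:R))).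
  apply: ler_wpM2l; first lra.
  by rewrite lerD2l ler_wpM2l// invr_ge0 ltW.
rewrite hS (_ : T / 2 * _ = (W + 1) / 2 * (T * S)); last by field.
by apply: ler_wpM2l; [lra|].
Qed.

(** The growth exponent 1 - del/4 of the partial sums and the weight exponent -1 + 4 kap have a
    negative sum because 16 kap < del. *)
Lemma jcoef_summable : cvgn (series (fun n => `|jcoef f n| *
  n%:R `^ (-1 + 4 * kap))).
Proof.
have [C C0 HC] := jcoef_sum_le; have /andP[d0 d1] := hdel; have /andP[k1 k2] :=
  hkap.
by apply: (dyadic_summable _ C0 _ _ _ HC) => [n||//|]; move: hkd => h //; lra.
Qed.

End coefficients.

End weighted_functions.

(** * Remainders of Jacobi expansions *)

Section endpoint_ibp.
Context {R : realType}.
Local Notation mu := (@lebesgue_measure R).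
Local Notation RT := (measurableTypeR R).
Implicit Types (F f : R -> R) (u v x t : R).

Lemma FTC_co F f u v : u <= v ->
  (forall x, u <= x <= v -> is_derive x 1 F (f x)) ->
  (forall x, u <= x <= v -> {for x, continuous f}) ->
  intg `[u, v[ f /\ \int[mu]_(x in `[u, v[) f x = F v - F u.
Proof.
move=> uv dF cf; have [i E] := FTC_cc uv dF cf.
have mcc := @mitv R `[u, v]; have mco := @mitv R `[u, v[.
have ico : intg `[u, v[ f.
  by apply: (intgS mcc mco _ i) => x /=; rewrite !in_itv/= => /andP[-> /ltW].
by split => //; rewrite (Rintegral_itv_bndo_bndc ico).
Qed.

Lemma intg_if (D E : set RT) (P : pred R) f : measurable D -> measurable E ->
  (forall x, E x <-> D x /\ P x) -> intg E f ->
  intg D (fun x => if P x then f x else 0).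
Proof.
move=> mD mE H fi; have fi' := intgS measurableT mD (@subsetT _ _)
  (intg_patch mE fi).
apply: (eq_intg _ _ fi') => // x Dx; rewrite patchE.
case: ifPn => [/set_mem/H[_ ->]//|xE]; case: ifPn => // Px.
by move/negP : xE; case; apply/mem_set/H.
Qed.

Variables (a b beta gam kap : R).
Hypothesis ab : a < b.
Hypothesis hbeta : - (1 / 2) <= beta <= 1 / 2.
Hypothesis hgam : - (1 / 2) <= gam <= 1 / 2.
Hypothesis hkap : 0 < kap <= 1 / 8.
Local Notation w := (weight a b beta gam).
Local Notation D := (`]a, b[%classic : set RT).
Local Notation sg := ((beta + 1 / 2) / 2 + kap).
Local Notation tu := ((gam + 1 / 2) / 2 + kap).
Local Notation G := (endpoint_weight a b sg tu).
Local Notation G1 := (endpoint_weight a b (sg + 1) (tu + 1)).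

Let hb : - (1 / 2) <= beta. Proof. by case/andP : hbeta. Qed.
Let hg : - (1 / 2) <= gam. Proof. by case/andP : hgam. Qed.
Let sg0 : 0 < sg. Proof. by have := hb; move: hkap => /andP[h1 h2] h3; lra. Qed.
Let tu0 : 0 < tu. Proof. by have := hg; move: hkap => /andP[h1 h2] h3; lra. Qed.
Let mD : measurable D. Proof. exact: mitv. Qed.

Definition wtail f t := \int[mu]_(x in `]t, b[) (f x * w x).

(** An increasing antiderivative of [G1], of the order of G at both ends. Hence a function whose
    derivative is bounded by [G1] is itself bounded by a multiple of G, and its product with f w is
    integrable. *)
Let M x := - sg^-1 * (x - a) `^ (- sg) + tu^-1 * (b - x) `^ (- tu).

Let dM x : a < x < b -> is_derive x 1 M (G1 x).
Proof.
move=> /andP[ax xb].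
apply: (is_derive_eq (is_deriveD
  (is_deriveZ (- sg^-1) (is_derive_powR_subl (- sg) ax))
  (is_deriveZ (tu^-1) (is_derive_powR_subr (- tu) xb)))).
rewrite /GRing.scale/= /endpoint_weight (opprD sg 1) (opprD tu 1).
have := sg0; have := tu0; move: (sg) (tu) => s t t0 s0.
by field; rewrite !gt_eqF.
Qed.

Let cG1 x : a < x < b -> {for x, continuous G1}.
Proof.
by move=> /andP[ax xb]; apply: continuousD;
  [exact: continuous_powR_subl|exact: continuous_powR_subr].
Qed.

Let M_le c : a < c < b -> exists2 C, 0 <= C & forall x, a < x < b ->
  `|M x - M c| <= C * G x.
Proof.
move=> acb; have [K K0 HK] := endpoint_weight_bounds ab hbeta hgam hkap.
have s0 : 0 <= sg^-1 by rewrite invr_ge0; exact/ltW/sg0.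
have t0 : 0 <= tu^-1 by rewrite invr_ge0; exact/ltW/tu0.
have cK : 0 <= `|M c| * K by apply: mulr_ge0; [exact: normr_ge0|exact: ltW].
exists (sg^-1 + tu^-1 + `|M c| * K) => [|x axb]; first by apply: addr_ge0 => //;
  exact: addr_ge0.
have [h1 _] := HK x axb.
have p0 := powR_ge0 (x - a) (- sg); have q0 := powR_ge0 (b - x) (- tu).
apply: le_trans (ler_normB _ _) _; rewrite mulrDl; apply: lerD; last first.
  by rewrite -mulrA -[leLHS]mulr1 ler_wpM2l.
rewrite /M; apply: le_trans (ler_normD _ _) _.
rewrite mulNr normrN !ger0_norm ?mulr_ge0// /endpoint_weight [leRHS]mulrDl.
by apply: lerD; apply: ler_wpM2l => //; rewrite ?lerDl ?lerDr.
Qed.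

Section kernel.
Variables (H h : R -> R) (K c : R).
Hypothesis acb : a < c < b.
Hypothesis dH : forall x, a < x < b -> is_derive x 1 H (h x).
Hypothesis ch : forall x, a < x < b -> {for x, continuous h}.
Hypothesis hK : forall x, a < x < b -> `|h x| <= K * G1 x.

Let segment u v : a < u -> v < b -> u <= v ->
  [/\ intg `[u, v[ h, intg `[u, v[ (fun t => `|h t|),
      \int[mu]_(t in `[u, v[) h t = H v - H u &
      \int[mu]_(t in `[u, v[) `|h t| <= K * (M v - M u)].
Proof.
move=> au vb uv.
have uvab x : u <= x <= v -> a < x < b.
  by move=> /andP[ux xv]; rewrite (lt_le_trans au)//= (le_lt_trans xv).
have mco := @mitv R `[u, v[.
have inD x : (`[u, v[%classic : set RT) x -> a < x < b.
  by rewrite /= in_itv/= => /andP[ux /ltW xv]; apply: uvab; rewrite ux.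
have [ih Eh] := FTC_co uv (fun x hx => dH (uvab x hx)) (fun x hx =>
  ch (uvab x hx)).
have [iM EM] := FTC_co uv (fun x hx => dM (uvab x hx)) (fun x hx =>
  cG1 (uvab x hx)).
have ih' := intg_norm mco ih.
split => //.
rewrite -EM -intZl//; apply: int_le => //; first exact: intgZl.
by move=> x /inD xD; exact: hK.
Qed.

(* As a function of t it is supported between c and x, so that h need not be
   integrable at the endpoints; integrated against a function of x with zero
   mean it produces the tail integral. *)
Let kernel x t : R := (if t < x then h t else 0) - (if t < c then h t else 0).

Let kernel_left x t : x <= c ->
  kernel x t = if (x <= t) && (t < c) then - h t else 0.
Proof.
move=> xc; rewrite /kernel; case: (ltP t x) => tx; case: (ltP t c) => tc;
  rewrite ?andbT ?andbF ?subr0 ?sub0r ?subrr//=.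
by have := lt_le_trans tx xc; rewrite ltNge tc.
Qed.

Let kernel_right x t : c <= x ->
  kernel x t = if (c <= t) && (t < x) then h t else 0.
Proof.
move=> cx; rewrite /kernel; case: (ltP t x) => tx; case: (ltP t c) => tc;
  rewrite ?andbT ?andbF ?subr0 ?subrr//=.
by have := lt_le_trans tc cx; rewrite ltNge tx.
Qed.

Let in_segment u v : a < u -> v < b -> forall t,
  (`[u, v[%classic : set RT) t <-> D t /\ (u <= t) && (t < v).
Proof.
move=> au vb t; rewrite /= !in_itv/=; split => [/andP[ut tv]|[]//].
by rewrite ut tv (lt_le_trans au)// (lt_trans tv).
Qed.

Lemma kernel_inner x : a < x < b ->
  [/\ intg D (kernel x), \int[mu]_(t in D) kernel x t = H x - H c &
      \int[mu]_(t in D) `|kernel x t| <= K * `|M x - M c|].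
Proof.
move=> /andP[ax xb]; have /andP[ac cb] := acb.
have K0 : 0 <= K.
  have h1 := hK acb; have g0 : 0 < G1 c.
    by apply: addr_gt0; apply: powR_gt0; rewrite subr_gt0.
  by rewrite -(pmulr_lge0 _ g0) (le_trans _ h1).
have [xc|cx] := leP x c.
  have [i1 i2 E I] := segment ax cb xc; have inS := in_segment ax cb; split.
  - apply: (eq_intg _ _ (intg_if mD (mitv _) inS (intgN (mitv _) i1))) =>
      // t _.
    by rewrite kernel_left.
  - under eq_Rintegral do rewrite kernel_left//.
    by rewrite (int_if _ inS) (intN (mitv _) i1) E opprB.
  have kE t : `|kernel x t| = if (x <= t) && (t < c) then `|h t| else 0.
    by rewrite kernel_left//; case: ifP; rewrite ?normr0 ?normrN.
  under eq_Rintegral do rewrite kE.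
  rewrite (int_if _ inS); apply: (le_trans I).
  by apply: ler_wpM2l => //; rewrite distrC ler_norm.
have [i1 i2 E I] := segment ac xb (ltW cx); have inS := in_segment ac xb; split.
- apply: (eq_intg _ _ (intg_if mD (mitv _) inS i1)) => // t _.
  by rewrite (kernel_right _ (ltW cx)).
- under eq_Rintegral do rewrite (kernel_right _ (ltW cx)).
  by rewrite (int_if _ inS) E.
have kE t : `|kernel x t| = if (c <= t) && (t < x) then `|h t| else 0.
  by rewrite (kernel_right _ (ltW cx)); case: ifP; rewrite ?normr0.
under eq_Rintegral do rewrite kE.
rewrite (int_if _ inS); apply: (le_trans I).
by apply: ler_wpM2l => //; rewrite ler_norm.
Qed.

Lemma kernel_outer f t : a < t < b -> intg D f -> \int[mu]_(x in D) f x = 0 ->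
  \int[mu]_(x in D) (f x * kernel x t) = (\int[mu]_(x in `]t, b[) f x) * h t.
Proof.
move=> /andP[at_ tb] fi f0.
have inT x : (`]t, b[%classic : set RT) x <-> D x /\ t < x.
  rewrite /= !in_itv/=; split => [/andP[tx ->]|[/andP[_ ->] ->]//].
  by rewrite tx (lt_trans at_ tx).
have mT : measurable (`]t, b[%classic : set RT) by exact: mitv.
have TD : (`]t, b[%classic : set RT) `<=` D by move=> x /inT[].
have i0 : intg D (fun x => h t * f x) by exact: intgZl.
have mf := intg_measurable i0.
have i1 : intg D (fun x => if t < x then h t * f x else 0).
  apply: (intg_le _ _ _ (intg_norm _ i0)) => //.
    apply: (@measurable_fun_if _ _ _ _ (fun x => h t * f x) (cst 0) D _
      (fun x => t < x)) => //.
    - by apply: measurable_funS;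
        [exact: measurableT| |exact: measurable_fun_ltr].
    - by apply: (measurable_funS mD _ mf) => x [].
  by move=> x _; case: (t < x); rewrite ?normr0.
have i2 : intg D (fun x => (if t < c then h t else 0) * f x) by exact: intgZl.
rewrite (@eq_int _ _ _ (fun x => (if t < x then h t * f x else 0) -
  (if t < c then h t else 0) * f x)); last first.
  by move=> x _; rewrite /kernel; case: (t < x); ring.
rewrite intB// intZl// f0 mulr0 subr0 (int_if _ inT) intZl//;
  last exact: intgS fi.
exact: mulrC.
Qed.

End kernel.

Lemma intg_weight_of_G f : measurable_fun D f ->
  intg D (fun x => `|f x| * (G x * w x)) -> intg D (fun x => f x * w x).
Proof.
move=> mf fi; have [K1 K10 HK1] := endpoint_weight_bounds ab hbeta hgam hkap.
have mw : measurable_fun D w by exact: measurable_weight.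
apply: (@intg_le _ _ _ (fun x => K1 * (`|f x| * (G x * w x)))) => //.
- exact: measurable_funM.
- move=> x; rewrite /= in_itv/= => axb; have [h1 _] := HK1 x axb.
  have w0 := weight_ge0 a b beta gam x.
  rewrite normrM (ger0_norm w0) [leRHS]mulrCA; apply: ler_wpM2l => //.
  by rewrite [leRHS]mulrA -[leLHS]mul1r ler_wpM2r.
- exact: intgZl.
Qed.

(** Fubini for f(x) w(x) times the kernel whose integral in t is H(x) - H(c). This avoids boundary
    terms: H may be unbounded at both ends, and the constant H(c) disappears because f w has mean
    zero. *)
Lemma endpoint_ibp f H h K : measurable_fun D f ->
  intg D (fun x => `|f x| * (G x * w x)) ->
  \int[mu]_(x in D) (f x * w x) = 0 ->
  (forall x, a < x < b -> is_derive x 1 H (h x)) ->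
  (forall x, a < x < b -> {for x, continuous h}) ->
  (forall x, a < x < b -> `|h x| <= K * G1 x) ->
  [/\ intg D (fun x => f x * w x * H x), intg D (fun t => wtail f t * h t) &
      \int[mu]_(x in D) (f x * w x * H x) =
        \int[mu]_(t in D) (wtail f t * h t)].
Proof.
move=> mf fi f0 dH ch hK.
pose c := (a + b) / 2.
have acb : a < c < b by have := ab => h1; apply/andP; split; rewrite /c; lra.
have K0 : 0 <= K.
  have h1 := hK c acb; have g0 : 0 < G1 c.
    by move: acb => /andP[ac cb]; apply: addr_gt0; apply: powR_gt0;
      rewrite subr_gt0.
  by rewrite -(pmulr_lge0 _ g0) (le_trans _ h1).
have [C C0 HC] := M_le acb.
have mh : measurable_fun D h by exact: continuous_oo_measurable.
have ifw := intg_weight_of_G mf fi.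
have mfw := intg_measurable ifw.
pose f' := (fun x => f x * w x) \_ D; pose h' := h \_ D.
have f'E x : D x -> f' x = f x * w x by move=> Dx; rewrite /f' patchE mem_set.
have h'E x : D x -> h' x = h x by move=> Dx; rewrite /h' patchE mem_set.
have mf' : measurable_fun setT f' by apply/(measurable_restrictT _ mD).
have mh' : measurable_fun setT h' by apply/(measurable_restrictT _ mD).
pose k (p : RT * RT) : R := f' p.1 *
  ((if (p.2 : R) < p.1 then h' p.2 else 0) -
    (if (p.2 : R) < c then h' p.2 else 0)).
have mk : measurable_fun (D `*` D) k.
  have m1 := @measurable_fst_RR R; have m2 := @measurable_snd_RR R.
  have mh2 : measurable_fun setT (fun p : RT * RT => h' p.2).
    by apply: (measurableT_comp mh'); exact: m2.
  apply: (@measurable_funS _ _ _ _ setT) => //.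
  apply: measurable_funM; first by apply: (measurableT_comp mf'); exact: m1.
  by apply: measurable_funB; apply: measurable_ltr_if.
pose k0 x t := (if t < x then h t else 0) - (if t < c then h t else 0).
have kE x t : D x -> D t -> k (x, t) = f x * w x * k0 x t.
  by move=> Dx Dt; rewrite /k /k0/= f'E// h'E.
have in_ x : D x -> a < x < b by rewrite /= in_itv.
have ig : intg D (fun x => (K * C) * (`|f x| * (G x * w x))) by exact: intgZl.
have kg x : D x -> (\int[mu]_(t in D) `|k (x, t)|%:E <=
  ((K * C) * (`|f x| * (G x * w x)))%:E)%E.
  move=> Dx; have [ik _ I] := kernel_inner acb dH ch hK (in_ x Dx).
  have w0 := weight_ge0 a b beta gam x.
  have -> : (\int[mu]_(t in D) `|k (x, t)|%:E =
    (\int[mu]_(t in D) (`|f x * w x| * `|k0 x t|))%R%:E)%E.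
    rewrite -eintE//; last by apply: intgZl => //; exact: intg_norm.
    by apply: eq_integral => t /set_mem Dt; rewrite kE// normrM.
  rewrite lee_fin intZl//; last exact: intg_norm.
  rewrite [X in X * _]normrM (ger0_norm w0).
  rewrite (_ : K * C * _ = `|f x| * w x * (K * (C * G x))); last by ring.
  apply: ler_wpM2l; first by apply: mulr_ge0.
  apply: (le_trans I); apply: ler_wpM2l => //.
  by apply: HC; exact: in_.
have [_ it ix E] := Rintegral_Fubini mD mD mk ig kg.
clear mk kg ig.
have secx x : D x -> \int[mu]_(t in D) k (x, t) = f x * w x * (H x - H c).
  move=> Dx; have [ik I _] := kernel_inner acb dH ch hK (in_ x Dx).
  by rewrite -I -(intZl _ mD ik); apply: eq_int => t Dt; exact: kE.
have sect t : D t -> \int[mu]_(x in D) k (x, t) = wtail f t * h t.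
  move=> Dt; rewrite -(kernel_outer h c (in_ t Dt) ifw f0).
  by apply: eq_int => x Dx; exact: kE.
have i3 : intg D (fun x => f x * w x * (H x - H c)) by exact: (eq_intg mD secx
  ix).
have HE x : f x * w x * (H x - H c) + H c * (f x * w x) = f x * w x *
  H x by ring.
have HE' x : f x * w x * (H x - H c) = f x * w x * H x - H c *
  (f x * w x) by ring.
have i0 := intgZl (H c) mD ifw.
have i4 := eq_intg mD (fun x _ => HE x) (intgD mD i3 i0).
split; [exact: i4|exact: (eq_intg mD sect it)|].
rewrite -(eq_int sect) -E (eq_int secx) (eq_int (fun x _ => HE' x)).
by rewrite (intB mD i4 i0) (intZl _ mD ifw) f0 mulr0 subr0.
Qed.

End endpoint_ibp.

Section series_tools.
Context {R : realType}.

Lemma dominated_series (u e : nat -> R) k : 0 <= k -> (forall n, 0 <= e n) ->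
  (forall n, `|u n| <= k * e n) -> cvgn (series e) ->
  cvgn (series u) /\
  forall N, `|limn (series u) - series u N| <=
    k * (limn (series e) - series e N).
Proof.
move=> k0 e0 ue ce.
have cu : cvgn (series u).
  apply: normed_cvg; apply: (@series_le_cvg _ _ (fun n => k * e n)) => //.
  - by move=> n; exact: normr_ge0.
  - by move=> n; exact: mulr_ge0.
  - exact: is_cvg_seriesZ ce.
split=> // N.
have ndE : nondecreasing_seq (series e).
  by apply/nondecreasing_seqP => n; rewrite /series/= big_nat_recr//= lerDl.
have cN : `|series u M - series u N| @[M --> \oo] --> `|limn (series u) -
  series u N|.
  by apply: cvg_norm; apply: cvgB; [exact: cu|exact: cvg_cst].
apply: (cvgr_to_le cN); near=> M.
have NM : (N <= M)%N by near: M; exact: nbhs_infty_ge.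
have split_ (v : nat -> R) : series v M - series v N = \sum_(N <= i < M) v i.
  by rewrite /series/= (@big_cat_nat _ _ _ N 0 M)//= addrAC subrr add0r.
rewrite split_; apply: (@le_trans _ _ (k * (series e M - series e N)));
  last first.
  by apply: ler_wpM2l => //; rewrite lerD2r; exact: nondecreasing_cvgn_le.
rewrite split_ mulr_sumr; apply: le_trans (ler_norm_sum _ _ _) _.
exact: ler_sum.
Unshelve. all: by end_near.
Qed.

Lemma poly_antiderivative (q : {poly R}) : exists Q : {poly R}, Q^`() = q.
Proof.
exists (\poly_(i < (size q).+1) (q`_i.-1 / i%:R)); apply/polyP => i.
rewrite coef_deriv coef_poly ltnS; case: ltnP => [iq|qi].
  by rewrite /= -[LHS]mulr_natr divfK// pnatr_eq0.
by rewrite mul0rn nth_default.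
Qed.

End series_tools.

(** * The integrated expansion *)

Section remainder.
Context {R : realType}.
Local Notation mu := (@lebesgue_measure R).
Local Notation RT := (measurableTypeR R).
Implicit Types (f : R -> R) (u v x t : R).
Variables (a b beta gam kap : R).
Hypothesis ab : a < b.
Hypothesis hbeta : - (1 / 2) <= beta <= 1 / 2.
Hypothesis hgam : - (1 / 2) <= gam <= 1 / 2.
Hypothesis hkap : 0 < kap <= 1 / 8.
Local Notation w := (weight a b beta gam).
Local Notation Jp := (jacobi_poly a b beta gam).
Local Notation prim := (jacobi_prim a b beta gam).
Local Notation jcoef := (jcoef a b beta gam).
Local Notation wtail := (wtail a b beta gam).
Local Notation D := (`]a, b[%classic : set RT).
Local Notation sg := ((beta + 1 / 2) / 2 + kap).
Local Notation tu := ((gam + 1 / 2) / 2 + kap).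
Local Notation G := (endpoint_weight a b sg tu).
Local Notation G1 := (endpoint_weight a b (sg + 1) (tu + 1)).

Let hb : - (1 / 2) <= beta. Proof. by case/andP : hbeta. Qed.
Let hg : - (1 / 2) <= gam. Proof. by case/andP : hgam. Qed.
Let mD : measurable D. Proof. exact: mitv. Qed.
Let mw : measurable_fun D w. Proof. exact: measurable_weight. Qed.
Let inD x : D x -> a < x < b. Proof. by rewrite /= in_itv. Qed.

Lemma jacobi_span (q : {poly R}) N : (size q <= N)%N ->
  exists e : nat -> R, q = \sum_(0 <= n < N) e n *: Jp n.
Proof.
elim: N q => [|N IH] q sq.
  by exists (fun=> 0); rewrite big_geq//; apply/eqP; rewrite -size_poly_leq0.
have lN : lead_coef (Jp N) != 0.
  by rewrite lead_coef_eq0 -size_poly_eq0 size_jacobi_poly.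
pose k := q`_N / lead_coef (Jp N).
have [|e eE] := IH (q - k *: Jp N).
  apply/leq_sizeP => i; rewrite leq_eqVlt => /orP[/eqP <-|Ni].
    rewrite coefB coefZ /k lead_coefE size_jacobi_poly//=.
    rewrite lead_coefE size_jacobi_poly//= in lN.
    by rewrite divfK// subrr.
  by rewrite coefB coefZ !nth_default ?mulr0 ?subrr// ?size_jacobi_poly//
    (leq_trans sq).
exists (fun n => if n == N then k else e n).
rewrite big_nat_recr//= eqxx -[LHS](subrK (k *: Jp N)) eE; congr (_ + _).
by apply: eq_big_nat => n /andP[_ nN]; rewrite ltn_eqF.
Qed.

Lemma weight_bounded_derivative (q : {poly R}) :
  exists2 K, 0 <= K & forall x, a < x < b -> `|q.[x]| <= K * G1 x.
Proof.
have [K K0 HK] := horner_bounded_oo q a b.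
have s1 : 0 <= sg + 1 by have := hb; move: hkap => /andP[h1 h2] h3; lra.
exists (K * (b - a) `^ (sg + 1)) => [|x axb]; first by apply: mulr_ge0 => //;
  exact: powR_ge0.
have /andP[ax xb] := axb; apply: (le_trans (HK x axb)).
rewrite -mulrA -[leLHS]mulr1; apply: ler_wpM2l => //.
apply: (@le_trans _ _ ((b - a) `^ (sg + 1) * (x - a) `^ (- (sg + 1)))).
  have X0 : 0 < (x - a) `^ (sg + 1) by rewrite powR_gt0// subr_gt0.
  rewrite (powRN _ (sg + 1)) (ler_pdivlMr _ _ X0) [leLHS]mul1r.
  by apply: powR_homo_le; lra.
by apply: ler_wpM2l; [exact: powR_ge0|rewrite lerDl; exact: powR_ge0].
Qed.

Lemma wtail_jacobi n t : a < t < b -> (0 < n)%N -> wtail (horner (Jp n)) t =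
  - prim n t.
Proof.
move=> /andP[at_ tb] n0; have [dP _] := jacobi_prim_system ab hbeta hgam n0.
have tab x : t < x < b -> a < x < b by move=> /andP[tx ->];
  rewrite (lt_trans at_).
have iw := intg_weight_poly ab hb hg (Jp n).
have it : intg `]t, b[ (fun x => w x * (Jp n).[x]).
  apply: (intgS mD (mitv _) _ iw) => x; rewrite /= !in_itv/=; exact: tab.
have cf x : t < x < b -> {for x, continuous (fun x => w x * (Jp n).[x])}.
  move=> /tab/andP[ax xb]; apply: continuousM; last exact: continuous_horner.
  by apply: continuousM; [exact: continuous_powR_subl|exact:
    continuous_powR_subr].
have Pt : prim n x @[x --> t^'+] --> prim n t.
  by apply: cvg_at_right_filter; apply: (is_derive_continuous (dP t _));
    rewrite at_.
rewrite /wtail (@eq_int _ _ _ (fun x => w x * (Jp n).[x])); last by move=> x _;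
  exact: mulrC.
rewrite (FTC_oo tb (fun x hx => dP x (tab x hx)) cf it Pt
  (jacobi_prim_right beta ab hgam n)).
by rewrite sub0r.
Qed.

Variable f : R -> R.
Hypothesis mf : measurable_fun D f.
Hypothesis fi : intg D (fun x => `|f x| * (G x * w x)).
Hypothesis fJ : forall n, intg D (fun x => f x * ((Jp n).[x] * w x)).
Hypothesis fs : cvgn (series (fun n => `|jcoef f n| * n%:R `^ (-1 + 4 * kap))).

Definition jrem N x := f x - \sum_(0 <= n < N) jcoef f n * (Jp n).[x].

Lemma jrem_poly N : exists q : {poly R}, forall x, jrem N x = f x - q.[x].
Proof.
exists (\sum_(0 <= n < N) jcoef f n *: Jp n) => x; rewrite /jrem; congr (_ - _).
by rewrite horner_sum; apply: eq_bigr => n _; rewrite hornerZ.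
Qed.

Lemma measurable_jrem N : measurable_fun D (jrem N).
Proof.
have [q qE] := jrem_poly N; rewrite (_ : jrem N = fun x => f x - q.[x]);
  last exact/funext.
by apply: measurable_funB => //; exact: measurable_horner.
Qed.

Lemma intg_jrem_G N : intg D (fun x => `|jrem N x| * (G x * w x)).
Proof.
have [q qE] := jrem_poly N; have [K K0 HK] := horner_bounded_oo q a b.
have Gw0 x : 0 <= G x * w x.
  by apply: mulr_ge0; [exact: endpoint_weight_ge0|exact: weight_ge0].
apply: (@intg_le _ _ _ (fun x => `|f x| * (G x * w x) + K * (G x * w x))) => //.
- apply: measurable_funM; first by apply: measurableT_comp => //;
    exact: measurable_jrem.
  by apply: measurable_funM => //; exact: measurable_endpoint_weight.
- move=> x /inD axb; rewrite normrM normr_id (ger0_norm (Gw0 x)) -mulrDl.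
  apply: ler_wpM2r => //; rewrite qE; apply: le_trans (ler_normB _ _) _.
  by rewrite lerD2l; exact: HK.
- by apply: intgD => //; apply: intgZl => //; exact: intg_G.
Qed.

Let intg_wJJ n m : intg D (fun x => w x * (Jp n).[x] * (Jp m).[x]).
Proof.
apply: (eq_intg _ _ (intg_weight_poly ab hb hg (Jp n * Jp m))) => // x _.
by rewrite hornerM mulrA.
Qed.

Lemma intg_jrem_poly N (q : {poly R}) : intg D (fun x => jrem N x * w x *
  q.[x]).
Proof.
have [K K0 HK] := horner_bounded_oo q a b.
have i1 := intg_weight_of_G ab hbeta hgam hkap (measurable_jrem N)
  (intg_jrem_G N).
apply: (@intg_le _ _ _ (fun x => K * `|jrem N x * w x|)) => //.
- apply: measurable_funM; last exact: measurable_horner.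
  by apply: measurable_funM => //; exact: measurable_jrem.
- move=> x /inD axb; rewrite normrM mulrC; apply: ler_wpM2r => //; exact: HK.
- by apply: intgZl => //; exact: intg_norm.
Qed.

Lemma jrem_orth N (q : {poly R}) : (size q <= N)%N ->
  \int[mu]_(x in D) (jrem N x * w x * q.[x]) = 0.
Proof.
move=> /jacobi_span[e ->].
have i2 n : intg D (fun x => jrem N x * w x * (Jp n).[x])
  by exact: intg_jrem_poly.
rewrite (@eq_int _ _ _ (fun x => \sum_(0 <= n < N) e n *
  (jrem N x * w x * (Jp n).[x]))); last first.
  move=> x _; rewrite horner_sum mulr_sumr; apply: eq_bigr => n _.
  by rewrite hornerZ mulrCA.
rewrite Rintegral_sum//; last by move=> n _; exact: intgZl.
rewrite big_nat_cond big1// => n /andP[/andP[_ nN] _]; rewrite intZl//.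
rewrite (@eq_int _ _ _ (fun x => f x * ((Jp n).[x] * w x) -
    \sum_(0 <= m < N) jcoef f m * (w x * (Jp n).[x] * (Jp m).[x]))); last first.
  move=> x _; rewrite /jrem -mulrA mulrBl mulr_suml; congr (_ - _);
    first by rewrite (mulrC (w x)).
  by apply: eq_bigr => m _; rewrite -(mulrA (jcoef f m)) (mulrC (Jp m).[x]).
rewrite intB//; last by apply: intg_sum => // m _; exact: intgZl.
rewrite Rintegral_sum//; last by move=> m _; exact: intgZl.
under [X in _ - X]eq_bigr =>
  m _ do rewrite intZl// (jacobi_orthonormal ab hb hg).
by rewrite sum_delta// subrr mulr0.
Qed.

Lemma jrem_mean0 N : (0 < N)%N -> \int[mu]_(x in D) (jrem N x * w x) = 0.
Proof.
move=> N0; rewrite -[RHS](@jrem_orth N 1); last by rewrite size_poly1.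
by apply: eq_int => x _; rewrite hornerC mulr1.
Qed.

(** The base case is [jrem 1], since p_0 w has nonzero mean and no primitive vanishing at both ends;
    once the p_0 term is subtracted, every further term changes the tail integral by a multiple of a
    primitive. *)
Lemma wtail_jrem N t : a < t < b -> (0 < N)%N ->
  wtail (jrem N) t = wtail (jrem 1) t + series (fun n => jcoef f n * prim n t)
    N.
Proof.
move=> atb; have /andP[at_ tb] := atb; case: N => // N _.
have mT : measurable (`]t, b[%classic : set RT) by exact: mitv.
have TD : (`]t, b[%classic : set RT) `<=` D.
  by move=> x; rewrite /= !in_itv/= => /andP[tx ->]; rewrite (lt_trans at_).
have iN N' : intg `]t, b[ (fun x => jrem N' x * w x).
  apply: (intgS mD mT TD).
  exact: (intg_weight_of_G ab hbeta hgam hkap (measurable_jrem N')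
    (intg_jrem_G N')).
(* The eigenvalue of degree 0 is 0 and division by 0 has the value 0, so the term n = 0 of the
   series is zero. *)
have prim0 : prim 0 t = 0 by rewrite /jacobi_prim /jacobi_lam mul0r invr0 mulr0.
elim: N => [|N IH]; first by rewrite /series/= big_nat1 prim0 mulr0 addr0.
rewrite [series _ _]/series/= big_nat_recr//= addrA -[X in _ = X + _]IH.
have ij : intg `]t, b[ (fun x => (Jp N.+1).[x] * w x).
  apply: (intgS mD mT TD); apply: (eq_intg _ _ (intg_weight_poly ab hb hg
    (Jp N.+1))) => //.
  by move=> x _; exact: mulrC.
rewrite /wtail (@eq_int _ _ _ (fun x => jrem N.+1 x * w x - jcoef f N.+1 *
  ((Jp N.+1).[x] * w x))).
  rewrite intB//; last exact: intgZl.
  by rewrite intZl// -/(wtail _ _) -/(wtail (horner (Jp N.+1)) t) wtail_jacobi//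
    mulrN opprK.
by move=> x _; rewrite /jrem big_nat_recr//=; ring.
Qed.


Let coef_weight n := `|jcoef f n| * n%:R `^ (-1 + 4 * kap).

Definition jtail N := limn (series coef_weight) - series coef_weight N.

Lemma jtail_cvg0 : jtail N @[N --> \oo] --> 0.
Proof.
rewrite -(subrr (limn (series coef_weight))).
by apply: cvgB; [exact: cvg_cst|exact: fs].
Qed.

Let coef_weight_ge0 n : 0 <= coef_weight n.
Proof. by apply: mulr_ge0; [exact: normr_ge0|exact: powR_ge0]. Qed.

Lemma jtail_ge0 N : 0 <= jtail N.
Proof.
rewrite subr_ge0; apply: nondecreasing_cvgn_le fs N.
apply/nondecreasing_seqP => n; rewrite /series/= big_nat_recr//= lerDl.
exact: coef_weight_ge0.
Qed.

Let prim_series t := limn (series (fun n => jcoef f n * prim n t)).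

Let prim_series_spec : exists2 K, 0 <= K & forall t, a < t < b ->
  series (fun n => jcoef f n * prim n t) N @[N --> \oo] --> prim_series t /\
  forall N, `|prim_series t - series (fun n => jcoef f n * prim n t) N| <=
     K * (t - a) `^ ((beta + 1 / 2) / 2 + 2 * kap) * jtail N /\
   `|prim_series t - series (fun n => jcoef f n * prim n t) N| <=
     K * (b - t) `^ ((gam + 1 / 2) / 2 + 2 * kap) * jtail N.
Proof.
have [K K0 HK] := jacobi_bounds ab hbeta hgam hkap; have K0' := ltW K0.
exists K => // t tab.
have cw0 n : jcoef f n * prim 0 t = 0 by rewrite /jacobi_prim /jacobi_lam mul0r
  invr0 !mulr0.
have l0 : 0 <= K * (t - a) `^ ((beta + 1 / 2) / 2 + 2 * kap) by apply: mulr_ge0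
  => //; exact: powR_ge0.
have r0 : 0 <= K * (b - t) `^ ((gam + 1 / 2) / 2 + 2 * kap) by apply: mulr_ge0
  => //; exact: powR_ge0.
have H1 n : `|jcoef f n * prim n t| <= K * (t - a) `^ ((beta + 1 / 2) / 2 + 2 *
  kap) * coef_weight n.
  have [->|n0] := posnP n; first by rewrite cw0 normr0; exact: mulr_ge0.
  have [_ /(_ n0)[h _]] := HK n t tab; rewrite normrM /coef_weight mulrCA.
  by apply: ler_wpM2l => //; rewrite mulrAC.
have H2 n : `|jcoef f n * prim n t| <= K * (b - t) `^ ((gam + 1 / 2) / 2 + 2 *
  kap) * coef_weight n.
  have [->|n0] := posnP n; first by rewrite cw0 normr0; exact: mulr_ge0.
  have [_ /(_ n0)[_ h]] := HK n t tab; rewrite normrM /coef_weight mulrCA.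
  by apply: ler_wpM2l => //; rewrite mulrAC.
have [c1 B1] := dominated_series l0 coef_weight_ge0 H1 fs.
have [_ B2] := dominated_series r0 coef_weight_ge0 H2 fs.
by split.
Qed.

Let measurable_prim n : measurable_fun D (prim n).
Proof.
case: n => [|n].
  rewrite (_ : prim 0 = cst 0); first exact: measurable_cst.
  by apply/funext => t; rewrite /jacobi_prim /jacobi_lam mul0r invr0 mulr0.
apply: continuous_oo_measurable => x axb.
have [dP _] := jacobi_prim_system ab hbeta hgam (ltn0Sn n).
exact: is_derive_continuous (dP x axb).
Qed.

Let measurable_partial N : measurable_fun D (fun t =>
  series (fun n => jcoef f n * prim n t) N).
Proof. by apply: measurable_sum => n; apply: measurable_funM. Qed.

Let measurable_prim_series : measurable_fun D prim_series.
Proof.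
have [K K0 HK] := prim_series_spec.
apply: (measurable_fun_cvg measurable_partial) => t /inD tab.
by have [c _] := HK t tab.
Qed.

(** By [endpoint_ibp] the integral equals the pairing of the remainder with Q, which vanishes once
    the degree of Q is below N. *)
Lemma jrem_derivative_pairing N (q Q : {poly R}) : (0 < N)%N -> Q^`() = q ->
  intg D (fun t => wtail (jrem N) t * q.[t]) /\
  ((size Q <= N)%N -> \int[mu]_(t in D) (wtail (jrem N) t * q.[t]) = 0).
Proof.
move=> N0 Qq; have [K K0 HK] := weight_bounded_derivative q.
have dQ x : a < x < b -> is_derive x 1 (horner Q) q.[x].
  by move=> _; rewrite -Qq; exact: is_derive_poly.
have cq x : a < x < b -> {for x, continuous (horner q)}.
  by move=> _; exact: continuous_horner.
have [_ i E] := endpoint_ibp ab hbeta hgam hkap (measurable_jrem N)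
  (intg_jrem_G N)
  (jrem_mean0 N0) dQ cq HK.
by split => // sQ; rewrite -E jrem_orth.
Qed.

(* The left-hand side is a limit of tail integrals of the remainders, which
   are orthogonal to polynomials of growing degree. *)
Lemma wtail_series : {ae mu, forall t, a < t < b -> wtail (jrem 1) t +
  prim_series t = 0}.
Proof.
have [K K0 HK] := prim_series_spec.
have [K1 K10 HK1] : exists2 K1, 0 <= K1 & forall t N, a < t < b ->
    `|prim_series t - series (fun n => jcoef f n * prim n t) N| <= K1 * jtail N.
  exists (K * (b - a) `^ ((beta + 1 / 2) / 2 + 2 * kap)).
    by apply: mulr_ge0 => //; exact: powR_ge0.
  move=> t N tab; have [_ /(_ N)[h _]] := HK t tab; apply: (le_trans h).
  apply: ler_wpM2r; first exact: jtail_ge0.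
  apply: ler_wpM2l => //; move: tab => /andP[at_ tb].
  by apply: powR_homo_le; have := hb; move: hkap => /andP[? ?] ?; lra.
have iS : intg D prim_series.
  apply: (@intg_bounded _ _ _ (K1 * jtail 0)) => //.
    by rewrite lebesgue_oo// ltry.
  move=> t /inD tab; have := HK1 t 0%N tab.
  by rewrite /series/= big_geq// subr0.
have iW : intg D (fun t => wtail (jrem 1) t).
  have [|i _] := @jrem_derivative_pairing 1 1 'X (ltn0Sn _);
    first by rewrite derivX.
  by apply: (eq_intg _ _ i) => // t _; rewrite hornerC mulr1.
have iF : intg D (fun t => wtail (jrem 1) t + prim_series t) by exact: intgD.
apply: moments_zero_ae => // q.
have [Q Qq] := poly_antiderivative q; have [K2 K20 HK2] :=
  horner_bounded_oo q a b.
have iq N : intg D (fun t =>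
  (prim_series t - series (fun n => jcoef f n * prim n t) N) * q.[t]) /\
    `|\int[mu]_(t in D) ((prim_series t - series (fun n => jcoef f n * prim n t)
      N) * q.[t])|
      <= K1 * K2 * (b - a) * jtail N.
  have mi : measurable_fun D (fun t =>
    (prim_series t - series (fun n => jcoef f n * prim n t) N) * q.[t]).
    apply: measurable_funM; last exact: measurable_horner.
    by apply: measurable_funB;
      [exact: measurable_prim_series|exact: measurable_partial].
  have bi t : D t -> `|(prim_series t - series (fun n => jcoef f n * prim n t)
    N) * q.[t]| <=
      K1 * jtail N * K2.
    by move=> /inD tab; rewrite normrM; apply: ler_pM => //;
      [exact: HK1|exact: HK2].
  have fD : (mu D < +oo)%E by rewrite lebesgue_oo// ltry.
  have ic : intg D (cst (K1 * jtail N * K2)).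
    apply: (@intg_bounded _ _ _ `|K1 * jtail N * K2|) => //.
  split; first exact: (intg_bounded mD fD mi bi).
  apply: (le_trans (norm_Rintegral_le mD mi bi ic)).
  rewrite int_cst_oo//; move: (jtail N) => d.
  by rewrite (_ : K1 * d * K2 * (b - a) = K1 * K2 * (b - a) * d) ?lexx//; ring.
(* The function tested is the tail integral of the N-th remainder plus the tail of the series. The
   first is orthogonal to q for large N, and the second is uniformly small. *)
have IE N : (0 < N)%N -> (size Q <= N)%N ->
    `|\int[mu]_(t in D) ((wtail (jrem 1) t + prim_series t) * q.[t])| <=
      K1 * K2 * (b - a) * jtail N.
  move=> N0 sQ; have [i1 /(_ sQ) E1] := jrem_derivative_pairing N0 Qq.
  have [i2 B2] := iq N.
  rewrite (@eq_int _ _ _ (fun t => wtail (jrem N) t * q.[t] +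
     (prim_series t - series (fun n => jcoef f n * prim n t) N) * q.[t]));
       last first.
    by move=> t /inD tab; rewrite (wtail_jrem tab N0); ring.
  by rewrite intD// E1 add0r.
have c0 : K1 * K2 * (b - a) * jtail N @[N --> \oo] --> 0.
  rewrite -(mulr0 (K1 * K2 * (b - a))); apply: cvgM; first exact: cvg_cst.
  exact: jtail_cvg0.
apply/eqP; rewrite -normr_le0; apply: (cvgr_to_ge c0); near=> N.
apply: IE; near: N; [exact: nbhs_infty_gt|exact: nbhs_infty_ge].
Unshelve. all: by end_near.
Qed.

(** After the integration by parts, [wtail_series] replaces the tail integral of the remainder by a
    tail of the absolutely convergent integrated series. The constant is uniform in N and in H, and
    the dependence on h is only through K: this allows averaging over a family of functions H. *)
Lemma jrem_pairing : exists2 C, 0 <= C & forall N H h K, (0 < N)%N ->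
  (forall x, a < x < b -> is_derive x 1 H (h x)) ->
  (forall x, a < x < b -> {for x, continuous h}) ->
  (forall x, a < x < b -> `|h x| <= K * G1 x) ->
  intg D (fun x => jrem N x * w x * H x) /\
  `|\int[mu]_(x in D) (jrem N x * w x * H x)| <= K * (C * jtail N).
Proof.
have [M M0 HM] := prim_series_spec; have /andP[k0 k1] := hkap.
have kap1 : -1 < kap - 1 by lra.
have i1 : intg D (fun t => (t - a) `^ (kap - 1)) by exact: intg_powR_subl.
have i2 : intg D (fun t => (b - t) `^ (kap - 1)) by exact: intg_powR_subr.
set E := \int[mu]_(t in D) ((t - a) `^ (kap - 1) + (b - t) `^ (kap - 1)).
have E0 : 0 <= E by apply: Rintegral_ge0 => t _; apply: addr_ge0;
  exact: powR_ge0.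
exists (M * E) => [|N H h K N0 dH ch hK]; first exact: mulr_ge0.
have [iH iT ET] := endpoint_ibp ab hbeta hgam hkap (measurable_jrem N)
  (intg_jrem_G N)
  (jrem_mean0 N0) dH ch hK.
split => //; rewrite ET.
have K0 : 0 <= K.
  pose c := (a + b) / 2.
  have acb : a < c < b by have := ab => h1; apply/andP; split; rewrite /c; lra.
  have h1 := hK c acb; have g0 : 0 < G1 c.
    by move: acb => /andP[ac cb]; apply: addr_gt0; apply: powR_gt0;
      rewrite subr_gt0.
  by rewrite -(pmulr_lge0 _ g0) (le_trans _ h1).
pose g t := (series (fun n => jcoef f n * prim n t) N - prim_series t) * h t.
have mg : measurable_fun D g.
  apply: measurable_funM; last exact: continuous_oo_measurable.
  by apply: measurable_funB;
    [exact: measurable_partial|exact: measurable_prim_series].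
have -> : \int[mu]_(t in D) (wtail (jrem N) t * h t) = \int[mu]_(t in D) g t.
  rewrite /Rintegral; congr fine; apply: ae_eq_integral => //.
  - by case/integrableP : iT.
  - exact/measurable_EFinP.
  - apply: filterS wtail_series; first exact: (ae_filter_ringOfSetsType mu).
    move=> t Ht /inD tab; congr EFin.
    rewrite /g (wtail_jrem tab N0); congr (_ * _).
    have -> : wtail (jrem 1) t = - prim_series t by apply/eqP;
      rewrite -addr_eq0 Ht.
    exact: addrC.
have T0 := jtail_ge0 N.
have ic : intg D (fun t => K * M * jtail N * ((t - a) `^ (kap - 1) +
  (b - t) `^ (kap - 1))).
  by apply: intgZl => //; exact: intgD.
apply: (le_trans (norm_Rintegral_le mD mg _ ic)); last first.
  rewrite intZl//; last exact: intgD.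
  by rewrite -/E (_ : K * M * _ * E = K * (M * E * jtail N)); last by ring.
move=> t /inD tab; have [_ /(_ N)[h1 h2]] := HM t tab.
rewrite /g normrM distrC; set d := `|_ - _| in h1 h2 *.
apply: (@le_trans _ _ (d * (K * G1 t))); first by apply: ler_wpM2l;
  [exact: normr_ge0|exact: hK].
have /andP[at_ tb] := tab.
have X0 : 0 < t - a by rewrite subr_gt0.
have Y0 : 0 < b - t by rewrite subr_gt0.
(* The primitives vanish with the extra exponent 2 kap and the weight costs kap beyond the critical
   exponent; the remaining exponent kap - 1 is integrable. *)
have e1 : (t - a) `^ (kap - 1) = (t - a) `^ ((beta + 1 / 2) / 2 + 2 * kap) *
  (t - a) `^ (- (sg + 1)).
  by rewrite -powR_addl//; congr (_ `^ _); ring.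
have e2 : (b - t) `^ (kap - 1) = (b - t) `^ ((gam + 1 / 2) / 2 + 2 * kap) *
  (b - t) `^ (- (tu + 1)).
  by rewrite -powR_addl//; congr (_ `^ _); ring.
move: (jtail N) h1 h2 => J h1 h2.
rewrite e1 e2 /endpoint_weight !mulrDr.
have p1 := powR_ge0 (t - a) (- (sg + 1));
  have p2 := powR_ge0 (b - t) (- (tu + 1)).
move: p1 p2 h1 h2.
set u := _ `^ (- (sg + 1)); set v := _ `^ (- (tu + 1)); set u' := _ `^ _;
  set v' := (b - t) `^ _.
move=> p1 p2 h1 h2; apply: lerD.
- rewrite (_ : d * (K * u) = K * u * d); last by ring.
  rewrite (_ : _ * (u' * u) = K * u * (M * u' * J)); last by ring.
  by apply: ler_wpM2l => //; exact: mulr_ge0.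
- rewrite (_ : d * (K * v) = K * v * d); last by ring.
  rewrite (_ : _ * (v' * v) = K * v * (M * v' * J)); last by ring.
  by apply: ler_wpM2l => //; exact: mulr_ge0.
Qed.

End remainder.

(** * The Riemann-Liouville integral *)

Section rl_tools.
Context {R : realType}.
Local Notation mu := (@lebesgue_measure R).
Local Notation RT := (measurableTypeR R).

(** If f is not integrable, at least one of the integrals of its positive and negative parts is
    infinite; their difference is infinite as well, and [fine] sends it to 0. *)
Lemma Rintegral_not_intg (D : set RT) (f : R -> R) : measurable D ->
  measurable_fun D f -> ~ intg D f -> \int[mu]_(x in D) f x = 0.
Proof.
move=> mD mf nf; rewrite /Rintegral integralE.
have mef : measurable_fun D (EFin \o f) by exact/measurable_EFinP.
have mp := measurable_funepos mef; have mn := measurable_funeneg mef.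
have p0 : (0 <= \int[mu]_(x in D) (EFin \o f)^\+ x)%E.
  by apply: integral_ge0 => x _; exact: funepos_ge0.
have n0 : (0 <= \int[mu]_(x in D) (EFin \o f)^\- x)%E.
  by apply: integral_ge0 => x _; exact: funeneg_ge0.
have E : (\int[mu]_(x in D) `|(EFin \o f) x| =
    \int[mu]_(x in D) (EFin \o f)^\+ x + \int[mu]_(x in D) (EFin \o f)^\- x)%E.
  rewrite -ge0_integralD//.
  by apply: eq_integral => x _; rewrite -[LHS]/((abse \o (EFin \o f)) x)
    fune_abse.
have : ~ (\int[mu]_(x in D) `|(EFin \o f) x| < +oo)%E.
  by move=> h; apply: nf; apply/integrableP.
rewrite {}E; move: p0 n0.
case: (\int[mu]_(x in D) _)%E => [r| |]; case: (\int[mu]_(x in D) _)%E =>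
  [s| |] //=.
by move=> _ _; rewrite ltry.
Qed.

(** Without integrability both sides take the default value 0. This is convenient for inner
    integrals, where it spares a proof that every section is integrable. *)
Lemma intZl_measurable (D : set RT) k (f : R -> R) : measurable D ->
  measurable_fun D f ->
  \int[mu]_(x in D) (k * f x) = k * \int[mu]_(x in D) f x.
Proof.
move=> mD mf; have [fi|nf] := pselect (intg D f); first exact: intZl.
rewrite (Rintegral_not_intg mD mf nf) mulr0.
have [->|k0] := eqVneq k 0.
  by rewrite (@eq_int _ _ _ (cst 0)) ?[LHS]/Rintegral ?integral0// => x _;
    rewrite mul0r.
apply: Rintegral_not_intg => //; first exact: measurable_funM.
move=> fi; apply: nf; apply: (eq_intg _ _ (intgZl k^-1 mD fi)) => // x _.
by rewrite mulKf.
Qed.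

Lemma powR_neg_le (z L r s : R) : 0 < z -> z <= L -> r <= s ->
  z `^ (- r) <= L `^ (s - r) * z `^ (- s).
Proof.
move=> z0 zL rs.
have -> : z `^ (- r) = z `^ (s - r) * z `^ (- s).
  by rewrite -powR_addl//; congr (_ `^ _); ring.
apply: ler_wpM2r; first exact: powR_ge0.
by apply: powR_homo_le; [rewrite subr_ge0|exact: ltW|].
Qed.

Lemma measurable_horner_comp d (T : measurableType d) (D : set T) (g : T -> RT)
    (q : {poly R}) : measurable_fun D g -> measurable_fun D (fun z => q.[g z]).
Proof.
have mq := @measurable_horner R q setT.
by move=> mg; apply: (measurableT_comp mq).
Qed.

End rl_tools.

(** * The adjoint kernel of the fractional integral *)

Section riemann_liouville.
Context {R : realType}.
Local Notation mu := (@lebesgue_measure R).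
Local Notation RT := (measurableTypeR R).
Implicit Types (f : R -> R) (u v x t s : R).
Variables (a b alpha beta gam kap : R).
Hypothesis ab : a < b.
Hypothesis halpha : 0 < alpha < 1.
Hypothesis hbeta : - (1 / 2) <= beta <= 1 / 2.
Hypothesis hgam : - (1 / 2) <= gam <= 1 / 2.
Hypothesis hkap : 0 < kap <= 1 / 8.
Local Notation w := (weight a b beta gam).
Local Notation D := (`]a, b[%classic : set RT).
Local Notation I01 := (`]0, 1[%classic : set RT).
Local Notation sg := ((beta + 1 / 2) / 2 + kap).
Local Notation tu := ((gam + 1 / 2) / 2 + kap).
Local Notation G := (endpoint_weight a b sg tu).
Local Notation G1 := (endpoint_weight a b (sg + 1) (tu + 1)).

Let hb : - (1 / 2) <= beta. Proof. by case/andP : hbeta. Qed.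
Let hg : - (1 / 2) <= gam. Proof. by case/andP : hgam. Qed.
Let al0 : 0 < alpha. Proof. by case/andP : halpha. Qed.
Let L0 : 0 < b - a. Proof. by rewrite subr_gt0. Qed.
Let mD : measurable D. Proof. exact: mitv. Qed.
Let mI : measurable I01. Proof. exact: mitv. Qed.
Let mw : measurable_fun D w. Proof. exact: measurable_weight. Qed.
Let inD x : D x -> a < x < b. Proof. by rewrite /= in_itv. Qed.

Section fixed_polynomial.
Variable q : {poly R}.

Let node s t := t + (b - t) * s.
(* With x = t + (b - t) s, the integral of (x - t)^(alpha - 1) q(x) w(x) over
   t < x < b is w(t) times the integral over 0 < s < 1 of the kernel below
   against rl_section s t, an elementary function of t for each s. *)
Definition rl_unit_kernel s : R := s `^ (alpha - 1) * (1 - s) `^ gam.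
Let ratio s t := (t - a) `^ (- beta) * (node s t - a) `^ beta.
Definition rl_section s t := (b - t) `^ alpha * ratio s t * q.[node s t].

Let dsection s t :=
  - (alpha * (b - t) `^ (alpha - 1)) * (ratio s t * q.[node s t]) +
  (b - t) `^ alpha * (ratio s t *
    (beta * ((1 - s) * (node s t - a) `^ (-1) - (t - a) `^ (-1)))) *
    q.[node s t] +
  (b - t) `^ alpha * ratio s t * (q^`().[node s t] * (1 - s)).

Let node_bounds s t : 0 < s < 1 -> a < t < b -> t <= node s t < b.
Proof.
move=> /andP[s0 s1] /andP[at_ tb]; have Y0 : 0 < b - t by rewrite subr_gt0.
apply/andP; split; first by rewrite /node lerDl; apply: mulr_ge0; exact: ltW.
by rewrite /node -ltrBDl -[ltRHS]mulr1 ltr_pM2l.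
Qed.

Let dnode s t : is_derive t 1 (node s) (1 - s).
Proof.
rewrite (_ : node s = fun t => (1 - s) * t + b * s); last first.
  by apply/funext => z; rewrite /node; ring.
apply: (is_derive_eq (is_deriveD (is_deriveZ (1 - s) (is_derive_id t (1 : R)))
  (is_derive_cst (b * s) t 1))).
by rewrite addr0 /GRing.scale/= mulr1.
Qed.

Let dnode_pow s t e : 0 < s < 1 -> a < t < b ->
  is_derive t 1 (fun t => (node s t - a) `^ e) (e * (node s t - a) `^ (e - 1) *
    (1 - s)).
Proof.
move=> hs ht; have /andP[h1 _] := node_bounds hs ht; have /andP[at_ _] := ht.
have hn : a < node s t by exact: lt_le_trans h1.
exact: (@is_derive1_comp R (fun y => (y - a) `^ e) (node s) t _ _
  (is_derive_powR_subl e hn) (dnode s t)).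
Qed.

Let dnode_poly (r : {poly R}) s t :
  is_derive t 1 (fun t => r.[node s t]) (r^`().[node s t] * (1 - s)).
Proof.
exact: (@is_derive1_comp R (horner r) (node s) t _ _
  (is_derive_poly r (node s t)) (dnode s t)).
Qed.

Lemma rl_section_derive s t : 0 < s < 1 -> a < t < b ->
  is_derive t 1 (rl_section s) (dsection s t).
Proof.
move=> hs ht; have /andP[at_ tb] := ht; have /andP[h1 h2] := node_bounds hs ht.
have T0 : 0 < t - a by rewrite subr_gt0.
have U0 : 0 < node s t - a by rewrite subr_gt0 (lt_le_trans at_).
have dR := is_deriveM (is_derive_powR_subl (- beta) at_) (dnode_pow beta hs ht).
apply: (is_derive_eq (is_deriveM (is_deriveM (is_derive_powR_subr alpha tb) dR)
  (dnode_poly q s t))).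
transitivity ((b - t) `^ alpha * ratio s t * (q^`().[node s t] * (1 - s)) +
  q.[node s t] * ((b - t) `^ alpha *
    ((t - a) `^ (- beta) * (beta * (node s t - a) `^ (beta - 1) * (1 - s)) +
     (node s t - a) `^ beta * (- beta * (t - a) `^ (- beta - 1))) +
   ratio s t * - (alpha * (b - t) `^ (alpha - 1)))); first by [].
rewrite (powR_addl beta (-1) U0) (powR_addl (- beta) (-1) T0) /dsection /ratio.
ring.
Qed.

Lemma rl_section_derive_continuous s t : 0 < s < 1 -> a < t < b ->
  {for t, continuous (dsection s)}.
Proof.
move=> hs ht; have /andP[at_ tb] := ht.
have cn e : {for t, continuous (fun t => (node s t - a) `^ e)}.
  exact: is_derive_continuous (dnode_pow e hs ht).
have cq (r : {poly R}) : {for t, continuous (fun t => r.[node s t])}.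
  exact: is_derive_continuous (dnode_poly r s t).
have cT e : {for t, continuous (fun t => (t - a) `^ e)}
  by exact: continuous_powR_subl.
have cY e : {for t, continuous (fun t => (b - t) `^ e)}
  by exact: continuous_powR_subr.
have cr : {for t, continuous (ratio s)} by exact: continuousM.
apply: continuousD; [apply: continuousD|].
- apply: continuousM; last exact: continuousM.
  by apply: continuousN; apply: continuousM; [exact: cvg_cst|exact: cY].
- apply: continuousM => //; apply: continuousM => //; apply: continuousM => //.
  apply: continuousM; first exact: cvg_cst.
  by apply: continuousB => //; apply: continuousM; [exact: cvg_cst|exact: cn].
- apply: continuousM; first exact: continuousM.
  by apply: continuousM; [exact: cq|exact: cvg_cst].
Qed.

Let ratio_le s t : 0 < s < 1 -> a < t < b ->
  0 <= ratio s t <= 1 + (b - a) `^ beta * (t - a) `^ (- beta).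
Proof.
move=> hs ht; have /andP[h1 h2] := node_bounds hs ht; have /andP[at_ tb] := ht.
have T0 : 0 < t - a by rewrite subr_gt0.
have r0 : 0 <= ratio s t by apply: mulr_ge0; exact: powR_ge0.
rewrite r0 /ratio (_ : 1 + _ = (t - a) `^ (- beta) *
  ((t - a) `^ beta + (b - a) `^ beta)).
  apply: ler_wpM2l; first exact: powR_ge0.
  by apply: powR_leD => //; apply/andP; split; lra.
rewrite mulrDr -powR_addl// addNr powRr0; congr (_ + _); exact: mulrC.
Qed.

(** Domination by a multiple of [G1]. The closure properties below carry the constants, so that the
    derivative can be estimated term by term. *)
Let bnd (g : R -> R) := exists2 C, 0 <= C & forall t, a < t < b -> g t <=
  C * G1 t.

Let bndD g h : bnd g -> bnd h -> bnd (fun t => g t + h t).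
Proof.
move=> [C C0 HC] [E E0 HE]; exists (C + E) => [|t ht]; first exact: addr_ge0.
by rewrite mulrDl; apply: lerD; [exact: HC|exact: HE].
Qed.

Let bndZ k g : 0 <= k -> bnd g -> bnd (fun t => k * g t).
Proof.
move=> k0 [C C0 HC]; exists (k * C) => [|t ht]; first exact: mulr_ge0.
by rewrite -mulrA; apply: ler_wpM2l => //; exact: HC.
Qed.

Let bndT r : r <= sg + 1 -> bnd (fun t => (t - a) `^ (- r)).
Proof.
move=> h; exists ((b - a) `^ (sg + 1 - r)) => [|t /andP[at_ tb]];
  first exact: powR_ge0.
have h1 := @powR_neg_le R (t - a) (b - a) r (sg + 1) ltac:(lra) ltac:(lra) h.
apply: (le_trans h1); apply: ler_wpM2l; first exact: powR_ge0.
by rewrite lerDl; exact: powR_ge0.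
Qed.

Let bndY r : r <= tu + 1 -> bnd (fun t => (b - t) `^ (- r)).
Proof.
move=> h; exists ((b - a) `^ (tu + 1 - r)) => [|t /andP[at_ tb]];
  first exact: powR_ge0.
have h1 := @powR_neg_le R (b - t) (b - a) r (tu + 1) ltac:(lra) ltac:(lra) h.
apply: (le_trans h1); apply: ler_wpM2l; first exact: powR_ge0.
by rewrite lerDr; exact: powR_ge0.
Qed.

Let bnd_le g h : (forall t, a < t < b -> g t <= h t) -> bnd h -> bnd g.
Proof.
by move=> gh [C C0 HC]; exists C => // t ht; apply: le_trans (HC t ht);
  exact: gh.
Qed.

(** The worst singularities are (b - t)^(alpha - 1) at the right end and (t - a)^(- beta - 1) at the
    left end. Both are weaker than those of [G1]: alpha > 0 settles the first, and beta <= (beta +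
    1/2) / 2, that is beta <= 1/2, the second. Their products are separated by [powR_mul_le]. *)
Lemma rl_section_derive_bound : exists2 K, 0 <= K & forall s t, 0 < s < 1 ->
  a < t < b ->
  `|dsection s t| <= K * G1 t.
Proof.
have := hb; have := hg; move: (hkap) (halpha) (hbeta) =>
  /andP[k0 k1] /andP[a0 a1] /andP[_ b1] hg' hb'.
have [K K0 HK] := horner_bounded_oo q a b; have [K' K'0 HK'] :=
  horner_bounded_oo q^`() a b.
have [M M0 HM] := @powR_mul_le R a b (- beta) (- (1 - alpha)) ab.
have l0 e : 0 <= (b - a) `^ e by exact: powR_ge0.
pose A t := 1 + (b - a) `^ beta * (t - a) `^ (- beta).
have B1 : bnd (fun=> 1).
  apply: (@bnd_le _ (fun t => (t - a) `^ (- 0))); first by move=> t _;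
    rewrite oppr0 powRr0.
  by apply: bndT; lra.
have BA : bnd A by apply: bndD => //; apply: bndZ => //; apply: bndT; lra.
have BY : bnd (fun t => (b - t) `^ (- (1 - alpha))) by apply: bndY; lra.
have B2 : bnd (fun t => (b - t) `^ (- (1 - alpha)) * A t).
  apply: (@bnd_le _ (fun t => (b - t) `^ (- (1 - alpha)) +
      (b - a) `^ beta * (M * ((t - a) `^ (- beta) +
        (b - t) `^ (- (1 - alpha)))))).
    move=> t ht; rewrite /A mulrDr mulr1 lerD2l mulrCA; apply: ler_wpM2l => //.
    by rewrite mulrC; exact: HM.
  apply: bndD => //; apply: bndZ => //; apply: bndZ; first exact: ltW.
  by apply: bndD => //; apply: bndT; lra.
have B3 : bnd (fun t => A t * (t - a) `^ (-1)).
  apply: (@bnd_le _ (fun t => (t - a) `^ (- 1) + (b - a) `^ beta *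
    (t - a) `^ (- (beta + 1)))).
    move=> t /andP[at_ tb]; rewrite /A mulrDl mul1r -mulrA -powR_addl
      ?subr_gt0//.
    by rewrite opprD.
  by apply: bndD; [apply: bndT; lra|apply: bndZ => //; apply: bndT; lra].
have : bnd (fun t => K * ((b - t) `^ (- (1 - alpha)) * A t) +
    (b - a) `^ alpha * K * (A t * (t - a) `^ (-1)) + (b - a) `^ alpha * K' *
      A t).
  apply: bndD; last by apply: bndZ => //; exact: mulr_ge0.
  by apply: bndD; apply: bndZ => //; exact: mulr_ge0.
move=> [C C0 HC]; exists C => // s t hs ht; apply: le_trans (HC t ht).
have /andP[at_ tb] := ht; have /andP[s0 s1] := hs; have /andP[n1 n2] :=
  node_bounds hs ht.
have /andP[r0 rA] := ratio_le hs ht; rewrite -/(A t) in rA.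
have hn : a < node s t < b by rewrite n2 andbT; apply: lt_le_trans n1.
have q1 := HK _ hn; have q2 := HK' _ hn.
have T0 : 0 < t - a by rewrite subr_gt0.
have U0 : 0 < node s t - a by rewrite subr_gt0; case/andP : hn.
have yA : (b - t) `^ alpha <= (b - a) `^ alpha by apply: powR_homo_le; lra.
have y0 := powR_ge0 (b - t) alpha; have y1 := powR_ge0 (b - t) (alpha - 1).
have A0 : 0 <= A t by apply: le_trans rA.
have -> : - (1 - alpha) = alpha - 1 by ring.
(* Since the node lies to the right of t, the difference is between -1 / (t - a) and 0. Its two
   terms are kept together so that the bound is uniform in s. *)
have ti : `|(1 - s) * (node s t - a) `^ (-1) - (t - a) `^ (-1)| <=
  (t - a) `^ (-1).
  rewrite !powR_inv1 ?(ltW U0) ?(ltW T0)//.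
  have i0 : 0 < (node s t - a)^-1 by rewrite invr_gt0.
  have i1 : (node s t - a)^-1 <= (t - a)^-1 by rewrite lef_pV2 ?posrE//; lra.
  move: i0 i1; move: (node s t - a)^-1 (t - a)^-1 => u v u0 uv.
  rewrite ler_norml; apply/andP; split; nra.
have t0 := powR_ge0 (t - a) (-1).
rewrite /dsection; move: (ratio s t) r0 rA => r r0 rA.
apply: le_trans (ler_normD _ _) _; apply: lerD; last first.
  rewrite !normrM (ger0_norm y0) (ger0_norm r0) (ger0_norm (_ : 0 <= 1 - s));
    last lra.
  apply: (@le_trans _ _ ((b - a) `^ alpha * A t * (K' * 1)));
    last by rewrite mulr1 mulrAC.
  apply: ler_pM; [exact: mulr_ge0|apply: mulr_ge0 => //; lra| |].
    exact: ler_pM.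
  by apply: ler_pM => //; lra.
apply: le_trans (ler_normD _ _) _; apply: lerD.
  rewrite mulNr normrN !normrM (ger0_norm y1) (ger0_norm r0) (gtr0_norm a0).
  rewrite (_ : K * _ = 1 * (b - t) `^ (alpha - 1) * (A t * K)); last by ring.
  apply: ler_pM; [by apply: mulr_ge0 => //;
    lra|exact: mulr_ge0| |exact: ler_pM].
  by apply: ler_wpM2r => //; lra.
rewrite !normrM (ger0_norm y0) (ger0_norm r0).
rewrite (_ : _ * K * _ = (b - a) `^ alpha * (A t * (1 * (t - a) `^ (-1))) * K);
  last by ring.
have bb : `|beta| <= 1 by rewrite ler_norml; lra.
apply: ler_pM => //; first by apply: mulr_ge0 => //; apply: mulr_ge0 => //;
  exact: mulr_ge0.
apply: ler_pM => //; first by apply: mulr_ge0 => //; exact: mulr_ge0.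
apply: ler_pM => //.
by apply: ler_pM.
Qed.

Lemma rl_section_bound : exists2 C, 0 <= C & forall s t, 0 < s < 1 ->
  a < t < b ->
  `|rl_section s t| <= C * G t.
Proof.
have [K1 K10 HK1] := endpoint_weight_bounds ab hbeta hgam hkap.
have [K K0 HK] := horner_bounded_oo q a b.
have l0 e : 0 <= (b - a) `^ e by exact: powR_ge0.
have bs : beta <= sg by move: hkap (hbeta) => /andP[k0 k1] /andP[? ?]; lra.
exists ((b - a) `^ alpha * (K1 + (b - a) `^ beta * (b - a) `^ (sg - beta)) * K)
  => [|s t hs ht].
  by apply: mulr_ge0 => //; apply: mulr_ge0 => //; apply: addr_ge0;
    [exact: ltW|exact: mulr_ge0].
have /andP[at_ tb] := ht; have /andP[n1 n2] := node_bounds hs ht.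
have /andP[r0 rA] := ratio_le hs ht; have [e1 _] := HK1 t ht.
have hn : a < node s t < b by rewrite n2 andbT; apply: lt_le_trans n1.
have g0 : 0 <= G t by exact: endpoint_weight_ge0.
rewrite /rl_section; move: (ratio s t) r0 rA => r r0 rA;
  rewrite !normrM (ger0_norm r0) (ger0_norm (powR_ge0 _ _)) [leRHS]mulrAC.
have yA : (b - t) `^ alpha <= (b - a) `^ alpha by apply: powR_homo_le;
  have := al0; lra.
apply: ler_pM => //; [by apply: mulr_ge0 => //; exact: powR_ge0| |exact: HK].
rewrite -mulrA; apply: ler_pM => //; first exact: powR_ge0.
apply: (le_trans rA); rewrite mulrDl; apply: lerD => //.
rewrite -mulrA; apply: ler_wpM2l => //.
apply: (le_trans (@powR_neg_le R (t - a) (b - a) beta sg ltac:(lra) ltac:(lra)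
  bs)).
by apply: ler_wpM2l => //; rewrite lerDl; exact: powR_ge0.
Qed.

Let measurable_node : measurable_fun setT (fun p : RT * RT => node p.2 p.1).
Proof.
have m1 := @measurable_fst_RR R; have m2 := @measurable_snd_RR R.
apply: measurable_funD => //; apply: measurable_funM => //.
exact: measurable_funB.
Qed.

Let measurable_section : measurable_fun setT (fun p : RT * RT =>
  rl_section p.2 p.1).
Proof.
have m1 := @measurable_fst_RR R; have m2 := @measurable_snd_RR R.
apply: measurable_funM.
  apply: measurable_funM.
    by apply: measurable_powR_comp; exact: measurable_funB.
  apply: measurable_funM; apply: measurable_powR_comp;
    first exact: measurable_funB.
  by apply: measurable_funB => //; exact: measurable_node.
exact: measurable_horner_comp measurable_node.
Qed.

Lemma intg_unit_kernel : intg I01 rl_unit_kernel.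
Proof.
have := hg; have := al0 => h1 h2.
have := @intg_powR_sub_mul R 0 1 (alpha - 1) gam ltr01 ltac:(lra) ltac:(lra).
by apply: eq_intg => // s _; rewrite subr0.
Qed.

Let unit_kernel_ge0 s : 0 <= rl_unit_kernel s.
Proof. by apply: mulr_ge0; exact: powR_ge0. Qed.

Lemma rl_inner t : a < t < b ->
  [/\ intg `]t, b[ (fun x => (x - t) `^ (alpha - 1) * (q.[x] * w x)),
      intg I01 (fun s => rl_unit_kernel s * rl_section s t) &
      \int[mu]_(x in `]t, b[) ((x - t) `^ (alpha - 1) * (q.[x] * w x)) =
      w t * \int[mu]_(s in I01) (rl_unit_kernel s * rl_section s t)].
Proof.
move=> ht; have /andP[at_ tb] := ht; have := hg; have := al0 => h1 h2.
have T0 : 0 < t - a by rewrite subr_gt0.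
have Y0 : 0 < b - t by rewrite subr_gt0.
have mT : measurable (`]t, b[%classic : set RT) by exact: mitv.
have [K K0 HK] := horner_bounded_oo q a b.
have i1 : intg `]t, b[ (fun x => (x - t) `^ (alpha - 1) * (q.[x] * w x)).
  apply: (@intg_le _ _ _ (fun x => (K * ((t - a) `^ beta + (b - a) `^ beta)) *
      ((x - t) `^ (alpha - 1) * (b - x) `^ gam))) => //.
  - apply: measurable_funM.
      by apply: measurable_powR_comp; exact: measurable_funB.
    by apply: measurable_funM;
      [exact: measurable_horner|exact: measurable_powR_sub_mul].
  - move=> x; rewrite /= in_itv/= => /andP[tx xb].
    have axb : a < x < b by rewrite xb (lt_trans at_).
    have p1 := powR_ge0 (x - t) (alpha - 1); have p2 := powR_ge0 (x - a) beta.
    have p3 := powR_ge0 (b - x) gam.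
    have le := @powR_leD R (t - a) (b - a) (x - a) beta T0 ltac:(lra).
    have p4 : 0 <= (x - a) `^ beta * (b - x) `^ gam by exact: mulr_ge0.
    rewrite normrM (ger0_norm p1) normrM /weight (ger0_norm p4).
    rewrite (_ : K * _ * _ = (x - t) `^ (alpha - 1) *
      (K * (((t - a) `^ beta + (b - a) `^ beta) * (b - x) `^ gam)));
      last by ring.
    apply: ler_wpM2l => //; apply: ler_pM => //; first exact: HK.
    exact: ler_wpM2r.
  - by apply: intgZl => //; apply: intg_powR_sub_mul => //; lra.
have Yn : b - t != 0 by rewrite gt_eqF.
have [i2 E] := @Rintegral_affine R (b - t) t Yn _ _ mT i1.
have pre : (fun s : RT => (b - t) * s + t) @^-1` (`]t, b[%classic : set RT) =
  I01.
  apply/seteqP; split => s; rewrite /= !in_itv/= => /andP[s0 s1]; apply/andP;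
    split.
  - by move: s0; rewrite ltrDr pmulr_rgt0.
  - by move: s1; rewrite -ltrBrDr -[ltRHS]mulr1 ltr_pM2l.
  - by rewrite ltrDr; exact: mulr_gt0.
  - by rewrite -ltrBrDr -[ltRHS]mulr1 ltr_pM2l.
rewrite pre (gtr0_norm Y0) in i2 E.
(* The substitution yields (b - t)^(alpha + gam) in all. The part (b - t)^gam is absorbed by w(t),
   and the power (t - a)^beta that w(t) also contains is cancelled by [ratio]. *)
have key s : I01 s -> (b - t) * (((b - t) * s + t - t) `^ (alpha - 1) *
    (q.[(b - t) * s + t] * w ((b - t) * s + t))) =
      w t * (rl_unit_kernel s * rl_section s t).
  rewrite /= in_itv/= => hs; have /andP[s0 s1] := hs.
  have -> : (b - t) * s + t = node s t by rewrite /node addrC.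
  have -> : node s t - t = (b - t) * s by rewrite /node; ring.
  have eb : b - node s t = (b - t) * (1 - s) by rewrite /node; ring.
  rewrite /rl_section /ratio /rl_unit_kernel /weight eb.
  have s1' : 0 <= 1 - s by rewrite subr_ge0 ltW.
  rewrite (powRM _ (ltW Y0) (ltW s0)) (powRM _ (ltW Y0) s1').
  rewrite powRN (powR_addl alpha (-1) Y0) powR_inv1 ?(ltW Y0)//.
  by field; rewrite Yn /= gt_eqF// powR_gt0.
have wt0 : 0 < w t by apply: mulr_gt0; exact: powR_gt0.
have i3 : intg I01 (fun s => rl_unit_kernel s * rl_section s t).
  have := intgZl ((w t)^-1 * (b - t)) mI i2; apply: eq_intg => // s Is.
  by rewrite -mulrA /comp key// mulKf// gt_eqF.
split => //; rewrite E -intZl// -intZl//.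
exact: eq_int.
Qed.

Lemma rl_section_dominated : exists2 C, 0 <= C & forall t, a < t < b ->
  `|\int[mu]_(s in I01) (rl_unit_kernel s * rl_section s t)| <= C * G t /\
  \int[mu]_(s in I01) `|rl_unit_kernel s * rl_section s t| <= C * G t.
Proof.
have [C C0 HC] := rl_section_bound; have ik := intg_unit_kernel.
set B := \int[mu]_(s in I01) rl_unit_kernel s.
have B0 : 0 <= B by apply: Rintegral_ge0 => s _; exact: unit_kernel_ge0.
exists (B * C) => [|t ht]; first exact: mulr_ge0.
have [_ i2 _] := rl_inner ht.
have le s : I01 s -> `|rl_unit_kernel s * rl_section s t| <= C * G t *
  rl_unit_kernel s.
  rewrite /= in_itv/= => hs; rewrite normrM (ger0_norm (unit_kernel_ge0 s))
    mulrC.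
  by apply: ler_wpM2r; [exact: unit_kernel_ge0|exact: HC].
have ic : intg I01 (fun s => C * G t * rl_unit_kernel s) by exact: intgZl.
have -> : B * C * G t = \int[mu]_(s in I01) (C * G t * rl_unit_kernel s).
  by rewrite intZl// -/B; ring.
split; last by apply: int_le => //; exact: intg_norm.
by apply: norm_Rintegral_le => //; exact: intg_measurable i2.
Qed.

Lemma measurable_rl_section s : measurable_fun D (rl_section s).
Proof.
have mn : measurable_fun D (fun t : RT => node s t).
  apply: measurable_funD => //; apply: measurable_funM => //.
  exact: measurable_funB.
apply: measurable_funM; last exact: measurable_horner_comp.
apply: measurable_funM; first by apply: measurable_powR_comp;
  exact: measurable_funB.
by apply: measurable_funM; apply: measurable_powR_comp; exact: measurable_funB.
Qed.

Lemma measurable_rl_section2 : measurable_fun setT (fun p : RT * RT =>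
  rl_section p.2 p.1).
Proof. exact: measurable_section. Qed.

End fixed_polynomial.

Section functions.
Variable f : R -> R.
Hypothesis mf : measurable_fun D f.
Hypothesis fi : intg D (fun x => `|f x| * (G x * w x)).

Definition rl_real x := \int[mu]_(t in `]a, x[) (f t * (x - t) `^ (alpha - 1)).

Let f' := f \_ D.
Let w' := w \_ D.
Let f'E x : D x -> f' x = f x. Proof. by move=> Dx;
  rewrite /f' patchE mem_set. Qed.
Let w'E x : D x -> w' x = w x. Proof. by move=> Dx;
  rewrite /w' patchE mem_set. Qed.
Let mf' : measurable_fun setT f'. Proof. exact/(measurable_restrictT _ mD). Qed.
Let mw' : measurable_fun setT w'. Proof. exact/(measurable_restrictT _ mD). Qed.

Variable q : {poly R}.
Local Notation rl_section := (rl_section q).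

(** A second exchange, between s and t, isolates for each s a pairing of f w with one function of t,
    the form to which [jrem_pairing] applies. *)
Lemma rl_sectionwise :
  [/\ intg I01 (fun s => rl_unit_kernel s * \int[mu]_(t in D) (f t * w t *
    rl_section s t)),
      intg D (fun t => f t * w t * \int[mu]_(s in I01) (rl_unit_kernel s *
        rl_section s t)) &
      \int[mu]_(t in D) (f t * w t * \int[mu]_(s in I01) (rl_unit_kernel s *
        rl_section s t)) =
      \int[mu]_(s in I01) (rl_unit_kernel s * \int[mu]_(t in D) (f t * w t *
        rl_section s t))].
Proof.
have [C C0 HC] := rl_section_dominated q.
pose k (p : RT * RT) : R := rl_unit_kernel p.2 *
  (f' p.1 * w' p.1 * rl_section p.2 p.1).
have m1 := @measurable_fst_RR R; have m2 := @measurable_snd_RR R.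
have mk : measurable_fun (D `*` I01) k.
  apply: (@measurable_funS _ _ _ _ setT) => //.
  apply: measurable_funM.
    apply: measurable_funM; apply: measurable_powR_comp => //.
    exact: measurable_funB.
  apply: measurable_funM; last exact: measurable_rl_section2.
  by apply: measurable_funM; [apply: (measurableT_comp mf');
    exact: m1|apply: (measurableT_comp mw'); exact: m1].
have kE t s : D t -> k (t, s) = f t * w t * (rl_unit_kernel s * rl_section s t).
  by move=> Dt; rewrite /k/= f'E// w'E//; ring.
have ig : intg D (fun t => C * (`|f t| * (G t * w t))) by exact: intgZl.
have kg t : D t -> (\int[mu]_(s in I01) `|k (t, s)|%:E <=
  (C * (`|f t| * (G t * w t)))%:E)%E.
  move=> Dt; have [_ i2 _] := rl_inner q (inD Dt);
    have wt := weight_ge0 a b beta gam t.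
  have -> : (\int[mu]_(s in I01) `|k (t, s)|%:E =
      (\int[mu]_(s in I01) (`|f t * w t| * `|rl_unit_kernel s *
        rl_section s t|))%R%:E)%E.
    rewrite -eintE//; last by apply: intgZl => //; exact: intg_norm.
    by apply: eq_integral => s _; rewrite kE// normrM.
  rewrite lee_fin intZl//; last exact: intg_norm.
  rewrite [X in X * _]normrM (ger0_norm wt).
  rewrite (_ : C * _ = `|f t| * w t * (C * G t)); last by ring.
  apply: ler_wpM2l; first exact: mulr_ge0.
  by have [_] := HC t (inD Dt).
have [_ i1 i2 E] := Rintegral_Fubini mD mI mk ig kg.
clear kg ig mk.
have e1 t : D t -> \int[mu]_(s in I01) k (t, s) = f t * w t *
  \int[mu]_(s in I01) (rl_unit_kernel s * rl_section s t).
  move=> Dt; have [_ i3 _] := rl_inner q (inD Dt); rewrite -intZl//.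
  by apply: eq_int => s _; exact: kE.
have e2 s : I01 s -> \int[mu]_(t in D) k (t, s) = rl_unit_kernel s *
  \int[mu]_(t in D) (f t * w t * rl_section s t).
  move=> _; have mfw : measurable_fun D (fun t => f t * w t * rl_section s t).
    by apply: measurable_funM;
      [exact: measurable_funM|exact: measurable_rl_section].
  rewrite -(intZl_measurable _ mD mfw).
  by apply: eq_int => t Dt; rewrite kE//; ring.
split; [exact: (eq_intg _ _ i1)|exact: (eq_intg _ _ i2)|].
by rewrite -(eq_int e1) E (eq_int e2).
Qed.

(** An exchange over the triangle t < x, followed by [rl_inner]. Existence of the fractional
    integral at almost every x is a by-product of it. *)
Lemma rl_fubini :
  [/\ {ae mu, forall x, D x -> intg `]a,
    x[ (fun t => (q.[x] * w x) * (f t * (x - t) `^ (alpha - 1)))},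
      intg D (fun x => q.[x] * w x * rl_real x) &
      \int[mu]_(x in D) (q.[x] * w x * rl_real x) =
      \int[mu]_(t in D) (f t * w t * \int[mu]_(s in I01) (rl_unit_kernel s *
        rl_section s t))].
Proof.
have [K K0 HK] := horner_bounded_oo q a b.
(* The majorant for the exchange: |q| is bounded by the constant K, so the inner integral of the
   modulus is at most the inner integral for the constant polynomial. *)
have [C C0 HC] := rl_section_dominated K%:P.
pose k (p : RT * RT) : R := f' p.1 *
  (if (p.1 : R) < p.2 then (p.2 - p.1) `^ (alpha - 1) * (q.[p.2] * w' p.2) else
    0).
have m1 := @measurable_fst_RR R; have m2 := @measurable_snd_RR R.
have mk : measurable_fun (D `*` D) k.
  apply: (@measurable_funS _ _ _ _ setT) => //.
  apply: measurable_funM; first by apply: (measurableT_comp mf'); exact: m1.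
  apply: measurable_ltr_if => //.
  apply: measurable_funM; first by apply: measurable_powR_comp;
    exact: measurable_funB.
  apply: measurable_funM; first exact: measurable_horner_comp.
  by apply: (measurableT_comp mw'); exact: m2.
have kx x t : D x -> D t -> k (t, x) = if t < x then (q.[x] * w x) *
  (f t * (x - t) `^ (alpha - 1)) else 0.
  move=> Dx Dt; rewrite /k/= (f'E Dt) (w'E Dx); case: (t < x);
    last by rewrite mulr0.
  by rewrite [LHS]mulrA; exact: mulrC.
have inT t : a < t < b -> forall x, (`]t, b[%classic : set RT) x <-> D x /\
  t < x.
  move=> /andP[at_ tb] x; rewrite /= !in_itv/=;
    split => [/andP[tx ->]|[/andP[_ ->] ->]//].
  by rewrite tx (lt_trans at_ tx).
have inX x : a < x < b -> forall t, (`]a, x[%classic : set RT) t <-> D t /\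
  t < x.
  move=> /andP[ax xb] t; rewrite /= !in_itv/=;
    split => [/andP[-> tx]|[/andP[-> _] ->]//].
  by rewrite tx (lt_trans tx xb).
have ig : intg D (fun t => C * (`|f t| * (G t * w t))) by exact: intgZl.
have kg t : D t -> (\int[mu]_(x in D) `|k (t, x)|%:E <=
  (C * (`|f t| * (G t * w t)))%:E)%E.
  move=> Dt; have ht := inD Dt.
  have [i1 _ _] := rl_inner q ht; have [i2 _ E2] := rl_inner K%:P ht.
  have wt := weight_ge0 a b beta gam t.
  have mT : measurable (`]t, b[%classic : set RT) by exact: mitv.
  have i1n := intg_norm mT i1.
  have kE x : D x -> `|k (t, x)| = if t < x then `|f t| *
    `|(x - t) `^ (alpha - 1) * (q.[x] * w x)| else 0.
    by move=> Dx; rewrite /k/= f'E// w'E// normrM; case: (t < x);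
      rewrite ?normr0 ?mulr0.
  have -> : (\int[mu]_(x in D) `|k (t, x)|%:E =
      (\int[mu]_(x in `]t, b[) (`|f t| * `|(x - t) `^ (alpha - 1) *
        (q.[x] * w x)|))%R%:E)%E.
    rewrite -eintE//; last exact: intgZl.
    rewrite -(eint_if (fun x => `|f t| * `|(x - t) `^ (alpha - 1) *
      (q.[x] * w x)|) (inT t ht)).
    by apply: eq_integral => x /set_mem Dx; rewrite kE.
  rewrite lee_fin intZl//.
  rewrite (_ : C * _ = `|f t| * (w t * (C * G t))); last by ring.
  apply: ler_wpM2l => //.
  apply: (@le_trans _ _ (\int[mu]_(x in `]t,
    b[) ((x - t) `^ (alpha - 1) * ((K%:P).[x] * w x)))).
    apply: int_le => // x Tx; have [/inD hx _] := (inT t ht x).1 Tx.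
    rewrite normrM (ger0_norm (powR_ge0 _ _)); apply: ler_wpM2l;
      first exact: powR_ge0.
    rewrite hornerC normrM (ger0_norm (weight_ge0 _ _ _ _ _)).
    by apply: ler_wpM2r; [exact: weight_ge0|exact: HK].
  rewrite E2; apply: ler_wpM2l => //; have [h _] := HC t ht.
  exact: le_trans (ler_norm _) h.
have [aei i1 i2 E] := Rintegral_Fubini mD mD mk ig kg.
clear kg ig mk.
have e1 x : D x -> \int[mu]_(t in D) k (t, x) = q.[x] * w x * rl_real x.
  move=> Dx; rewrite /rl_real -intZl_measurable; [|exact: mitv|]; last first.
    apply: measurable_funM.
      apply: (measurable_funS mD _ mf) => t /(inX x (inD Dx) t)[].
      by [].
    by apply: measurable_powR_comp; exact: measurable_funB.
  rewrite -(int_if (fun t => q.[x] * w x * (f t * (x - t) `^ (alpha - 1)))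
    (inX x (inD Dx))).
  by apply: eq_int => t Dt; exact: kx.
have e2 t : D t -> \int[mu]_(x in D) k (t, x) = f t * w t * \int[mu]_(s in I01)
  (rl_unit_kernel s * rl_section s t).
  move=> Dt; have ht := inD Dt; have [i3 _ E3] := rl_inner q ht.
  rewrite -mulrA -E3 -(intZl (f t) (mitv _) i3).
  rewrite -(int_if (fun x => f t * ((x - t) `^ (alpha - 1) * (q.[x] * w x)))
    (inT t ht)).
  apply: eq_int => x Dx; rewrite /k/= (f'E Dt) (w'E Dx).
  by case: (t < x); rewrite ?mulr0.
split; last by rewrite -(eq_int e1) -E (eq_int e2).
- apply: (@filterS _ _ (ae_filter_ringOfSetsType mu) _ _ _ aei).
  move=> x h Dx; have {}h := h Dx; have hx := inX x (inD Dx).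
  have h' := intgS mD (mitv _) (fun t Et => ((hx t).1 Et).1) h.
  apply: (eq_intg _ _ h') => [|t Et]; first exact: mitv.
  by have [Dt tx] := (hx t).1 Et; rewrite (kx x t Dx Dt) tx.
- exact: (eq_intg _ _ i1).
Qed.

End functions.

(** The bound of [jrem_pairing], uniform in s, is integrated against the unit kernel. *)
Lemma rl_jrem_bound (f : R -> R) (q : {poly R}) : measurable_fun D f ->
  intg D (fun x => `|f x| * (G x * w x)) ->
  (forall n, intg D (fun x => f x * ((jacobi_poly a b beta gam n).[x] * w x)))
    ->
  cvgn (series (fun n => `|jcoef a b beta gam f n| * n%:R `^ (-1 + 4 * kap))) ->
  exists2 C, 0 <= C & forall N, (0 < N)%N ->
  `|\int[mu]_(x in D) (q.[x] * w x * rl_real (jrem a b beta gam f N) x)| <=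
    C * jtail a b beta gam kap f N.
Proof.
move=> mf fi fJ fs.
have [C C0 HC] := jrem_pairing ab hbeta hgam hkap mf fi fJ fs.
have [K K0 HK] := rl_section_derive_bound q.
set B := \int[mu]_(s in I01) rl_unit_kernel s.
have B0 : 0 <= B by apply: Rintegral_ge0 => s _; apply: mulr_ge0;
  exact: powR_ge0.
exists (B * (K * C)) => [|N N0]; first by apply: mulr_ge0 => //;
  exact: mulr_ge0.
have mN := measurable_jrem beta gam mf N;
  have iN := intg_jrem_G ab hbeta hgam hkap mf fi N.
have [_ _ ->] := rl_fubini mN iN q.
have [i1 _ ->] := rl_sectionwise mN iN q.
have ik := intg_unit_kernel.
have ic : intg I01 (fun s => K * (C * jtail a b beta gam kap f N) *
  rl_unit_kernel s) by exact: intgZl.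
apply: (le_trans (norm_Rintegral_le mI (intg_measurable i1) _ ic)); last first.
  by rewrite intZl// -/B; move: (jtail _ _ _ _ _ _ _) => J; rewrite le_eqVlt;
    apply/orP; left; apply/eqP; ring.
move=> s Is; have hs : 0 < s < 1 by move: Is; rewrite /= in_itv.
have k0 : 0 <= rl_unit_kernel s by apply: mulr_ge0; exact: powR_ge0.
rewrite normrM (ger0_norm k0) mulrC; apply: ler_wpM2r => //.
have [_] := HC N (rl_section q s) _ K N0 (fun t ht => rl_section_derive _ hs ht)
  (fun t ht => rl_section_derive_continuous hs ht) (fun t ht => HK s t hs ht).
by [].
Qed.

End riemann_liouville.

(** * The matrix entries *)

Section rl_jacobi.
Context {R : realType}.
Local Notation mu := (@lebesgue_measure R).
Local Notation RT := (measurableTypeR R).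
Variables (a b alpha beta gam : R).
Hypothesis ab : a < b.
Hypothesis halpha : 0 < alpha < 1.
Hypothesis hb : - (1 / 2) <= beta.
Hypothesis hg : - (1 / 2) <= gam.
Local Notation w := (weight a b beta gam).
Local Notation Jp := (jacobi_poly a b beta gam).
Local Notation delta := (jacobi_delta a b beta gam).
Local Notation D := (`]a, b[%classic : set RT).
Implicit Types (x t : R) (k m n : nat).

Let al0 : 0 < alpha. Proof. by case/andP : halpha. Qed.
Let L0 : 0 < b - a. Proof. by rewrite subr_gt0. Qed.
Let mD : measurable D. Proof. exact: mitv. Qed.

Lemma Gamma_nat n : Gamma (n%:R + 1) = n`!%:R :> R.
Proof.
elim: n => [|n IH]; first by rewrite add0r Gamma1.
by rewrite -natr1 GammaS ?IH ?factS ?natrM ?natr1//; rewrite natr1 ltr0n.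
Qed.

Let nonint k i : (k%:R : R) + alpha - i%:R != 0.
Proof.
have /andP[a0 a1] := halpha; rewrite addrAC addr_eq0; apply/negP => /eqP E.
have : k%:R - i%:R = - alpha by [].
case: (leqP i k) => ik.
  by rewrite -natrB// => h; have := ler0n R (k - i); rewrite h; lra.
have : (k.+1%:R : R) <= i%:R by rewrite ler_nat.
by rewrite -natr1; lra.
Qed.

(** As 0 < alpha < 1, the argument k + alpha - m + 1 may be negative but is never an integer, so no
    pole of Gamma is met and [Gamma_pole_free] applies. *)
Lemma Gamma_falling m k :
  Gamma (k%:R + alpha - m%:R + 1) * \prod_(j < m) (k%:R + alpha - j%:R) =
  Gamma (k%:R + alpha + 1).
Proof.
have -> : \prod_(j < m) (k%:R + alpha - j%:R) =
    \prod_(i < m) (k%:R + alpha - m%:R + 1 + i%:R).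
  rewrite (reindex_inj rev_ord_inj)/=; apply: eq_bigr => i _.
  by rewrite natrB// -natr1; ring.
have E : k%:R + alpha - m%:R + 1 + m%:R = k%:R + alpha + 1 by ring.
rewrite -[in RHS]E; apply: Gamma_pole_free; last first.
  by rewrite E; have := al0; have := ler0n R k; lra.
move=> i; have := nonint (k + i).+1 m.
by congr (_ != 0); rewrite -natr1 natrD; ring.
Qed.

Lemma rl_power k x : a < x < b ->
  intg `]a, x[ (fun t => (t - a) ^+ k * (x - t) `^ (alpha - 1)) /\
  \int[mu]_(t in `]a, x[) ((t - a) ^+ k * (x - t) `^ (alpha - 1)) =
  Gamma alpha * (k`!%:R / Gamma (k%:R + alpha + 1)) * (x - a) `^ (k%:R + alpha).
Proof.
move=> /andP[ax xb]; have := al0 => a0; have k0 := ler0n R k.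
have k1 : 0 < (k%:R + 1 : R) by lra.
have E t : (`]a, x[%classic : set RT) t ->
    (t - a) `^ (k%:R + 1 - 1) * (x - t) `^ (alpha - 1) = (t - a) ^+ k *
      (x - t) `^ (alpha - 1).
  by rewrite /= in_itv/= => /andP[at_ _];
    rewrite addrK powR_mulrn// subr_ge0 ltW.
split.
  by apply: (eq_intg _ E); [exact: mitv|apply: intg_powR_sub_mul => //; lra].
rewrite -(eq_int E) (Rintegral_powR_Beta ax k1 a0).
have BG := Beta_Gamma k1 a0; rewrite Gamma_nat in BG.
have G0 : Gamma (k%:R + alpha + 1) != 0 by rewrite gt_eqF// Gamma_gt0//; lra.
have e1 : k%:R + 1 + alpha = k%:R + alpha + 1 by ring.
rewrite e1 in BG; rewrite e1 addrK mulrC; congr (_ * _).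
apply: (mulIf G0); rewrite BG -mulrA divfK//.
exact: mulrC.
Qed.

Lemma jacobi_taylor n x : (Jp n).[x] = \sum_(k < n.+1) ((Jp n)^`(k)).[a] /
  k`!%:R * (x - a) ^+ k.
Proof.
rewrite -[in LHS](subrKC a x) (@nderiv_taylor_wide _ n.+1); last 2 first.
- exact: mulrC.
- by rewrite size_jacobi_poly.
apply: eq_bigr => k _; by rewrite nderivn_def hornerMn -mulr_natr mulfK//
  pnatr_eq0 -lt0n fact_gt0.
Qed.

Lemma rl_real_jacobi n x : a < x < b -> rl_real a alpha (horner (Jp n)) x =
  Gamma alpha * \sum_(k < n.+1)
    ((Jp n)^`(k)).[a] / Gamma (k%:R + alpha + 1) * (x - a) `^ (k%:R + alpha).
Proof.
move=> hx; rewrite /rl_real.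
rewrite (@eq_int _ _ _ (fun t => \sum_(k < n.+1) ((Jp n)^`(k)).[a] / k`!%:R *
  ((t - a) ^+ k * (x - t) `^ (alpha - 1)))); last first.
  by move=> t _; rewrite jacobi_taylor mulr_suml; apply: eq_bigr => k _;
    rewrite mulrA.
have mX : measurable (`]a, x[%classic : set RT) by exact: mitv.
rewrite Rintegral_sum//; last by move=> k _; apply: intgZl => //;
  have [] := rl_power k hx.
rewrite mulr_sumr; apply: eq_bigr => k _; have [i E] := rl_power k hx.
rewrite intZl// E.
have f0 : k`!%:R != 0 :> R by rewrite pnatr_eq0 -lt0n fact_gt0.
have g0 : Gamma (k%:R + alpha + 1) != 0.
  by rewrite gt_eqF// Gamma_gt0//; have := al0; have := ler0n R k; lra.
by field; rewrite ?f0 ?g0.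
Qed.

(** The sign and the power of b - a in delta_m combine with those of the moment. For m = 0 the two
    conventions agree by Gamma(x + 1) = x Gamma(x), or by Gamma(1) = 1 when beta + gam + 1 = 0. *)
Lemma jacobi_delta_hdelta m :
  delta m * (-1) ^+ m * (b - a) `^ (alpha + beta + gam + m%:R + 1) =
  jacobi_hdelta a b alpha beta gam m.
Proof.
have hbg := hbg1 hb hg.
rewrite /jacobi_delta /jacobi_hdelta; case: ifP => [/andP[/eqP -> /eqP bg0]|h].
  rewrite eqxx expr0 mulr1 fact0 !addr0 mul1r bg0 mul0r addr0.
  rewrite (_ : alpha + beta + gam + 1 = alpha + (beta + gam + 1)); last by ring.
  rewrite (_ : beta + gam + 2 = beta + gam + 1 + 1); last by ring.
  have Gp : 0 < Gamma (beta + 1) * Gamma (gam + 1).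
    by apply: mulr_gt0; apply: Gamma_gt0; [exact: hb1|exact: hg1].
  by rewrite bg0 addr0 add0r Gamma1 mul1r mul1r mulrC sqrtrV ?ltW.
rewrite mulrAC -!mulrA mulrCA [LHS]mulrA.
set S := Num.sqrt (beta + gam + 2 * m%:R + 1);
  set T := Num.sqrt (Gamma (beta + gam + m%:R + 1) / _).
have sgn : (-1 : R) ^+ m * (-1) ^+ m = 1 by rewrite -exprMn mulrNN mulr1 expr1n.
have Lp : (b - a) `^ (alpha + beta + gam + m%:R + 1) /
  (b - a) `^ (m%:R + (beta + gam + 1) / 2) =
   (b - a) `^ (alpha + (beta + gam + 1) / 2).
  by rewrite -powRN -powR_addl//; congr (_ `^ _); field.
transitivity ((b - a) `^ (alpha + (beta + gam + 1) / 2) * (S * T)).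
  rewrite -Lp; move: ((-1 : R) ^+ m) sgn => s sgn.
  rewrite -[RHS]mul1r -[X in _ = X * _]sgn; ring.
congr (_ * _); rewrite /S /T -sqrtrM; last by have := ler0n R m; lra.
have -> : (if m == 0%N then Gamma (beta + gam + 2)
    else (beta + gam + 2 * m%:R + 1) * Gamma (beta + gam + m%:R + 1)) =
    (beta + gam + 2 * m%:R + 1) * Gamma (beta + gam + m%:R + 1).
  case: eqP h => [-> /= h|//]; rewrite mulr0 !addr0.
  rewrite (_ : beta + gam + 2 = beta + gam + 1 + 1); last by ring.
  by rewrite GammaS// lt_def hbg h.
by rewrite -(mulrA (beta + gam + 2 * m%:R + 1)).
Qed.

Lemma rl_jacobi_matrix m n :
  \int[mu]_(x in D) ((Jp m).[x] * w x * rl_real a alpha (horner (Jp n)) x) =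
  Gamma alpha * ((-1) ^+ n * jacobi_A a b alpha beta gam m n).
Proof.
have inD x : D x -> a < x < b by rewrite /= in_itv.
have := al0 => a0; have h1 := hb1 hb; have h2 := hg1 hg.
pose p k x := (x - a) `^ (k%:R + alpha + beta) * (b - x) `^ gam * (Jp m).[x].
pose c k := ((Jp n)^`(k)).[a] / Gamma (k%:R + alpha + 1).
have ip k : intg D (p k).
  by apply: intg_powR_poly => //; have := ler0n R k; lra.
rewrite (@eq_int _ _ _ (fun x => Gamma alpha * \sum_(k < n.+1) c k * p k x));
  last first.
  move=> x /inD hx; rewrite rl_real_jacobi// mulrCA; congr (_ * _).
  rewrite mulr_sumr; apply: eq_bigr => k _; rewrite /c /p /weight.
  have X0 : 0 < x - a by case/andP : hx => ? _; rewrite subr_gt0.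
  by rewrite (powR_addl (k%:R + alpha) beta X0); ring.
rewrite intZl//; last by apply: intg_sum => // k _; exact: intgZl.
rewrite Rintegral_sum//; last by move=> k _; exact: intgZl.
congr (_ * _); rewrite /jacobi_A -(jacobi_delta_hdelta m) big_mkord mulr_sumr
  mulr_sumr.
apply: eq_bigr => k _; rewrite intZl//.
rewrite (@eq_int _ _ _ (fun x => delta m * ((x - a) `^ (k%:R + alpha + beta) *
  (b - x) `^ gam *
  (jq a b (beta + m%:R) (gam + m%:R) m).[x]))); last first.
  by move=> x _; rewrite /p jacobi_polyE// hornerZ mulrCA.
rewrite intZl//; last by apply: intg_powR_poly => //; have := ler0n R k; lra.
rewrite jacobi_moment//; last by have := ler0n R k; lra.
(* The moment has the real exponent k + alpha; its falling factorial becomes a Gamma quotient whose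
   numerator cancels the denominator produced by the fractional integral of (x - a)^k. *)
have GF := Gamma_falling m k.
have G0 : Gamma (k%:R + alpha + 1) != 0.
  by rewrite gt_eqF// Gamma_gt0//; have := ler0n R k; lra.
have Gm0 : Gamma (k%:R + alpha - m%:R + 1) != 0.
  by apply: contraNneq G0 => E; rewrite -GF E mul0r.
have -> : \prod_(j < m) (k%:R + alpha - j%:R) = Gamma (k%:R + alpha + 1) /
  Gamma (k%:R + alpha - m%:R + 1).
  by rewrite -GF mulrC mulKf.
rewrite /c /frakC.
have -> : (b - a) `^ (k%:R + alpha + beta + gam + m%:R + 1) =
    (b - a) ^+ k * (b - a) `^ (alpha + beta + gam + m%:R + 1).
  rewrite -powR_mulrn ?(ltW L0)// -powR_addl//; congr (_ `^ _); ring.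
have -> : alpha + beta + k%:R + 1 = k%:R + alpha + beta + 1 by ring.
have sgn : (-1 : R) ^+ n * (-1) ^+ k * (-1) ^+ (n + k) = 1.
  by rewrite -exprD -exprMn mulrNN mulr1 expr1n.
move: (Beta _ _) => B; move: ((Jp n)^`(k)).[a] => d;
  move: ((b - a) `^ _) (delta m) => L dl.
move: ((-1 : R) ^+ n) ((-1 : R) ^+ (n + k)) ((-1 : R) ^+ m) ((-1 : R) ^+ k) sgn
  => s1 s2 s3 s4 sgn.
rewrite -[LHS]mul1r -[X in X * _ = _]sgn.
by field; rewrite G0 Gm0.
Qed.

End rl_jacobi.

(** * Jacobi coefficients of the fractional integral of a real function *)

Section real_part.
Context {R : realType}.
Local Notation mu := (@lebesgue_measure R).
Local Notation RT := (measurableTypeR R).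
Variables (a b alpha beta gam kap del : R).
Hypothesis ab : a < b.
Hypothesis halpha : 0 < alpha < 1.
Hypothesis hbeta : - (1 / 2) <= beta <= 1 / 2.
Hypothesis hgam : - (1 / 2) <= gam <= 1 / 2.
Hypothesis hkap : 0 < kap <= 1 / 8.
Hypothesis hdel : 0 < del <= 1.
Hypothesis hkd : 16 * kap < del.
Local Notation w := (weight a b beta gam).
Local Notation Jp := (jacobi_poly a b beta gam).
Local Notation jcoef := (jcoef a b beta gam).
Local Notation D := (`]a, b[%classic : set RT).
Local Notation G := (endpoint_weight a b ((beta + 1 / 2) / 2 + kap)
  ((gam + 1 / 2) / 2 + kap)).
Local Notation rl := (rl_real a alpha).
Implicit Types (f g : R -> R) (x t : R).

Let hb : - (1 / 2) <= beta. Proof. by case/andP : hbeta. Qed.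
Let hg : - (1 / 2) <= gam. Proof. by case/andP : hgam. Qed.
Let al0 : 0 < alpha. Proof. by case/andP : halpha. Qed.
Let mD : measurable D. Proof. exact: mitv. Qed.
Let inD x : D x -> a < x < b. Proof. by rewrite /= in_itv. Qed.

Lemma weight_gt0 x : a < x < b -> 0 < w x.
Proof. by move=> /andP[ax xb]; apply: mulr_gt0;
  rewrite powR_gt0// subr_gt0. Qed.

(** The p_n span all polynomials, so g w has vanishing moments. Its integrability is read off from n
    = 0, where p_0 is a nonzero constant. *)
Lemma jacobi_unique_ae g :
  (forall n, intg D (fun x => g x * ((Jp n).[x] * w x)) /\
     \int[mu]_(x in D) (g x * ((Jp n).[x] * w x)) = 0) ->
  {ae mu, forall x, a < x < b -> g x = 0}.
Proof.
move=> H.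
have [c cE] : exists c, Jp 0 = c%:P.
  by exists ((Jp 0)`_0); apply: size1_polyC; rewrite size_jacobi_poly.
have c0 : c != 0.
  have := size_jacobi_poly ab hb hg 0; rewrite cE size_polyC.
  by case: (c != 0).
have ig : intg D (fun x => g x * w x).
  have [i _] := H 0%N; apply: (eq_intg _ _ (intgZl c^-1 mD i)) => // x _.
  by rewrite cE hornerC mulrCA mulKf.
have gq (q : {poly R}) : \int[mu]_(x in D) (g x * w x * q.[x]) = 0.
  have [e ->] := jacobi_span ab hbeta hgam (leqnn (size q)).
  rewrite (@eq_int _ _ _ (fun x => \sum_(0 <= n < size q) e n *
    (g x * ((Jp n).[x] * w x)))); last first.
    move=> x _; rewrite horner_sum mulr_sumr; apply: eq_bigr => n _.
    by rewrite hornerZ; move: (w x) (Jp n).[x] => W J; ring.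
  rewrite Rintegral_sum//; last by move=> n _; apply: intgZl => //;
    exact: (H n).1.
  apply: big1 => n _; have [i0 E0] := H n.
  by rewrite (intZl _ mD i0) E0 mulr0.
have := moments_zero_ae ab ig gq.
move=> h; apply: (@filterS _ _ (ae_filter_ringOfSetsType mu) _ _ _ h).
move=> x hx axb; have := hx axb => /eqP;
  rewrite mulf_eq0 (gt_eqF (weight_gt0 axb)) orbF.
by move/eqP.
Qed.

Lemma jcoef_inj_ae g1 g2 :
  (forall n, [/\ intg D (fun x => g1 x * ((Jp n).[x] * w x)),
     intg D (fun x => g2 x * ((Jp n).[x] * w x)) & jcoef g1 n = jcoef g2 n]) ->
  {ae mu, forall x, a < x < b -> g1 x = g2 x}.
Proof.
move=> H.
have : {ae mu, forall x, a < x < b -> g1 x - g2 x = 0}.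
  apply: jacobi_unique_ae => n; have [i1 i2 E] := H n.
  have BE x : g1 x * ((Jp n).[x] * w x) - g2 x * ((Jp n).[x] * w x) =
    (g1 x - g2 x) * ((Jp n).[x] * w x) by exact/esym/mulrBl.
  split; first exact: (eq_intg mD (fun x _ => BE x) (intgB mD i1 i2)).
  rewrite -(eq_int (fun x _ => BE x)) (intB mD i1 i2).
  by apply/eqP; rewrite subr_eq0; apply/eqP.
move=> h; apply: (@filterS _ _ (ae_filter_ringOfSetsType mu) _ _ _ h).
by move=> x hx axb; apply/eqP; rewrite -subr_eq0; apply/eqP; exact: hx.
Qed.

Lemma intg_poly_G (q : {poly R}) : intg D (fun x => `|q.[x]| * (G x * w x)).
Proof.
have [K K0 HK] := horner_bounded_oo q a b.
have Gw0 x : 0 <= G x * w x.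
  by apply: mulr_ge0; [exact: endpoint_weight_ge0|exact: weight_ge0].
apply: (@intg_le _ _ _ (fun x => K * (G x * w x))) => //.
- apply: measurable_funM; first by apply: measurableT_comp => //;
    exact: measurable_horner.
  by apply: measurable_funM;
    [exact: measurable_endpoint_weight|exact: measurable_weight].
- move=> x /inD axb; rewrite normrM normr_id (ger0_norm (Gw0 x)).
  by apply: ler_wpM2r => //; exact: HK.
- by apply: intgZl => //; exact: intg_G.
Qed.

Variable f : R -> R.
Hypothesis mf : measurable_fun D f.
Hypothesis fi : intg D (fun x => `|f x| `^ (1 + del) * (G x * w x)).

Let fG : intg D (fun x => `|f x| * (G x * w x)).
Proof. exact: (intg_powR_G ab hbeta hgam hkap hdel mf fi). Qed.

Lemma rl_coefficient m : intg D (fun x => (Gamma alpha)^-1 * rl f x *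
  ((Jp m).[x] * w x)) /\
  series (fun n => (-1) ^+ n * jcoef f n * jacobi_A a b alpha beta gam m n) N
    @[N --> \oo] -->
  \int[mu]_(x in D) ((Gamma alpha)^-1 * rl f x * ((Jp m).[x] * w x)).
Proof.
have fJ := intg_jacobi ab hbeta hgam hkap hdel mf fi.
have fs := jcoef_summable ab hbeta hgam hkap hdel hkd mf fi.
have Ga0 : Gamma alpha != 0 by rewrite gt_eqF// Gamma_gt0.
pose T g := \int[mu]_(x in D) ((Jp m).[x] * w x * rl g x).
have [_ i0 E0] := rl_fubini ab halpha hbeta hgam hkap mf fG (Jp m).
have E (g : R -> R) x : (Gamma alpha)^-1 * rl g x * ((Jp m).[x] * w x) =
    (Gamma alpha)^-1 * ((Jp m).[x] * w x * rl g x) by rewrite -mulrA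
      (mulrC (rl g x)).
split; first by apply: (eq_intg _ _ (intgZl (Gamma alpha)^-1 mD i0)) => // x _;
  rewrite E.
rewrite (@eq_int _ _ _ (fun x => (Gamma alpha)^-1 *
  ((Jp m).[x] * w x * rl f x))); last by move=> x _; exact: E.
rewrite (intZl _ mD i0) -/(T f).
pose A n := jacobi_A a b alpha beta gam m n.
have TJ n : T (horner (Jp n)) = Gamma alpha *
  ((-1) ^+ n * A n) by exact: rl_jacobi_matrix.
have Tlin N : T (jrem a b beta gam f N) = T f - \sum_(0 <= n < N) jcoef f n *
  T (horner (Jp n)).
  (* The fractional integral is additive only at points where the inner integrals converge.
     Linearity of T is therefore taken from its representation as integration of g w against the
     fixed function Phi. *)
  pose Phi t := \int[mu]_(s in `]0,
    1[) (rl_unit_kernel alpha gam s * rl_section a b alpha beta (Jp m) s t).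
  have mJ n : measurable_fun D (horner (Jp n)) by exact: measurable_horner.
  have TE g : measurable_fun D g -> intg D (fun x => `|g x| * (G x * w x)) ->
      intg D (fun t => g t * w t * Phi t) /\ T g =
        \int[mu]_(t in D) (g t * w t * Phi t).
    move=> mg ig; have [_ i _] := rl_sectionwise ab halpha hbeta hgam hkap mg ig
      (Jp m).
    have [_ _ h] := rl_fubini ab halpha hbeta hgam hkap mg ig (Jp m).
    split; [exact: i|exact: h].
  have [i1 ->] := TE f mf fG.
  have [_ ->] := TE _ (measurable_jrem beta gam mf N) (intg_jrem_G ab hbeta hgam
    hkap mf fG N).
  have iJ n : intg D (fun t => (Jp n).[t] * w t * Phi t) by have [] :=
    TE _ (mJ n) (intg_poly_G (Jp n)).
  rewrite (@eq_int _ _ _ (fun t => f t * w t * Phi t - \sum_(0 <= n < N) jcoef f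
    n * ((Jp n).[t] * w t * Phi t))); last first.
    move=> t _; rewrite /jrem !mulrBl; congr (_ - _); rewrite !mulr_suml.
    by apply: eq_bigr => n _; rewrite !mulrA.
  have iS : intg D (fun t => \sum_(0 <= n < N) jcoef f n *
    ((Jp n).[t] * w t * Phi t)).
    by apply: intg_sum => // n _; apply: intgZl => //; exact: iJ.
  rewrite (intB mD i1 iS); congr (_ - _).
  rewrite Rintegral_sum//; last by move=> n _; apply: intgZl => //; exact: iJ.
  apply: eq_bigr => n _; rewrite (intZl _ mD (iJ n)).
  by have [_ ->] := TE _ (mJ n) (intg_poly_G (Jp n)).
have [C C0 HC] := rl_jrem_bound ab halpha hbeta hgam hkap (Jp m) mf fG fJ fs.
(* The partial sums differ from the limit only by the value of T at the remainder, so convergence of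
   the series is equivalent to the decay of these values. *)
have sE N : series (fun n => (-1) ^+ n * jcoef f n * A n) N =
    (Gamma alpha)^-1 * T f - (Gamma alpha)^-1 * T (jrem a b beta gam f N).
  rewrite Tlin mulrBr opprB addrC subrK /series/= mulr_sumr; apply: eq_bigr =>
    n _.
  by rewrite TJ; field.
have c0 : T (jrem a b beta gam f N) @[N --> \oo] --> 0.
  have cJ : C * jtail a b beta gam kap f N @[N --> \oo] --> 0.
    rewrite -(mulr0 C); apply: cvgM; first exact: cvg_cst.
    exact: (jtail_cvg0 fs).
  apply/norm_cvg0P; apply: (squeeze_cvgr _ (cvg_cst 0) cJ).
  near=> N; rewrite normr_ge0 /=; apply: HC.
  by near: N; exact: nbhs_infty_gt.
rewrite (_ : (fun N => _) = (fun N => (Gamma alpha)^-1 * T f -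
  (Gamma alpha)^-1 * T (jrem a b beta gam f N))); last first.
  by apply/funext => N; exact: sE.
rewrite -[X in _ --> X]subr0 -[X in _ --> _ - X](mulr0 (Gamma alpha)^-1).
apply: cvgB; first exact: cvg_cst.
by apply: cvgM => //; exact: cvg_cst.
Unshelve. all: by end_near.
Qed.

Lemma rl_integrand_ae : {ae mu, forall x, a < x < b -> intg `]a,
  x[ (fun t => f t * (x - t) `^ (alpha - 1))}.
Proof.
have [h _ _] := rl_fubini ab halpha hbeta hgam hkap mf fG 1.
apply: (@filterS _ _ (ae_filter_ringOfSetsType mu) _ _ _ h).
move=> x hx axb; have Dx : D x by rewrite /= in_itv.
have i := intgZl (w x)^-1 (mitv _) (hx Dx).
apply: (eq_intg _ _ i) => [|t _]; first exact: mitv.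
by rewrite hornerC mul1r mulKf// gt_eqF// weight_gt0.
Qed.

End real_part.

Local Open Scope complex_scope.

(** * Complex functions through real and imaginary parts *)

Section complex_tools.
Context {R : realType}.
Local Notation mu := (@lebesgue_measure R).
Local Notation RT := (measurableTypeR R).
Implicit Types (z : R[i]) (r x : R).

Lemma Re_mulr_real z r : complex.Re (z * r%:C) = complex.Re z * r.
Proof. by case: z => u v /=; rewrite mulr0 subr0. Qed.

Lemma Im_mulr_real z r : complex.Im (z * r%:C) = complex.Im z * r.
Proof. by case: z => u v /=; rewrite mulr0 add0r. Qed.

Lemma Re_real_mul z r : complex.Re (r%:C * z) = r * complex.Re z.
Proof. by case: z => u v /=; rewrite mul0r subr0. Qed.

Lemma Im_real_mul z r : complex.Im (r%:C * z) = r * complex.Im z.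
Proof. by case: z => u v /=; rewrite mul0r addr0. Qed.

Lemma signr_complex n r : ((-1) ^+ n * r)%:C = (-1) ^+ n * r%:C.
Proof.
rewrite -signr_odd -[in RHS]signr_odd; case: (odd n);
  rewrite ?expr0 ?expr1 ?mul1r//.
by rewrite !mulN1r rmorphN.
Qed.

Lemma normc_powE z : Normc.normc z = (complex.Re z ^+ 2 + complex.Im z ^+ 2) `^
  2^-1.
Proof. by case: z => u v /=; rewrite powR12_sqrt// addr_ge0 ?sqr_ge0. Qed.

Lemma normr_Re_le z : `|complex.Re z| <= Normc.normc z.
Proof.
by case: z => u v /=; rewrite -sqrtr_sqr ler_wsqrtr// lerDl sqr_ge0.
Qed.

Lemma normr_Im_le z : `|complex.Im z| <= Normc.normc z.
Proof.
by case: z => u v /=; rewrite -sqrtr_sqr ler_wsqrtr// lerDr sqr_ge0.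
Qed.

Lemma normc_le_add z : Normc.normc z <= `|complex.Re z| + `|complex.Im z|.
Proof.
case: z => u v /=; rewrite -[leRHS]ger0_norm ?addr_ge0// -sqrtr_sqr
  ler_wsqrtr//.
rewrite -(real_normK (num_real u)) -(real_normK (num_real v)).
have := normr_ge0 u; have := normr_ge0 v; move: `|u| `|v| => s t; nra.
Qed.

Lemma cvg_complex (u : nat -> R[i]) (l : R[i]) :
  complex.Re (u n) @[n --> \oo] --> complex.Re l ->
  complex.Im (u n) @[n --> \oo] --> complex.Im l ->
  (u : nat -> R[i]^o) @ \oo --> (l : R[i]^o).
Proof.
(* In the order of the complex numbers a positive radius is a positive real: its imaginary part is
   zero. *)
move=> /cvgrPdist_lt cR /cvgrPdist_lt cI; apply/cvgrPdist_lt => e;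
  rewrite ltcE/= => /andP[/eqP eI e0].
have e20 : 0 < complex.Re e / 2 by rewrite divr_gt0.
near=> n.
have h1 : `|complex.Re l - complex.Re (u n)| < complex.Re e / 2.
  by near: n; exact: cR.
have h2 : `|complex.Im l - complex.Im (u n)| < complex.Re e / 2.
  by near: n; exact: cI.
rewrite ltcE /= -eI eqxx /=.
apply: le_lt_trans (normc_le_add _) _.
move: h1 h2; case: (l) => x y; case: (u n) => x' y' /=; lra.
Unshelve. all: by end_near.
Qed.

Lemma Re_series (u : nat -> R[i]) n :
  complex.Re (series u n) = series (fun k => complex.Re (u k)) n.
Proof.
by rewrite /series/=; apply: (big_morph (@complex.Re R)) => // -[x y] [x' y'].
Qed.

Lemma Im_series (u : nat -> R[i]) n :
  complex.Im (series u n) = series (fun k => complex.Im (u k)) n.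
Proof.
by rewrite /series/=; apply: (big_morph (@complex.Im R)) => // -[x y] [x' y'].
Qed.

Lemma weighted_Lp_parts p a b beta gam (psi : R -> R[i]) : 0 <= p ->
  weighted_Lp p a b beta gam psi ->
  intg `]a, b[ (fun x => `|complex.Re (psi x)| `^ p * weight a b beta gam x) /\
  intg `]a, b[ (fun x => `|complex.Im (psi x)| `^ p * weight a b beta gam x).
Proof.
move=> p0 [mR mI fin].
have mD : measurable (`]a, b[%classic : set RT) by exact: mitv.
have mw := @measurable_weight R a b beta gam.
have w0 := weight_ge0 a b beta gam.
have mN : measurable_fun (`]a,
  b[%classic : set RT) (fun x => Normc.normc (psi x)).
  rewrite (_ : (fun x => _) = fun x =>
      (complex.Re (psi x) ^+ 2 + complex.Im (psi x) ^+ 2) `^ 2^-1); last first.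
    by apply/funext => x; exact: normc_powE.
  apply: measurable_powR_comp; apply: measurable_funD; exact: measurable_funX.
have iN : intg `]a, b[ (fun x => Normc.normc (psi x) `^ p * weight a b beta gam
  x).
  apply/integrableP; split.
    by apply/measurable_EFinP; apply: measurable_funM => //;
      exact: measurable_powR_comp.
  apply: le_lt_trans fin; rewrite le_eqVlt; apply/orP; left; apply/eqP.
  apply: eq_integral => x _ /=.
  by rewrite ger0_norm// mulr_ge0// powR_ge0.
split; apply: (intg_le mD _ _ iN).
- by apply: measurable_funM => //; apply: measurable_powR_comp;
    exact: measurableT_comp.
- move=> x _; rewrite ger0_norm ?mulr_ge0 ?powR_ge0//; apply: ler_wpM2r => //.
  by apply: powR_homo_le => //; exact: normr_Re_le.
- by apply: measurable_funM => //; apply: measurable_powR_comp;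
    exact: measurableT_comp.
- move=> x _; rewrite ger0_norm ?mulr_ge0 ?powR_ge0//; apply: ler_wpM2r => //.
  by apply: powR_homo_le => //; exact: normr_Im_le.
Qed.

Variables (a b beta gam : R).
Local Notation D := (`]a, b[%classic : set RT).
Local Notation Jp := (jacobi_poly a b beta gam).
Local Notation w := (weight a b beta gam).

Lemma Re_jacobi_coef g n :
  complex.Re (jacobi_coef a b beta gam g n) = jcoef a b beta gam (fun x =>
    complex.Re (g x)) n.
Proof. by apply: eq_int => x _; exact: Re_mulr_real. Qed.

Lemma Im_jacobi_coef g n :
  complex.Im (jacobi_coef a b beta gam g n) = jcoef a b beta gam (fun x =>
    complex.Im (g x)) n.
Proof. by apply: eq_int => x _; exact: Im_mulr_real. Qed.

Lemma Re_RL_integral alpha g x :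
  complex.Re (RL_integral a alpha g x) =
  (Gamma alpha)^-1 * rl_real a alpha (fun t => complex.Re (g t)) x.
Proof.
rewrite Re_real_mul; congr (_ * _).
by apply: eq_int => t _; exact: Re_mulr_real.
Qed.

Lemma Im_RL_integral alpha g x :
  complex.Im (RL_integral a alpha g x) =
  (Gamma alpha)^-1 * rl_real a alpha (fun t => complex.Im (g t)) x.
Proof.
rewrite Im_real_mul; congr (_ * _).
by apply: eq_int => t _; exact: Im_mulr_real.
Qed.

Lemma Cintegrable_jacobi g n :
  Cintegrable `]a, b[ (jacobi_integrand a b beta gam g n) <->
  intg D (fun x => complex.Re (g x) * ((Jp n).[x] * w x)) /\
  intg D (fun x => complex.Im (g x) * ((Jp n).[x] * w x)).
Proof.
have mD : measurable D by exact: mitv.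
split=> -[h1 h2]; split; [apply: (eq_intg _ _ h1)|apply: (eq_intg _ _ h2)|
  apply: (eq_intg _ _ h1)|apply: (eq_intg _ _ h2)] => //= x _;
  by rewrite ?Re_mulr_real ?Im_mulr_real.
Qed.

End complex_tools.

(** Jacobi coefficients determine a function only almost everywhere. The identity with f is
    therefore split: the fractional integral exists almost everywhere, it has the sums of the series
    as coefficients, and any function with these coefficients agrees with it almost everywhere.
    Since an integral has a value even when it diverges, integrability is asserted along with the
    values. *)
Theorem theorem1 (R : realType) (a b alpha beta gam p : R) (psi : R -> R[i])
    (hab : a < b)
    (hbeta : - (1 / 2) <= beta <= 1 / 2) (hgam : - (1 / 2) <= gam <= 1 / 2)
    (hMp : (exponent_M beta gam < p%:E)%E) (hpm : (p%:E < exponent_m beta gam)%E)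
    (halpha : 0 < alpha < 1)
    (hpsi : weighted_Lp p a b beta gam psi) :
  exists f_ : nat -> R[i],
    [/\ forall m, Cseries_cvg (fun n => (-1) ^+ n *
            jacobi_coef a b beta gam psi n *
            (jacobi_A a b alpha beta gam m n)%:C) (f_ m),
        infmx_mul_eq (jacobi_matrix a b alpha beta gam)
          (jacobi_coef a b beta gam psi) f_,
        {ae (@lebesgue_measure R), forall x : R, x \in `]a, b[ ->
          Cintegrable `]a, x[ (RL_integrand alpha psi x)},
        has_jacobi_coefs a b beta gam (RL_integral a alpha psi) f_ &
        forall f : R -> R[i], has_jacobi_coefs a b beta gam f f_ ->
          {ae (@lebesgue_measure R), forall x : R, x \in `]a, b[ ->
            RL_integral a alpha psi x = f x}].
Proof.
have [kap [del [hkap hdel hkd dp [hs ht]]]] := exponent_params hbeta hgam hMp.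
have p0 : 0 <= p by case/andP : hdel => d0 _; lra.
have [mR mI _] := hpsi; have [iR iI] := weighted_Lp_parts p0 hpsi.
have gR := Lp_intg hab hbeta hgam hdel dp hs ht mR iR.
have gI := Lp_intg hab hbeta hgam hdel dp hs ht mI iI.
have cR := rl_coefficient hab halpha hbeta hgam hkap hdel hkd mR gR.
have cI := rl_coefficient hab halpha hbeta hgam hkap hdel hkd mI gI.
have aR := rl_integrand_ae hab halpha hbeta hgam hkap hdel mR gR.
have aI := rl_integrand_ae hab halpha hbeta hgam hkap hdel mI gI.
have FF := ae_filter_ringOfSetsType (@lebesgue_measure R).
(* The witness is the coefficient sequence of the fractional integral itself; the content is that
   the series converge to it. *)
pose f_ := jacobi_coef a b beta gam (RL_integral a alpha psi).
have main m : Cseries_cvg (fun n => (-1) ^+ n * jacobi_coef a b beta gam psi n *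
    (jacobi_A a b alpha beta gam m n)%:C) (f_ m).
  have termE n : (-1) ^+ n * jacobi_coef a b beta gam psi n *
      (jacobi_A a b alpha beta gam m n)%:C =
      jacobi_coef a b beta gam psi n *
        ((-1) ^+ n * jacobi_A a b alpha beta gam m n)%:C.
    by rewrite signr_complex mulrA (mulrC ((-1) ^+ n)).
  apply: cvg_complex.
  - rewrite Re_jacobi_coef /jcoef.
    under eq_fun do rewrite Re_series.
    rewrite (@eq_int _ _ _ (fun x => (Gamma alpha)^-1 *
      rl_real a alpha (fun t => complex.Re (psi t)) x *
      ((jacobi_poly a b beta gam m).[x] * weight a b beta gam x))); last first.
      by move=> x _; rewrite Re_RL_integral.
    rewrite (_ : (fun n => _) = series (fun n => (-1) ^+ n *
      jcoef a b beta gam (fun t => complex.Re (psi t)) n *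
        jacobi_A a b alpha beta gam m n)).
      by have [] := cR m.
    apply/funext => N; apply: eq_bigr => n _.
    by rewrite termE Re_mulr_real Re_jacobi_coef mulrA
      (mulrC (jcoef _ _ _ _ _ _)).
  - rewrite Im_jacobi_coef /jcoef.
    under eq_fun do rewrite Im_series.
    rewrite (@eq_int _ _ _ (fun x => (Gamma alpha)^-1 *
      rl_real a alpha (fun t => complex.Im (psi t)) x *
      ((jacobi_poly a b beta gam m).[x] * weight a b beta gam x))); last first.
      by move=> x _; rewrite Im_RL_integral.
    rewrite (_ : (fun n => _) = series (fun n => (-1) ^+ n *
      jcoef a b beta gam (fun t => complex.Im (psi t)) n *
        jacobi_A a b alpha beta gam m n)).
      by have [] := cI m.
    apply/funext => N; apply: eq_bigr => n _.
    by rewrite termE Im_mulr_real Im_jacobi_coef mulrA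
      (mulrC (jcoef _ _ _ _ _ _)).
have rlR m : intg (`]a, b[%classic : set (measurableTypeR R))
    (fun x => complex.Re (RL_integral a alpha psi x) *
      ((jacobi_poly a b beta gam m).[x] * weight a b beta gam x)).
  have [i _] := cR m; apply: (eq_intg _ _ i) => [|x _]; first exact: mitv.
  by rewrite Re_RL_integral.
have rlI m : intg (`]a, b[%classic : set (measurableTypeR R))
    (fun x => complex.Im (RL_integral a alpha psi x) *
      ((jacobi_poly a b beta gam m).[x] * weight a b beta gam x)).
  have [i _] := cI m; apply: (eq_intg _ _ i) => [|x _]; first exact: mitv.
  by rewrite Im_RL_integral.
exists f_; split => //.
- move=> m; have := main m; rewrite /Cseries_cvg.
  rewrite (_ : (fun n => _) = (fun n => jacobi_matrix a b alpha beta gam m n *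
    jacobi_coef a b beta gam psi n))//.
  apply/funext => n; rewrite /jacobi_matrix signr_complex.
  by rewrite -mulrA (mulrC (jacobi_coef _ _ _ _ _ _)) mulrA.
- apply: (@filterS2 _ _ FF _ _ _ _ aR aI) => x h1 h2; rewrite in_itv/= => hx.
  split.
  + apply: (eq_intg _ _ (h1 hx)) => [|t _]; first exact: mitv.
    by rewrite Re_mulr_real.
  + apply: (eq_intg _ _ (h2 hx)) => [|t _]; first exact: mitv.
    by rewrite Im_mulr_real.
- by move=> n; split => //; apply/Cintegrable_jacobi; split.
- move=> f hf.
  have uR : {ae @lebesgue_measure R, forall x, a < x < b ->
      complex.Re (RL_integral a alpha psi x) = complex.Re (f x)}.
    apply: (jcoef_inj_ae hab hbeta hgam) => n.
    have [/Cintegrable_jacobi[i1 _] E] := hf n; split => //.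
    by rewrite -!Re_jacobi_coef E.
  have uI : {ae @lebesgue_measure R, forall x, a < x < b ->
      complex.Im (RL_integral a alpha psi x) = complex.Im (f x)}.
    apply: (jcoef_inj_ae hab hbeta hgam) => n.
    have [/Cintegrable_jacobi[_ i1] E] := hf n; split => //.
    by rewrite -!Im_jacobi_coef E.
  apply: (@filterS2 _ _ FF _ _ _ _ uR uI) => x h1 h2; rewrite in_itv/= => hx.
  have := h1 hx; have := h2 hx.
  by case: (RL_integral a alpha psi x) => u v; case: (f x) => u' v' /= -> ->.
Qed.
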